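(* Let $C\subset L^3_2$ be a tropical curve of degree $d$, and assume that $\mathrm{char}(K)=0$ or $\mathrm{char}(K)\ge d$. Moreover, let $\{i,j,k,l\}=\{0,1,2,3\}$ be such that $C$ intersects neither $\mathrm{cone}([e_i],[e_j])$, nor $\mathrm{cone}([e_i],[e_i+e_k])$, nor $\mathrm{cone}([e_i],[e_i+e_l])$. If $$c_1:=\sum_{ae_j+be_k\in P(C)}a\ \ne\ \sum_{ae_i+be_k\in P(C)}a=:c_2,$$ and $0<c_2<d$, then $C$ is not realizable in $L$.
   Context: Let $K$ be an algebraically closed field, $S=K[x_0^{\pm1},\dots,x_3^{\pm1}]$, $S_0$ its degree-$0$ part, $X=\mathrm{Spec}(S_0)$ the $3$-dimensional torus, $L=(x_0+x_1+x_2+x_3)\subset S$, $L_0=L\cap S_0$, and $E=\mathrm{Spec}(S_0/L_0)$. In $\mathbb R^4/\langle\mathbf 1\rangle$, $\mathbf 1=(1,1,1,1)$, with lattice $\mathbb Z^4/\langle\mathbf 1\rangle$, write $[v]$ for the class of $v$ and $e_0,\dots,e_3$ for the unit vectors. $L^3_2=\mathrm{trop}(E)$ is the $2$-dimensional fan with maximal cones $\mathrm{cone}([e_i],[e_j])$, $i<j$, all of multiplicity $1$. A tropical curve in $L^3_2$ is a $1$-dimensional rational fan with support in $L^3_2$ and non-negative integer multiplicities $m(\sigma)$ on its rays with $\sum_\sigma m(\sigma)u_\sigma=0$, where $u_\sigma$ is the primitive lattice generator of $\sigma$. $P(C)\subset\mathbb Z^4$ is the set of vectors $m(\sigma)v_\sigma$,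 one for each ray $\sigma$ of $C$ of positive multiplicity, with $v_\sigma\in\mathbb Z^4$ the representative of $u_\sigma$ with minimal coordinate $0$. The degree of $C$ is the number $d$ with $\sum_{v\in P(C)}v=d\cdot\mathbf 1$. That $C$ does not intersect a (closed) cone means that its support meets the cone only in the origin. Tropicalization (trivial valuation, min-convention): for $f=\sum_\nu a_\nu x^\nu\in S_0$ and $\omega\in\mathbb R^4$ let $\mathrm{in}_\omega(f)$ be the sum of the terms $a_\nu x^\nu$, $a_\nu\ne0$, with $\omega\cdot\nu$ minimal; $\mathrm{in}_\omega(I)$ is the ideal generated by all $\mathrm{in}_\omega(f)$, $f\in I$. For an irreducible curve $Y\subset X$ with prime ideal $P\subset S_0$, $\mathrm{trop}(Y)\subset\mathbb R^4/\langle\mathbf 1\rangle$ is the image of $\{\omega:\mathrm{in}_\omega(P)\ne S_0\}$, with multiplicity $\sum_Q\ell((S_0/\mathrm{in}_\omega(P))_Q)$ on a ray $\sigma$, where $\omega$ is in the relative interior of $\sigma$ and $Q$ runs over the minimal primes of $\mathrm{in}_\omega(P)$. Extend this linearly to a map $\mathrm{Trop}$ on $1$-cycles. $C$ is realizable in $L$ if there is an effective $1$-cycle $Y$ in $E$ (a non-negative integer combination of irreducible curves in $E$) with $\mathrm{Trop}(Y)=C$. *)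

(* Defs.v *)
From HB Require Import structures.
From mathcomp Require Import all_boot all_order all_algebra finmap monalg.
From mathcomp Require Import boolp classical_sets reals ereal esum.

Set Implicit Arguments.
Unset Strict Implicit.
Unset Printing Implicit Defensive.

Import Order.TTheory GRing.Theory Num.Theory.

Local Open Scope ring_scope.

(* The exponent vectors of [n] variables form the group ['rV[int]_n].  As
   [monalg] puts a ring structure on [{malg K[G]}] only for monoids without
   nontrivial units, the product is defined here, on an alias of that module. *)
Definition laurent (K : fieldType) (n : nat) := {malg K['rV[int]_n]}.

HB.instance Definition _ (K : fieldType) (n : nat) :=
  GRing.Lmodule.copy (laurent K n) {malg K['rV[int]_n]}.

HB.lock Definition lmul (K : fieldType) (n : nat) (f g : laurent K n) :
    laurent K n :=
  \sum_(u <- msupp f) \sum_(v <- msupp g) << f@_u * g@_v *g u + v >>.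

Section LaurentRing.
Variables (K : fieldType) (n : nat).
Implicit Types (f g h : laurent K n) (u v : 'rV[int]_n).

Definition lmonom (v : 'rV[int]_n) : laurent K n := << v >>.

Local Notation lmul := (@lmul K n).

Let lmulw (d1 d2 : {fset 'rV[int]_n}) f g :
  (msupp f `<=` d1)%fset -> (msupp g `<=` d2)%fset ->
  lmul f g = \sum_(u <- d1) \sum_(v <- d2) << f@_u * g@_v *g u + v >>.
Proof.
move=> le_d1 le_d2; rewrite lmul.unlock (big_fset_incl _ le_d1) /=.
  apply/eq_bigr=> u _; apply/big_fset_incl => // v _ /mcoeff_outdom ->.
  by rewrite mulr0 monalgU0.
move=> u _ /mcoeff_outdom fu.
by rewrite big1 => // v _; rewrite fu mul0r monalgU0.
Qed.

Let lmulC : commutative lmul.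
Proof.
move=> f g; rewrite lmul.unlock exchange_big /=.
by apply/eq_bigr=> u _; apply/eq_bigr=> v _; rewrite mulrC addrC.
Qed.

Let lmul0f : left_zero 0 lmul.
Proof. by move=> g; rewrite lmul.unlock msupp0 big_seq_fset0. Qed.

Let lmulf0 : right_zero 0 lmul.
Proof. by move=> g; rewrite lmulC lmul0f. Qed.

Let lmulDl : left_distributive lmul +%R.
Proof.
move=> f g h; set d := (msupp f `|` msupp g)%fset.
rewrite (@lmulw d (msupp h) (f + g)) ?fsubset_refl ?msuppD_le //.
rewrite (@lmulw d (msupp h) f) ?fsubset_refl ?fsubsetUl //.
rewrite (@lmulw d (msupp h) g) ?fsubset_refl ?fsubsetUr //.
rewrite -big_split /=; apply/eq_bigr=> u _.
rewrite -big_split /=; apply/eq_bigr=> v _.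
by rewrite mcoeffD mulrDl monalgUD.
Qed.

Let lmulDr : right_distributive lmul +%R.
Proof. by move=> h f g; rewrite lmulC lmulDl ![lmul _ h]lmulC. Qed.

Lemma lmulUU (a b : K) u v :
  lmul << a *g u >> << b *g v >> = << a * b *g u + v >>.
Proof. by rewrite (lmulw msuppU_le msuppU_le) !big_seq_fset1 !mcoeffUU. Qed.

Let lmul_suml (I : Type) (r : seq I) (F : I -> laurent K n) g :
  lmul (\sum_(i <- r) F i) g = \sum_(i <- r) lmul (F i) g.
Proof. exact: (big_morph (lmul^~ g) (fun x y => lmulDl x y g) (lmul0f g)). Qed.

Let lmul_sumr (I : Type) (r : seq I) (F : I -> laurent K n) g :
  lmul g (\sum_(i <- r) F i) = \sum_(i <- r) lmul g (F i).
Proof. exact: (big_morph (lmul g) (lmulDr g) (lmulf0 g)). Qed.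

Lemma laurentE f :
  f = \sum_(u <- msupp f) (<< f@_u *g u >> : laurent K n) :> laurent K n.
Proof. exact: monalgE. Qed.

Let lmulA : associative lmul.
Proof.
move=> f g h; rewrite (laurentE f) !lmul_suml; apply: eq_bigr => u _.
rewrite (laurentE g) lmul_suml !lmul_sumr lmul_suml; apply: eq_bigr => v _.
rewrite (laurentE h) !lmul_sumr; apply: eq_bigr => w _.
by rewrite !lmulUU mulrA addrA.
Qed.

Let lmul1 : left_id (lmonom 0) lmul.
Proof.
move=> f; rewrite {1}[f]monalgE lmul_sumr [RHS]monalgE.
by apply: eq_bigr => u _; rewrite lmulUU mul1r add0r.
Qed.

Let lone_neq0 : lmonom 0 != 0.
Proof. by rewrite monalgU_eq0 oner_eq0. Qed.

HB.instance Definition _ := GRing.Zmodule_isComNzRing.Build (laurent K n)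
  lmulA lmulC lmul1 lmulDl lone_neq0.

Lemma lmulE f g : f * g =
  \sum_(u <- msupp f) \sum_(v <- msupp g) << f@_u * g@_v *g u + v >>.
Proof. by rewrite -[f * g]/(lmul f g) lmul.unlock. Qed.

Definition expo_deg (v : 'rV[int]_n) : int := \sum_i v 0 i.

Definition deg0_pred f := all (fun v => expo_deg v == 0) (msupp f).
Definition deg0 := [qualify a f | deg0_pred f].

Lemma deg0P f :
  reflect (forall v, v \in msupp f -> expo_deg v = 0) (f \is a deg0).
Proof.
by apply: (iffP allP) => H v vf; [exact/eqP/H | apply/eqP/H].
Qed.

Lemma expo_degD u v : expo_deg (u + v) = expo_deg u + expo_deg v.
Proof. by rewrite -big_split; apply: eq_bigr => i _; rewrite mxE. Qed.

Lemma deg0U (a : K) v : expo_deg v = 0 -> (<< a *g v >> : laurent K n) \is a deg0.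
Proof. by move=> v0; apply/deg0P => w /(fsubsetP msuppU_le); rewrite inE => /eqP->. Qed.

Let deg0_add : {in deg0 &, forall f g, f + g \is a deg0}.
Proof.
move=> f g /deg0P Hf /deg0P Hg; apply/deg0P => v /(fsubsetP (msuppD_le _ _)).
by rewrite in_fsetU => /orP[/Hf|/Hg].
Qed.

Let deg0_opp g : g \is a deg0 -> - g \is a deg0.
Proof. by move=> /deg0P Hg; apply/deg0P => v; rewrite msuppN; apply: Hg. Qed.

Let deg00 : 0 \is a deg0.
Proof. by apply/deg0P => v; rewrite msupp0. Qed.

Let deg0_sum (I : eqType) (r : seq I) (P : pred I) (F : I -> laurent K n) :
  (forall i, i \in r -> P i -> F i \is a deg0) ->
  \sum_(i <- r | P i) F i \is a deg0.
Proof.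
move=> H; rewrite big_seq_cond.
apply: (big_rec (fun f => f \is a deg0)) => [|i f].
  exact: deg00.
by case/andP=> ir Pi; apply: deg0_add; apply: H.
Qed.

Let deg0_subring : subring_closed deg0_pred.
Proof.
split=> [|f g Hf Hg|f g /deg0P Hf /deg0P Hg].
- by apply: deg0U; rewrite /expo_deg big1 // => i _; rewrite mxE.
- exact: (deg0_add Hf (deg0_opp Hg)).
- rewrite lmulE; apply: deg0_sum => u uf _; apply: deg0_sum => v vg _.
  by apply: deg0U; rewrite expo_degD Hf // Hg.
Qed.

HB.instance Definition _ :=
  GRing.isSubringClosed.Build (laurent K n) deg0_pred deg0_subring.

Record laurent0 := Laurent0 {
  laurent0_val :> laurent K n; _ : laurent0_val \is a deg0 }.

HB.instance Definition _ := [isSub for laurent0_val].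
HB.instance Definition _ := [Choice of laurent0 by <:].
HB.instance Definition _ := [SubChoice_isSubComNzRing of laurent0 by <:].

Variable R : realType.

Definition expo_weight (w : 'rV[R]_n) (v : 'rV[int]_n) : R :=
  \sum_i w 0 i * (v 0 i)%:~R.

Definition initial_form (w : 'rV[R]_n) f : laurent K n :=
  \sum_(u <- msupp f |
        all (fun v => expo_weight w u <= expo_weight w v) (msupp f))
    << f@_u *g u >>.

Lemma initial_form_deg0 w f : f \is a deg0 -> initial_form w f \is a deg0.
Proof. by move=> /deg0P Hf; apply: deg0_sum => u uf _; apply/deg0U/Hf. Qed.

Definition initial_form0 (w : 'rV[R]_n) (f : laurent0) : laurent0 :=
  Laurent0 (initial_form_deg0 w (valP f)).

End LaurentRing.

Local Open Scope classical_set_scope.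

Definition has_chain (T : Type) (F : set (set T)) (n : nat) : Prop :=
  exists c : nat -> set T,
    (forall i, (i <= n)%N -> F (c i)) /\
    (forall i, (i < n)%N -> c i `<` c i.+1).

Section Ideals.
Variable A : comNzRingType.
Implicit Types (I J P Q : set A) (N : set (A * A)).

Definition is_ideal I : Prop :=
  [/\ I 0, forall a b, I a -> I b -> I (a + b) & forall a b, I b -> I (a * b)].

Definition ideal_gen (G : set A) : set A := smallest is_ideal G.

Definition is_prime P : Prop :=
  [/\ is_ideal P, ~ P 1 & forall a b, P (a * b) -> P a \/ P b].

Definition primes_over J : set (set A) := [set P | is_prime P /\ J `<=` P].

Definition minimal_primes J : set (set A) :=
  [set Q | primes_over J Q /\
           forall P, primes_over J P -> P `<=` Q -> P = Q].

Definition has_krull_dim J (n : nat) : Prop :=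
  has_chain (primes_over J) n /\ ~ has_chain (primes_over J) n.+1.

(* The localization [(A/J)_Q] is the set of fractions [(a, s)], [s \notin Q],
   modulo [loc_eq]; its elements are represented by such pairs, and its
   [A_Q]-submodules by the corresponding sets of pairs. *)
Definition loc_eq J Q (x y : A * A) : Prop :=
  exists u, ~ Q u /\ J (u * (y.2 * x.1 - x.2 * y.1)).

Definition loc_submodule J Q N : Prop :=
  [/\ N `<=` [set x | ~ Q x.2],
      forall x y, N x -> ~ Q y.2 -> loc_eq J Q x y -> N y,
      N (0, 1),
      forall x y, N x -> N y -> N (y.2 * x.1 + x.2 * y.1, x.2 * y.2) &
      forall c t x, ~ Q t -> N x -> N (c * x.1, t * x.2)].

Definition loc_length (R : realType) J Q : \bar R :=
  ereal_sup [set (n%:R)%:E | n in has_chain (loc_submodule J Q)].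

End Ideals.

Section Plane.
Variable K : fieldType.

Local Notation S := (laurent K 4).
Local Notation S0 := (laurent0 K 4).

Definition L : set S :=
  ideal_gen [set \sum_(i < 4) lmonom K (delta_mx 0 i)].

Definition L0 : set S0 := [set f | L (val f)].

(* Curves in [Spec (S0/L0)] are given by their prime ideals in [S0]. *)
Definition curve_in_E (P : set S0) : Prop :=
  [/\ is_prime P, has_krull_dim P 1 & L0 `<=` P].

Variable R : realType.

Definition initial_ideal (w : 'rV[R]_4) (I : set S0) : set S0 :=
  ideal_gen (initial_form0 w @` I).

(* The sum is empty, hence [0], if the initial ideal is the whole ring, that is
   if [w] is not in [trop(Y)]. *)
Definition trop_mult (P : set S0) (w : 'rV[R]_4) : \bar R :=
  let J := initial_ideal w P in
  (\esum_(Q in minimal_primes J) loc_length R J Q)%E.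

(* A 1-cycle is a formal sum of irreducible curves, here a list of pairs of
   a coefficient and a curve. *)
Definition cycle_trop_mult (Y : seq (nat * set S0)) (w : 'rV[R]_4) : \bar R :=
  (\sum_(y <- Y) (y.1%:R)%:E * trop_mult y.2 w)%E.

End Plane.

Definition same_class (v v' : 'rV[int]_4) : Prop :=
  exists s : int, v = v' + const_mx s.

Definition min0 (v : 'rV[int]_4) : Prop :=
  (forall i, 0 <= v 0 i) /\ (exists i, v 0 i = 0).

(* Excludes the zero class: [n = 0] would be a solution. *)
Definition primitive_class (v : 'rV[int]_4) : Prop :=
  forall (n : nat) (v' : 'rV[int]_4), same_class v (v' *+ n) -> n = 1%N.

(* A one-dimensional rational fan with multiplicities: a ray is represented by
   the vector [v_sigma], and [C v_sigma] is its multiplicity. *)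
Definition weighted_fan := {fsfun 'rV[int]_4 -> nat with 0%N}.

Definition evec (i : 'I_4) : 'rV[int]_4 := delta_mx 0 i.

Section Cones.
Variable R : realType.

(* Subsets of [R^4/<1>] are represented by their preimages in [R^4]; in
   particular [cone [::]] represents the origin. *)
Definition cone (gs : seq 'rV[int]_4) : set 'rV[R]_4 :=
  [set w | exists (t : 'rV[int]_4 -> R) (s : R), (forall g, 0 <= t g) /\
     w = \sum_(g <- gs) t g *: map_mx intr g + const_mx s].

Definition L32 : set 'rV[R]_4 :=
  [set w | exists i j : 'I_4, (i < j)%N /\ cone [:: evec i; evec j] w].

Definition fan_support (C : weighted_fan) : set 'rV[R]_4 :=
  [set w | cone [::] w \/ exists2 v, v \in finsupp C & cone [:: v] w].

Definition tropical_curve (C : weighted_fan) : Prop :=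
  [/\ forall v, v \in finsupp C -> min0 v /\ primitive_class v,
      same_class (\sum_(v <- finsupp C) v *+ C v) 0 &
      fan_support C `<=` L32].

Definition intersects (C : weighted_fan) (gs : seq 'rV[int]_4) : Prop :=
  exists w, [/\ fan_support C w, cone gs w & ~ cone [::] w].

(* Only meaningful for [w] not representing the origin: then at most one ray
   contains [w], and it does so in its relative interior. *)
Definition fan_mult (C : weighted_fan) (w : 'rV[R]_4) : nat :=
  (\sum_(v <- finsupp C | `[< cone [:: v] w >]) C v)%N.

Definition realizable_in_L (K : fieldType) (C : weighted_fan) : Prop :=
  exists Y : seq (nat * set (laurent0 K 4)),
    (forall y, y \in Y -> curve_in_E y.2) /\
    forall w, ~ cone [::] w -> cycle_trop_mult Y w = ((fan_mult C w)%:R)%:E.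

End Cones.

Definition PC (C : weighted_fan) : {fset 'rV[int]_4} :=
  [fset v *+ C v | v in finsupp C]%fset.

Definition has_degree (C : weighted_fan) (d : nat) : Prop :=
  \sum_(v <- PC C) v = const_mx d%:Z.

(* The vectors [a e_j + b e_k] of [P(C)], each contributing [a]. *)
Definition first_coef_sum (C : weighted_fan) (j k : 'I_4) : int :=
  \sum_(v <- PC C | v == v 0 j *: evec j + v 0 k *: evec k) v 0 j.

(* Main.v *)
(* The plane E is cut out of the torus by x_0 + ... + x_3 = 0, so in the chart
   X = x_p/x_s, Y = x_q/x_s (where x_r/x_s = -(1 + X + Y)) an irreducible curve
   has one equation f(X, Y), and its tropical multiplicity along
   a[e_p] + b[e_q] is the number of nonzero roots of the corresponding face of
   f (roots equal to -1 also excluded if b = 0).  Apply this to a curve whose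
   tropicalization avoids the three cones.  In the chart (p,q,r,s) = (i,k,j,l):
   - the Newton polygon gives f(0, Y) order n = sum of a * multiplicity over the
     rays a[e_i] + b[e_k]; as neither [e_i] nor cone([e_i],[e_j]) is met,
     f(0, Y) = alpha Y^n;
   - the two cones ([e_i],[e_i+e_k]) and ([e_i],[e_i+e_l]) being avoided, f has
     no term linear in X, so f = alpha Y^n mod X^2.
   In the chart (j,k,i,l) the equation restricted to its axis is f(-(1+Y), Y),
   hence congruent to alpha Y^n mod (1+Y)^2, and it is beta Y^n' (1+Y)^m, since
   [e_j] is avoided, where n' is the sum for the rays a[e_j] + b[e_k].  Comparing
   values and logarithmic derivatives at Y = -1 gives m = 0 and n = n' in K.
   Summing over the components of a cycle, c_1 = c_2 in K, which is impossible
   in the given characteristic for distinct c_1 <= d and 0 < c_2 < d. *)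

Require Import Defs.
From HB Require Import structures.
From mathcomp Require Import all_boot all_order all_algebra finmap monalg.
From mathcomp Require Import boolp classical_sets fsbigop reals ereal esum.
From mathcomp Require Import fraction ring lra zify.

Set Implicit Arguments.
Unset Strict Implicit.
Unset Printing Implicit Defensive.

Import Order.TTheory GRing.Theory Num.Theory.
Local Open Scope ring_scope.
Local Open Scope classical_set_scope.

(** * Ideals and evaluation of Laurent polynomials *)

(** Geometrically, [Y = -1] on the line [x_j = 0] is the point where this line meets [x_i = 0]. A
    congruence modulo [x_i^2] therefore fixes both the value and the first derivative of the
    restriction to [x_j = 0] at that point. This is why order two suffices, and why the exponents
    are compared only as elements of [K].

    The obstacle is that multiplicities are lengths over localizations of [S_0/in_w(P)], while the
    argument is about polynomials in two variables. [S_0/L_0] is [K[X,Y]] with [X], [Y] and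
    [1 + X + Y] inverted. Nothing is inverted here: a Laurent polynomial is multiplied by
    [(x_0 x_1 x_2 x_3)^n] for a large [n] and then evaluated, and ideals are compared up to such
    factors. A unimodular monomial substitution turns the weight into the order in one variable [T],
    so that the initial ideal is read off a lowest coefficient.

    The bounds fit the characteristic because [0 <= c_1 <= d] and [0 < c_2 < d] give
    [|c_1 - c_2| < d]. A difference of exactly [d], which may be the characteristic, is thereby
    excluded. *)

Section IdealTheory.
Variables (A : comNzRingType) (I : set A).
Hypothesis idI : is_ideal I.

Lemma ideal0 : I 0. Proof. by case: idI. Qed.
Lemma idealD a b : I a -> I b -> I (a + b). Proof. by case: idI => _ + _; apply. Qed.
Lemma idealMl a b : I b -> I (a * b). Proof. by case: idI => _ _; apply. Qed.
Lemma idealMr a b : I a -> I (a * b). Proof. by rewrite mulrC; apply: idealMl. Qed.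
Lemma idealN a : I a -> I (- a). Proof. by rewrite -mulN1r; apply: idealMl. Qed.
Lemma idealB a b : I a -> I b -> I (a - b).
Proof. by move=> Ia Ib; apply: idealD => //; apply: idealN. Qed.

Lemma ideal_sum (T : eqType) (r : seq T) (F : T -> A) :
  (forall t, t \in r -> I (F t)) -> I (\sum_(t <- r) F t).
Proof.
move=> IF; rewrite big_seq; apply: big_ind => //; first exact: ideal0.
exact: idealD.
Qed.

Lemma idealBC a b : I (a - b) -> I (b - a).
Proof. by move=> /idealN; rewrite opprB. Qed.

(** Congruence modulo [I] is written [I (a - b)] throughout, in place of equality in a quotient
    ring; this and the next lemmas make it compatible with products and powers. *)
Lemma idealB_mul a b c d : I (a - b) -> I (c - d) -> I (a * c - b * d).
Proof.
move=> h1 h2; have -> : a * c - b * d = c * (a - b) + b * (c - d).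
  by rewrite !mulrBr [c * a]mulrC [c * b]mulrC addrA subrK.
by apply: idealD; apply: idealMl.
Qed.

Lemma idealB_exp a b n : I (a - b) -> I (a ^+ n - b ^+ n).
Proof.
move=> h; elim: n => [|n IH]; first by rewrite !expr0 subrr; apply: ideal0.
by rewrite !exprS; apply: idealB_mul.
Qed.

Lemma idealB_prod (T : Type) (r : seq T) (F G : T -> A) :
  (forall t, I (F t - G t)) -> I (\prod_(t <- r) F t - \prod_(t <- r) G t).
Proof.
move=> FG; elim: r => [|t r IH]; first by rewrite !big_nil subrr; apply: ideal0.
by rewrite !big_cons; apply: idealB_mul.
Qed.

Lemma idealB_mem a b : I (a - b) -> I b -> I a.
Proof. by move=> h1 /(idealD h1); rewrite subrK. Qed.

Lemma ideal_unit a b : a * b = 1 -> forall c, I (a * c) -> I c.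
Proof.
move=> ab1 c /(idealMl b); rewrite mulrA [b * a]mulrC ab1 mul1r //.
Qed.

End IdealTheory.

Lemma ideal_gen_ideal (A : comNzRingType) (G : set A) : is_ideal (ideal_gen G).
Proof.
split=> [J [[J0 _ _] _]|a b Ga Gb J idJ|a b Gb J idJ] //.
- by apply: (idealD idJ.1); [exact: Ga | exact: Gb].
- by apply: (idealMl idJ.1); exact: Gb.
Qed.

Lemma ideal_gen_sub (A : comNzRingType) (G : set A) : G `<=` ideal_gen G.
Proof. by move=> a Ga J [_]; apply. Qed.

Lemma ideal_gen_min (A : comNzRingType) (G J : set A) :
  is_ideal J -> G `<=` J -> ideal_gen G `<=` J.
Proof. by move=> idJ GJ a; apply. Qed.

Lemma prime_prod (A : comNzRingType) (P : set A) (I : eqType) (r : seq I)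
    (F : I -> A) : is_prime P -> P (\prod_(i <- r) F i) ->
  exists2 i, i \in r & P (F i).
Proof.
move=> [_ P1 PM]; elim: r => [|i r IH]; first by rewrite big_nil.
rewrite big_cons => /PM[Pi|/IH[j jr Pj]]; first by exists i; rewrite ?mem_head.
by exists j; rewrite // in_cons jr orbT.
Qed.

Lemma prime_exp (A : comNzRingType) (P : set A) a n :
  is_prime P -> P (a ^+ n) -> P a.
Proof.
move=> [_ P1 PM]; elim: n => [|n IH]; first by rewrite expr0.
by rewrite exprS => /PM[].
Qed.

Lemma prime_unit (A : comNzRingType) (P : set A) a b :
  is_prime P -> a * b = 1 -> ~ P a.
Proof. by move=> [idP P1 _] ab1 Pa; apply: P1; rewrite -ab1; apply: idealMr. Qed.

(** * Clearing denominators of Laurent polynomials *)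

Section Clear.
Variables (K : fieldType) (N : nat).
Implicit Types (g h : laurent K N) (v : 'rV[int]_N) (n : nat).

(* [g] has no exponent below [-n]: [(x_0 ... x_3)^n g] is a polynomial. *)
Definition bounded_below n g :=
  forall v, v \in msupp g -> forall c, 0 <= v 0 c + n%:Z.

Lemma bounded_below_exists g : exists n, bounded_below n g.
Proof.
exists (\sum_(v <- msupp g) \sum_c absz (v 0%R c))%N => v vg c.
have : (absz (v 0%R c) <= \sum_(v <- msupp g) \sum_c absz (v 0%R c))%N.
  rewrite (big_fsetD1 v) //= (bigD1 c) //= -addnA; exact: leq_addr.
rewrite -lez_nat abszE => /(le_trans _) le.
by rewrite -lerBlDl sub0r le // -normrN ler_norm.
Qed.

Lemma bounded_belowW n m g : (n <= m)%N -> bounded_below n g -> bounded_below m g.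
Proof.
move=> nm bg v vg c; apply: le_trans (bg v vg c) _.
by rewrite lerD2l lez_nat.
Qed.

Lemma bounded_belowD n g h : bounded_below n g -> bounded_below n h -> bounded_below n (g + h).
Proof.
by move=> bg bh v /(fsubsetP (msuppD_le _ _)); rewrite in_fsetU => /orP[/bg|/bh].
Qed.

Lemma bounded_belowU n (a : K) v :
  (forall c, 0 <= v 0 c + n%:Z) -> bounded_below n (<< a *g v >> : laurent K N).
Proof. by move=> bv w /(fsubsetP msuppU_le); rewrite inE => /eqP->. Qed.

Lemma bounded_below_sum n (T : eqType) (r : seq T) (F : T -> laurent K N) :
  (forall t, t \in r -> bounded_below n (F t)) -> bounded_below n (\sum_(t <- r) F t).
Proof.
move=> bF; rewrite big_seq; apply: big_ind => //; last exact: bounded_belowD.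
by move=> v; rewrite msupp0.
Qed.

Lemma bounded_belowM n m g h : bounded_below n g -> bounded_below m h -> bounded_below (n + m) (g * h).
Proof.
move=> bg bh; rewrite lmulE; apply: bounded_below_sum => u ug; apply: bounded_below_sum => v vh.
apply: bounded_belowU => c; rewrite mxE PoszD addrACA; apply: addr_ge0; [exact: bg|exact: bh].
Qed.

Lemma bounded_below2_exists g h : exists n, bounded_below n g /\ bounded_below n h.
Proof.
have [[n bn] [m bm]] := (bounded_below_exists g, bounded_below_exists h).
by exists (n + m)%N; split; [apply: bounded_belowW bn|apply: bounded_belowW bm]; rewrite ?leq_addr ?leq_addl.
Qed.

Section Eval.
Variables (B : comNzRingType) (iota : {rmorphism K -> B}) (z : 'I_N -> B).

(* The value at [z] of [(x_0 ... x_3)^n g], meaningful only if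
   [bounded_below n g], as [absz] gives junk at negative exponents. *)
Definition clr n g : B :=
  \sum_(v <- msupp g) iota g@_v * \prod_c z c ^+ absz (v 0 c + n%:Z).

Lemma clrEw (d : {fset 'rV[int]_N}) n g : (msupp g `<=` d)%fset ->
  clr n g = \sum_(v <- d) iota g@_v * \prod_c z c ^+ absz (v 0 c + n%:Z).
Proof.
move=> le_d; rewrite /clr (big_fset_incl _ le_d) //= => v _ /mcoeff_outdom ->.
by rewrite rmorph0 mul0r.
Qed.

Lemma clrD n : {morph clr n : g h / g + h}.
Proof.
move=> g h; set d := (msupp g `|` msupp h)%fset.
rewrite (@clrEw d n (g + h)) ?msuppD_le //.
rewrite (@clrEw d n g) ?fsubsetUl // (@clrEw d n h) ?fsubsetUr //.
rewrite -big_split; apply: eq_bigr => v _.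
by rewrite mcoeffD rmorphD mulrDl.
Qed.

Lemma clr0 n : clr n 0 = 0.
Proof. by rewrite /clr msupp0 big_seq_fset0. Qed.

Lemma clr_sum n (T : Type) (r : seq T) (F : T -> laurent K N) :
  clr n (\sum_(t <- r) F t) = \sum_(t <- r) clr n (F t).
Proof. exact: (big_morph _ (clrD n) (clr0 n)). Qed.

Lemma clrU n a v :
  clr n (<< a *g v >> : laurent K N) = iota a * \prod_c z c ^+ absz (v 0 c + n%:Z).
Proof. by rewrite (clrEw n msuppU_le) big_seq_fset1 mcoeffUU. Qed.

Lemma clrM n m g h : bounded_below n g -> bounded_below m h ->
  clr (n + m) (g * h) = clr n g * clr m h.
Proof.
move=> bg bh; rewrite lmulE clr_sum [clr n g]/clr [clr m h]/clr big_distrlr /=.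
rewrite big_seq [RHS]big_seq; apply: eq_bigr => u ug.
rewrite clr_sum big_seq [RHS]big_seq; apply: eq_bigr => v vh.
rewrite clrU rmorphM mulrACA -big_split; congr (_ * _); apply: eq_bigr => c _ /=.
rewrite -exprD; congr (_ ^+ _); rewrite mxE PoszD addrACA.
have h1 := bg u ug c; have h2 := bh v vh c.
by apply/eqP; rewrite -eqz_nat PoszD !gez0_abs //; apply: addr_ge0.
Qed.

Lemma clr_one n : clr n 1 = \prod_c z c ^+ n.
Proof.
rewrite -[1]/(lmonom K 0) clrU rmorph1 mul1r; apply: eq_bigr => c _.
by rewrite mxE add0r.
Qed.

Lemma bounded_below_one : bounded_below 0 1.
Proof. by apply: bounded_belowU => c; rewrite mxE. Qed.

Lemma clrS n k g : bounded_below n g -> clr (k + n) g = (\prod_c z c) ^+ k * clr n g.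
Proof.
move=> bg; rewrite -[in LHS](mul1r g) clrM //; last exact: bounded_belowW bounded_below_one.
by rewrite clr_one prodrXl.
Qed.

End Eval.

Lemma clr_morph (B B' : comNzRingType) (iota : {rmorphism K -> B})
    (rho : {rmorphism B -> B'}) z n g :
  rho (clr iota z n g) = clr (rho \o iota) (rho \o z) n g.
Proof.
rewrite /clr rmorph_sum; apply: eq_bigr => v _; rewrite rmorphM; congr (_ * _).
by rewrite rmorph_prod; apply: eq_bigr => c _; rewrite rmorphXn.
Qed.

Lemma eq_clr (B : comNzRingType) (iota iota' : {rmorphism K -> B}) z z' n g :
  iota =1 iota' -> z =1 z' -> clr iota z n g = clr iota' z' n g.
Proof.
move=> e1 e2; apply: eq_bigr => v _; rewrite e1; congr (_ * _).
by apply: eq_bigr => c _; rewrite e2.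
Qed.

Lemma clr_congr (B : comNzRingType) (iota : {rmorphism K -> B}) (I : set B) z z' n g :
  is_ideal I -> (forall c, I (z c - z' c)) ->
  I (clr iota z n g - clr iota z' n g).
Proof.
move=> idI zz'; rewrite /clr -sumrB; apply: ideal_sum => // v _.
rewrite -mulrBr; apply: idealMl => //; apply: idealB_prod => // c.
exact: idealB_exp.
Qed.

End Clear.

HB.lock Definition ev1 (K B : comNzRingType) (iota : {rmorphism K -> B}) (x : B) :
  {rmorphism {poly K} -> B} := horner_morph (fun a => mulrC x (iota a)).

Section Evaluation.
Variables (K B : comNzRingType) (iota : {rmorphism K -> B}).

Lemma ev1X x : ev1 iota x 'X = x.
Proof. by rewrite ev1.unlock; exact: horner_morphX. Qed.
Lemma ev1C x c : ev1 iota x c%:P = iota c.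
Proof. by rewrite ev1.unlock; exact: horner_morphC. Qed.
Definition ev1E := (ev1X, ev1C).

Lemma ev1_sum x (p : {poly K}) D : (size p <= D)%N ->
  ev1 iota x p = \sum_(j < D) iota p`_j * x ^+ j.
Proof.
move=> sp; rewrite {1}(_ : p = \sum_(j < D) (p`_j)%:P * 'X^j); last first.
  transitivity (\poly_(j < D) p`_j).
    by apply/polyP => j; rewrite coef_poly; case: ltnP => // /(leq_trans sp) /(nth_default 0).
  by rewrite poly_def; apply: eq_bigr => j _; rewrite mul_polyC.
rewrite rmorph_sum; apply: eq_bigr => j _.
by rewrite [LHS]rmorphM [X in _ * X]rmorphXn /= ev1X ev1C.
Qed.

Lemma ev1_uniq x (rho : {rmorphism {poly K} -> B}) :
  (forall c, rho c%:P = iota c) -> rho 'X = x -> rho =1 ev1 iota x.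
Proof.
move=> hC hX; elim/poly_ind => [|p c IH]; first by rewrite !rmorph0.
by rewrite !rmorphD !rmorphM /= ev1X ev1C hC hX IH.
Qed.
End Evaluation.

HB.lock Definition ev2 (K : fieldType) (B : comNzRingType) (iota : {rmorphism K -> B}) (x y : B) :
  {rmorphism {poly {poly K}} -> B} := ev1 (ev1 iota y) x.

Section Evaluation2.
Variables (K : fieldType) (B : comNzRingType) (iota : {rmorphism K -> B}).

Lemma ev2P x y q : ev2 iota x y q%:P = ev1 iota y q.
Proof. by rewrite ev2.unlock ev1C. Qed.
Lemma ev2X x y : ev2 iota x y 'X = x.
Proof. by rewrite ev2.unlock ev1X. Qed.
Lemma ev2Y x y : ev2 iota x y 'X%:P = y.
Proof. by rewrite ev2P ev1X. Qed.
Lemma ev2C x y c : ev2 iota x y c%:P%:P = iota c.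
Proof. by rewrite ev2P ev1C. Qed.

Lemma ev20 x y : ev2 iota x y 0 = 0. Proof. exact: rmorph0. Qed.
Lemma ev21 x y : ev2 iota x y 1 = 1. Proof. exact: rmorph1. Qed.
Lemma ev2D x y : {morph ev2 iota x y : G H / G + H}. Proof. exact: rmorphD. Qed.
Lemma ev2N x y : {morph ev2 iota x y : G / - G}. Proof. exact: rmorphN. Qed.
Lemma ev2B x y : {morph ev2 iota x y : G H / G - H}. Proof. exact: rmorphB. Qed.
Lemma ev2M x y : {morph ev2 iota x y : G H / G * H}. Proof. exact: rmorphM. Qed.
Lemma ev2Xn x y n : {morph ev2 iota x y : G / G ^+ n}. Proof. exact: rmorphXn. Qed.

Lemma ev2_uniq x y (rho : {rmorphism {poly {poly K}} -> B}) :
  (forall c, rho c%:P%:P = iota c) -> rho 'X = x -> rho 'X%:P = y ->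
  rho =1 ev2 iota x y.
Proof.
move=> hC hX hY; rewrite ev2.unlock; apply: ev1_uniq => // q.
exact: (@ev1_uniq K B iota y (rho \o polyC) hC hY q).
Qed.
End Evaluation2.

Definition cst2 (K : fieldType) : {rmorphism K -> {poly {poly K}}} := polyC \o polyC.

Section Torus.
Variable K : fieldType.
Local Notation S := (laurent K 4).
Local Notation S0 := (laurent0 K 4).

Lemma expo_deg_delta (c : 'I_4) : expo_deg (delta_mx 0 c : 'rV[int]_4) = 1.
Proof.
rewrite /expo_deg (bigD1 c) //= mxE !eqxx big1 ?addr0 // => i /negPf ic.
by rewrite mxE ic andbF.
Qed.

Lemma expo_deg0 : expo_deg (0 : 'rV[int]_4) = 0.
Proof. by apply: big1 => i _; rewrite mxE. Qed.

Lemma expo_degN (v : 'rV[int]_4) : expo_deg (- v) = - expo_deg v.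
Proof. by rewrite -sumrN; apply: eq_bigr => i _; rewrite mxE. Qed.

Lemma expo_deg_quot (p s : 'I_4) :
  expo_deg (delta_mx 0 p - delta_mx 0 s : 'rV[int]_4) = 0.
Proof. by rewrite expo_degD expo_degN !expo_deg_delta subrr. Qed.

Definition xquot (p s : 'I_4) : S0 := Laurent0 (deg0U (1 : K) (expo_deg_quot p s)).

Definition cst_fun (c : K) : S0 := Laurent0 (deg0U c expo_deg0).

Lemma cst_additive : zmod_morphism cst_fun.
Proof. by move=> a b; apply: val_inj; rewrite /= monalgUB. Qed.
Lemma cst_multiplicative : monoid_morphism cst_fun.
Proof.
by split=> [|a b]; apply: val_inj => //=; rewrite -[RHS]/(_ * _) /GRing.mul /= lmulUU addr0.
Qed.
HB.instance Definition _ := GRing.isZmodMorphism.Build K S0 cst_fun cst_additive.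
HB.instance Definition _ := GRing.isMonoidMorphism.Build K S0 cst_fun cst_multiplicative.
Definition cst : {rmorphism K -> S0} := cst_fun.

Local Notation lv := (@laurent0_val K 4).
Lemma laurent0_valM : {morph lv : f g / f * g}. Proof. exact: (rmorphM val). Qed.
Lemma laurent0_valX n : {morph lv : f / f ^+ n}. Proof. exact: (rmorphXn val). Qed.
Lemma laurent0_valD : {morph lv : f g / f + g}. Proof. exact: (rmorphD val). Qed.
Lemma laurent0_valB : {morph lv : f g / f - g}. Proof. exact: (rmorphB val). Qed.
Lemma laurent0_val1 : lv 1 = 1. Proof. by []. Qed.
Lemma laurent0_val_sum (I : Type) (r : seq I) (F : I -> S0) :
  lv (\sum_(i <- r) F i) = \sum_(i <- r) lv (F i).
Proof. exact: (rmorph_sum val). Qed.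
Lemma laurent0_val_prod (I : Type) (r : seq I) (F : I -> S0) :
  lv (\prod_(i <- r) F i) = \prod_(i <- r) lv (F i).
Proof. exact: (rmorph_prod val). Qed.
Definition laurent0_valE := (laurent0_valM, laurent0_valX, laurent0_valD,
  laurent0_valB, laurent0_val_sum, laurent0_val_prod).

Lemma lmonomM u v : lmonom K u * lmonom K v = lmonom K (u + v) :> S.
Proof. by rewrite /GRing.mul /= lmulUU mulr1. Qed.

Lemma lmonom0 : lmonom K 0 = 1 :> S. Proof. by []. Qed.

Lemma lmonomX v n : lmonom K v ^+ n = lmonom K (v *+ n) :> S.
Proof.
elim: n => [|n IH]; first by rewrite expr0 mulr0n.
by rewrite exprS IH lmonomM mulrS.
Qed.

Lemma lmonom_prod (I : Type) (r : seq I) (F : I -> 'rV[int]_4) :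
  \prod_(i <- r) lmonom K (F i) = lmonom K (\sum_(i <- r) F i) :> S.
Proof.
elim/big_rec2: _ => // i u v _ ->; exact: lmonomM.
Qed.

Lemma xqM p s t : xquot p s * xquot s t = xquot p t.
Proof. by apply: val_inj; rewrite /= lmonomM addrA subrK. Qed.

Lemma xqq p : xquot p p = 1.
Proof. by apply: val_inj; rewrite /= -lmonom0 subrr. Qed.

Lemma xqV p s : xquot p s * xquot s p = 1.
Proof. by rewrite xqM xqq. Qed.

Definition xprod (s : 'I_4) : S0 := \prod_c xquot c s.

Lemma xprodV s : xprod s * (\prod_c xquot s c) = 1.
Proof. by rewrite -big_split big1 // => c _; exact: xqV. Qed.

Lemma xprod_unit n s : exists b, xprod s ^+ n * b = 1.
Proof. by exists ((\prod_c xquot s c) ^+ n); rewrite -exprMn xprodV expr1n. Qed.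

(** The universal case of evaluation: at the point with coordinates [x_c/x_s] of [S_0], an element
    of degree 0 is its own value. *)
Lemma clr_xq s n (g : S0) : bounded_below n g ->
  clr cst (xquot^~ s) n g = xprod s ^+ n * g.
Proof.
move=> bg; apply: val_inj; rewrite /= !laurent0_valE /= lmonom_prod lmonomX.
rewrite [X in _ * X]laurentE mulr_sumr big_seq [RHS]big_seq.
apply: eq_bigr => v vg; rewrite !laurent0_valE.
under eq_bigr => c _ do rewrite laurent0_valE /= lmonomX.
rewrite lmonom_prod -2![LHS]/(lmul _ _) -[RHS]/(lmul _ _) !lmulUU mulr1 mul1r add0r; congr << _ *g _ >>.
have absE c : (delta_mx 0 c - delta_mx 0 s : 'rV[int]_4) *+ `|(v 0 c + n%:Z)%R| =
   (v 0 c) *: delta_mx 0 c - (v 0 c) *: delta_mx 0 s + (delta_mx 0 c - delta_mx 0 s) *+ n.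
  rewrite -!scaler_nat -scalerBr -scalerDl; congr (_ *: _).
  by rewrite !natz gez0_abs //; exact: bg.
rewrite (eq_bigr _ (fun c _ => absE c)) big_split /= sumrMnl addrC; congr (_ + _).
rewrite sumrB -row_sum_delta -scaler_suml.
(* Degree 0 is used here: the powers of [x_s] in the denominators cancel. *)
have := elimT (deg0P _) (valP g) v vg; rewrite /expo_deg => ->.
by rewrite scale0r subr0.
Qed.

End Torus.

(** * Ideals of Laurent polynomials defined by a point with values in a ring *)

Section Pullback.
Variables (K : fieldType) (B : comNzRingType) (iota : {rmorphism K -> B}).
Variable z : 'I_4 -> B.
Local Notation S0 := (laurent0 K 4).
Local Notation clr := (clr iota z).
Implicit Types (a : set B) (g h : S0).

(* The inverse image of [a] under the evaluation at [z], without inverting the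
   coordinates of [z]. *)
Definition pullback a : set S0 := [set g | exists n, bounded_below n g /\ a (clr n g)].

Lemma pullbackS a n g : is_ideal a -> bounded_below n g -> a (clr n g) ->
  forall m, (n <= m)%N -> a (clr m g).
Proof.
by move=> ida bg ag m nm; rewrite -(subnK nm) clrS //; apply: idealMl.
Qed.

Lemma pullback_sub a a' : a `<=` a' -> pullback a `<=` pullback a'.
Proof. by move=> aa' g [n [bg /aa' ag]]; exists n. Qed.

Lemma pullback_ideal a : is_ideal a -> is_ideal (pullback a).
Proof.
move=> ida; split=> [|g h [n [bg ag]] [m [bh ah]]|g h [m [bh ah]]].
- by exists 0%N; split; [move=> v; rewrite msupp0|rewrite clr0; apply: ideal0].
- exists (n + m)%N; have nl := leq_addr m n; have ml := leq_addl n m; split.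
    by rewrite laurent0_valD; apply: bounded_belowD; [exact: bounded_belowW bg|exact: bounded_belowW bh].
  rewrite laurent0_valD clrD; apply: idealD => //.
    exact: pullbackS nl.
  exact: pullbackS ml.
- have [n bg] := bounded_below_exists g.
  exists (n + m)%N; rewrite laurent0_valM; split; first exact: bounded_belowM.
  by rewrite clrM //; apply: idealMl.
Qed.

(** Changing the clearing exponent multiplies the value by a power of the product of the
    coordinates. A prime ideal that contains no coordinate allows this power to be cancelled, so any
    admissible [n] tests membership. *)
Lemma pullbackP a n g : is_prime a -> (forall c, ~ a (z c)) -> bounded_below n g ->
  pullback a g -> a (clr n g).
Proof.
move=> pa az bg [m [bm am]]; have [ida _ aM] := pa.
have := pullbackS ida bm am (leq_addl n m).
rewrite addnC clrS // => /aM[] // /(prime_exp pa) /(prime_prod pa)[c _ /az//].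
Qed.

Lemma pullback_prime a : is_prime a -> (forall c, ~ a (z c)) ->
  is_prime (pullback a).
Proof.
move=> pa az; have [ida a1 aM] := pa.
split; first exact: pullback_ideal.
  move=> /(@pullbackP _ 0 1 pa az (@bounded_below_one K 4)); rewrite laurent0_val1 clr_one.
  by rewrite big1.
move=> g h pgh; have [n [bg bh]] := bounded_below2_exists g h.
have := @pullbackP _ (n + n) _ pa az; move=> /(_ (g * h)).
rewrite laurent0_valM => /(_ (bounded_belowM bg bh) pgh).
by rewrite clrM // => /aM[ag|ah]; [left|right]; exists n.
Qed.

(** If the coordinates map to [x_c/x_s] modulo [I], then evaluating and mapping back only multiplies
    by a unit. This serves twice: for charts, where [I] contains [L_0], and for initial ideals with
    their degenerate coordinates. *)
Lemma clear_congr (em : {rmorphism B -> S0}) (I : set S0) s n g :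
  is_ideal I -> (forall k, em (iota k) = cst K k) ->
  (forall c, I (em (z c) - xquot K c s)) -> bounded_below n g ->
  I (em (clr n g) - xprod K s ^+ n * g).
Proof.
move=> idI emk emz bg; rewrite clr_morph -clr_xq //.
rewrite (@eq_clr _ _ _ (em \o iota) (cst K) _ (em \o z)) //.
exact: clr_congr.
Qed.

Lemma clear_mem (em : {rmorphism B -> S0}) (I : set S0) s n g :
  is_ideal I -> (forall k, em (iota k) = cst K k) ->
  (forall c, I (em (z c) - xquot K c s)) -> bounded_below n g ->
  I g <-> I (em (clr n g)).
Proof.
move=> idI emk emz bg; have h := clear_congr idI emk emz bg.
split=> [Ig|]; first by apply: idealB_mem h _ => //; apply: idealMl.
move=> /(idealB_mem idI (idealBC idI h)).
by have [b xb] := xprod_unit K n s; apply: (ideal_unit idI xb).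
Qed.

End Pullback.

Definition principal_ideal (A : comNzRingType) (f : A) : set A := [set g | exists k, g = k * f].

Lemma principal_ideal_ideal (A : comNzRingType) (f : A) : is_ideal (principal_ideal f).
Proof.
split=> [|a b [k ->] [m ->]|a b [k ->]]; first by exists 0; rewrite mul0r.
- by exists (k + m); rewrite mulrDl.
- by exists (a * k); rewrite mulrA.
Qed.

Lemma principal_ideal_min (A : comNzRingType) (f : A) (I : set A) :
  is_ideal I -> I f -> principal_ideal f `<=` I.
Proof. by move=> idI If _ [k ->]; apply: idealMl. Qed.

Lemma preimage_ideal (A B : comNzRingType) (rho : {rmorphism A -> B}) (I : set B) :
  is_ideal I -> is_ideal (rho @^-1` I).
Proof.
move=> idI; split=> [|a b Ia Ib|a b Ib]; rewrite /preimage /=.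
- by rewrite rmorph0; apply: ideal0.
- by rewrite rmorphD; apply: idealD.
- by rewrite rmorphM; apply: idealMl.
Qed.

Lemma preimage_prime (A B : comNzRingType) (rho : {rmorphism A -> B}) (I : set B) :
  is_prime I -> is_prime (rho @^-1` I).
Proof.
move=> [idI I1 IM]; split; first exact: preimage_ideal.
  by rewrite /preimage /= rmorph1.
by move=> a b; rewrite /preimage /= rmorphM => /IM.
Qed.

Lemma zero_prime (B : idomainType) : is_prime [set (0 : B)].
Proof.
split=> [||a b /= /eqP].
- by split=> [//|_ _ -> ->|a _ ->]; rewrite /= ?addr0 ?mulr0.
- by move=> /eqP; rewrite oner_eq0.
- by rewrite mulf_eq0 => /orP[] /eqP; [left|right].
Qed.

Definition ring_ker (A B : comNzRingType) (rho : A -> B) : set A := rho @^-1` [set 0].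

Lemma ring_ker_prime (A : comNzRingType) (B : idomainType) (rho : {rmorphism A -> B}) :
  is_prime (ring_ker rho).
Proof. exact: preimage_prime (zero_prime B). Qed.

Lemma ev1_congr (K B : comNzRingType) (iota iota' : {rmorphism K -> B}) (I : set B) x x' p :
  is_ideal I -> (forall c, I (iota c - iota' c)) -> I (x - x') ->
  I (ev1 iota x p - ev1 iota' x' p).
Proof.
move=> idI Iio Ix; elim/poly_ind: p => [|p c IH].
  by rewrite !rmorph0 subrr; apply: ideal0.
rewrite !rmorphD !rmorphM /= !ev1E opprD addrACA; apply: idealD => //.
exact: idealB_mul.
Qed.

Lemma ev2_congr (K : fieldType) (B : comNzRingType) (iota : {rmorphism K -> B}) (I : set B) x x' y y' G :
  is_ideal I -> I (x - x') -> I (y - y') -> I (ev2 iota x y G - ev2 iota x' y' G).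
Proof.
move=> idI Ix Iy; rewrite ev2.unlock; apply: ev1_congr => // c; apply: ev1_congr => // k.
by rewrite subrr; apply: ideal0.
Qed.

Lemma ev2_id (K : fieldType) G : @ev2 K _ (cst2 K) 'X 'X%:P G = G.
Proof. by apply/esym/(@ev2_uniq K _ (cst2 K) 'X 'X%:P idfun). Qed.

Lemma ev2_comp (K : fieldType) (B B' : comNzRingType) (iota : {rmorphism K -> B})
    (iota' : {rmorphism K -> B'}) (rho : {rmorphism B -> B'}) x y G :
  (forall c, rho (iota c) = iota' c) ->
  rho (ev2 iota x y G) = ev2 iota' (rho x) (rho y) G.
Proof.
move=> h; apply: (@ev2_uniq K B' iota' (rho x) (rho y) (rho \o ev2 iota x y)) => [c||].
- by rewrite /= ev2C h.
- by rewrite /= ev2X.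
- by rewrite /= ev2Y.
Qed.

Section Evaluates.
Variables (K : fieldType) (B : comNzRingType) (iota : {rmorphism K -> B}).
Variable z : 'I_4 -> B.
Local Notation S0 := (laurent0 K 4).
Local Notation clr := (clr iota z).

(* [g] takes the value [b] at [z]. *)
Definition evals (g : S0) (b : B) :=
  exists n, bounded_below n g /\ clr n g = (\prod_c z c) ^+ n * b.

Lemma evalsS g b n m : bounded_below n g -> clr n g = (\prod_c z c) ^+ n * b ->
  (n <= m)%N -> clr m g = (\prod_c z c) ^+ m * b.
Proof.
by move=> bg e nm; rewrite -(subnK nm) clrS // e mulrA -exprD.
Qed.

Lemma evalsD g h b c : evals g b -> evals h c -> evals (g + h) (b + c).
Proof.
move=> [n [bg eg]] [m [bh eh]]; exists (n + m)%N.
have nl := leq_addr m n; have ml := leq_addl n m; rewrite laurent0_valD; split.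
  by apply: bounded_belowD; [exact: bounded_belowW bg|exact: bounded_belowW bh].
by rewrite clrD (evalsS bg eg nl) (evalsS bh eh ml) mulrDr.
Qed.

Lemma evalsM g h b c : evals g b -> evals h c -> evals (g * h) (b * c).
Proof.
move=> [n [bg eg]] [m [bh eh]]; exists (n + m)%N; rewrite laurent0_valM.
by split; [exact: bounded_belowM|rewrite clrM // eg eh exprD mulrACA].
Qed.

Lemma evals_cst k : evals (cst K k) (iota k).
Proof.
exists 0%N; split; first by apply: bounded_belowU => c; rewrite mxE.
by rewrite /= clrU expr0 mul1r big1 ?mulr1 // => c _; rewrite mxE.
Qed.

Lemma evals1 : evals 1 1.
Proof. by have := evals_cst 1; rewrite !rmorph1. Qed.

Lemma evalsX g b n : evals g b -> evals (g ^+ n) (b ^+ n).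
Proof.
move=> e; elim: n => [|n IH]; first by rewrite !expr0; apply: evals1.
by rewrite !exprS; apply: evalsM.
Qed.

Lemma evals_xq p s : z s = 1 -> evals (xquot K p s) (z p).
Proof.
move=> zs; exists 1%N; split.
  apply: bounded_belowU => c; rewrite !mxE /=.
  by case: (c == p); case: (c == s).
rewrite /= clrU rmorph1 mul1r expr1.
have [->|ps] := eqVneq p s.
  by rewrite zs mulr1; apply: eq_bigr => c _; rewrite subrr mxE add0r expr1.
rewrite (bigD1 p) //= [in RHS](bigD1 p) //= [RHS]mulrC !mulrA; congr (_ * _).
  by rewrite !mxE /= eqxx (negPf ps) subr0 expr2.
apply: eq_bigr => c /negPf cp; rewrite !mxE /= cp; have [->|_] := eqVneq c s.
  by rewrite zs expr1n.
by rewrite subr0 add0r expr1.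
Qed.

Lemma evals_morph (A : comNzRingType) (k : {rmorphism K -> A})
    (em : {rmorphism A -> S0}) (rho : {rmorphism A -> B}) x y G :
  (forall c, em (k c) = cst K c) -> (forall c, rho (k c) = iota c) ->
  evals (em x) (rho x) -> evals (em y) (rho y) ->
  evals (em (ev2 k x y G)) (rho (ev2 k x y G)).
Proof.
move=> emk rhok ex ey; elim/poly_ind: G => [|G q IH].
  by rewrite !rmorph0 -!(rmorph0 (cst K)) -(rmorph0 iota); apply: evals_cst.
rewrite !rmorphD !rmorphM /= ev2X ev2P; apply: evalsD; first exact: evalsM.
elim/poly_ind: q => [|q c IHq].
  by rewrite !rmorph0 -!(rmorph0 (cst K)) -(rmorph0 iota); apply: evals_cst.
rewrite !rmorphD !rmorphM /= ev1X ev1C emk rhok; apply: evalsD; first exact: evalsM.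
exact: evals_cst.
Qed.

Lemma evals_pullback (a : set B) g b : is_ideal a -> evals g b -> a b ->
  pullback iota z a g.
Proof. by move=> ida [n [bg e]] ab; exists n; rewrite e; split=> //; apply: idealMl. Qed.

Lemma pullback_evals (a : set B) g b : is_prime a -> (forall c, ~ a (z c)) ->
  evals g b -> pullback iota z a g -> a b.
Proof.
move=> pa az [n [bg e]] /(pullbackP pa az bg); rewrite e.
by have [_ _ aM] := pa; move=> /aM[] // /(prime_exp pa) /(prime_prod pa)[c _ /az].
Qed.

End Evaluates.

(** A quotient can have a value in the domain [B] although its denominator is not invertible there,
    because the value of the denominator can be cancelled. This gives the values of the monomials
    [T] and [U], which are quotients of monomials in [X] and [Y]. *)
Lemma evals_div (K : fieldType) (B : idomainType) (iota : {rmorphism K -> B}) z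
  (g g' h : laurent0 K 4) (b b' : B) : (forall c, z c != 0) -> b' != 0 ->
  h = g * g' -> evals iota z h (b * b') -> evals iota z g' b' -> evals iota z g b.
Proof.
move=> z0 b'0 eh [n [bh hE]] [n' [bg' g'E]].
have [m bg] := bounded_below_exists g; have nl := leq_addr m n; have ml := leq_addl n m.
exists (n + m)%N; split; first exact: bounded_belowW bg.
have pz0 k : (\prod_c z c) ^+ k != 0 by rewrite expf_neq0 //; apply/prodf_neq0.
apply: (mulIf (mulf_neq0 (pz0 n') b'0)).
rewrite -{1}g'E -clrM //; last exact: bounded_belowW bg.
rewrite -laurent0_valM -eh (evalsS bh hE); last by rewrite -addnA leq_addr.
by rewrite exprD !mulrA; congr (_ * _); rewrite -!mulrA; congr (_ * _); rewrite mulrC.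
Qed.

(** * Charts of the plane *)

Section FourPoint.
Variables (B : comNzRingType) (p q r s : 'I_4).
Hypothesis pqrs : uniq [:: p; q; r; s].

Definition four (x y t : B) (c : 'I_4) : B :=
  if c == p then x else if c == q then y else if c == r then t else 1.

Let ord4_perm : perm_eq (index_enum 'I_4) [:: p; q; r; s].
Proof.
apply: uniq_perm => //; first exact: index_enum_uniq.
move=> c; apply/esym.
have [|_ -> //] := uniq_min_size pqrs (fun x _ => mem_index_enum x).
by rewrite [index_enum _]unlock -enumT size_enum_ord.
Qed.

Lemma sum_four (V : nmodType) (F : 'I_4 -> V) : \sum_c F c = F p + F q + F r + F s.
Proof. by rewrite (perm_big _ ord4_perm) !big_cons big_nil /= addr0 !addrA. Qed.

Lemma prod_four (F : 'I_4 -> B) : \prod_c F c = F p * F q * F r * F s.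
Proof. by rewrite (perm_big _ ord4_perm) !big_cons big_nil /= mulr1 !mulrA. Qed.

Lemma four_cases (Q : 'I_4 -> Prop) : Q p -> Q q -> Q r -> Q s -> forall c, Q c.
Proof.
move=> Qp Qq Qr Qs c; have := mem_index_enum c.
by rewrite (perm_mem ord4_perm) !inE => /or4P[] /eqP->.
Qed.

Let neqs : [/\ q == p = false, r == p = false & s == p = false] /\
  [/\ r == q = false, s == q = false & s == r = false].
Proof.
move: pqrs; rewrite /= !inE !negb_or => /and4P[/and3P[h1 h2 h3] /andP[h4 h5] h6 _].
by do 2 split; apply/negbTE; rewrite eq_sym.
Qed.

Lemma four1 x y t : four x y t p = x. Proof. by rewrite /four eqxx. Qed.
Lemma four2 x y t : four x y t q = y.
Proof. by rewrite /four; case: neqs => -[-> _ _] _; rewrite eqxx. Qed.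
Lemma four3 x y t : four x y t r = t.
Proof. by rewrite /four; case: neqs => -[_ -> _] [-> _ _]; rewrite eqxx. Qed.
Lemma four4 x y t : four x y t s = 1.
Proof. by rewrite /four; case: neqs => -[_ _ ->] [_ -> ->]. Qed.
End FourPoint.

Definition splits (K : fieldType) := forall h : {poly K},
  exists rs, h = lead_coef h *: \prod_(z <- rs) ('X - z%:P).

(** The polynomial [p X + 1] is not constant, and [p] cannot vanish at any of its roots. *)
Lemma splits_nonroot (K : fieldType) (p : {poly K}) :
  splits K -> p != 0 -> exists x, p.[x] != 0.
Proof.
move=> /(_ (p * 'X + 1))[rs e] p0.
have sz : (1 < size (p * 'X + 1)%R)%N.
  by rewrite size_MXaddC (negPf p0) /= ltnS lt0n size_poly_eq0.
case: rs => [|x rs] in e.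
  by move: sz; rewrite e big_nil alg_polyC size_polyC; case: (_ != 0).
exists x; have : (p * 'X + 1).[x] = 0.
  by rewrite e hornerZ big_cons hornerM hornerXsubC subrr mul0r mulr0.
rewrite hornerD hornerMX hornerC => /eqP; rewrite addr_eq0 => /eqP px.
by apply: contra_eqN (px) => /eqP->; rewrite mul0r -addr_eq0 add0r oner_eq0.
Qed.

Section Chart.
Variable K : fieldType.
Local Notation S0 := (laurent0 K 4).
Variables (p q r s : 'I_4).
Hypothesis pqrs : uniq [:: p; q; r; s].

(* The outer variable is [X = x_p/x_s], the inner one [Y = x_q/x_s]. *)
Definition chart_coord : 'I_4 -> {poly {poly K}} :=
  four p q r 'X 'X%:P (- (1 + 'X + 'X%:P)).
Definition chart_emb : {rmorphism {poly {poly K}} -> S0} := ev2 (cst K) (xquot K p s) (xquot K q s).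

Lemma L_ideal : is_ideal (@L K). Proof. exact: ideal_gen_ideal. Qed.

Lemma L0_linear : L0 (xquot K r s + (1 + xquot K p s + xquot K q s)).
Proof.
have -> : xquot K r s + (1 + xquot K p s + xquot K q s) = \sum_c xquot K c s.
  by rewrite (sum_four pqrs) xqq [LHS]addrC -!addrA [LHS]addrC -!addrA.
rewrite /L0 /= laurent0_val_sum.
rewrite (eq_bigr (fun c => lmonom K (delta_mx 0 c) * lmonom K (- delta_mx 0 s))); last first.
  by move=> c _; rewrite lmonomM.
rewrite -mulr_suml; apply: (idealMr L_ideal); exact: ideal_gen_sub.
Qed.

Lemma chart_embC k : chart_emb (cst2 K k) = cst K k.
Proof. exact: ev2C. Qed.
Lemma chart_embX : chart_emb 'X = xquot K p s. Proof. exact: ev2X. Qed.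
Lemma chart_embY : chart_emb 'X%:P = xquot K q s. Proof. exact: ev2Y. Qed.
Lemma chart_embZ : chart_emb (- (1 + 'X + 'X%:P)) = - (1 + xquot K p s + xquot K q s).
Proof. by rewrite rmorphN 2!rmorphD rmorph1 /= chart_embX chart_embY. Qed.

Lemma chart_emb_coord (I : set S0) c : is_ideal I -> @L0 K `<=` I ->
  I (chart_emb (chart_coord c) - xquot K c s).
Proof.
move=> idI LI; have I0 := ideal0 idI.
move: c; apply: (four_cases pqrs); rewrite /chart_coord.
- by rewrite four1 chart_embX subrr.
- by rewrite (four2 pqrs) chart_embY subrr.
- rewrite (four3 pqrs) chart_embZ -opprD addrC; apply: idealN => //.
  by apply: LI; exact: L0_linear.
- by rewrite (four4 pqrs) rmorph1 xqq subrr.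
Qed.

Lemma chart_clear (I : set S0) (g : S0) n : is_ideal I -> @L0 K `<=` I -> bounded_below n g ->
  I g <-> I (chart_emb (@clr K 4 _ (cst2 K) chart_coord n g)).
Proof.
move=> idI LI; apply: (clear_mem idI chart_embC).
by move=> c; exact: chart_emb_coord.
Qed.

(* [f] generates the extension of [P] to the chart. *)
Definition chart_eq (P : set S0) (f : {poly {poly K}}) :=
  P `<=` @pullback K _ (cst2 K) chart_coord (principal_ideal f) /\ P (chart_emb f).

Lemma chart_coord4 : chart_coord s = 1. Proof. exact: four4. Qed.

(** Evaluation at the chart coordinates is a left inverse of [chart_emb], so a pulled back ideal can
    be tested on images of polynomials. *)
Lemma chart_evals G : @evals K _ (cst2 K) chart_coord (chart_emb G) G.
Proof.
have ep := @evals_xq K _ (cst2 K) chart_coord p s chart_coord4.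
have eq := @evals_xq K _ (cst2 K) chart_coord q s chart_coord4.
rewrite /chart_coord four1 -/chart_coord -chart_embX in ep.
rewrite /chart_coord (four2 pqrs) -/chart_coord -chart_embY in eq.
have := @evals_morph K _ (cst2 K) chart_coord _ (cst2 K)
   chart_emb idfun 'X 'X%:P G chart_embC (fun=> erefl) ep eq.
by rewrite ev2_id.
Qed.

Lemma chart_emb_unit c (I : set S0) : is_prime I -> @L0 K `<=` I -> ~ I (chart_emb (chart_coord c)).
Proof.
move=> pI LI; have idI : is_ideal I by case: pI.
have h := chart_emb_coord c idI LI => /(idealB_mem idI (idealBC idI h)).
exact: prime_unit pI (xqV K c s).
Qed.

End Chart.

(** * The ideal of a curve is principal in a chart *)

Section Generator.
Variable K : fieldType.
Hypothesis closedK : splits K.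
Local Notation S0 := (laurent0 K 4).
Variables (p q r s : 'I_4).
Hypothesis pqrs : uniq [:: p; q; r; s].
Local Notation chi := (chart_coord K p q r).
Local Notation em := (chart_emb K p q s).
Local Notation KXY := {poly {poly K}}.

Definition ev_at (c : K) : {rmorphism KXY -> {poly K}} := ev2 (polyC : {rmorphism K -> _}) 'X c%:P.

Lemma ev_at_lift c G :
  map_poly polyC (ev_at c G) = @ev2 K _ (cst2 K) 'X c%:P%:P G.
Proof.
have := @ev2_comp K {poly K} KXY (polyC : {rmorphism K -> {poly K}}) (cst2 K)
   (map_poly polyC : {rmorphism {poly K} -> KXY}) 'X c%:P G.
by rewrite /= map_polyX map_polyC; apply=> k; rewrite map_polyC.
Qed.

Lemma ev_at_mod c G : principal_ideal ('X%:P - c%:P%:P) (G - map_poly polyC (ev_at c G)).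
Proof.
rewrite ev_at_lift -{1}[G]ev2_id; apply: ev2_congr; first exact: principal_ideal_ideal.
  by rewrite subrr; exact: (ideal0 (principal_ideal_ideal _)).
by exists 1; rewrite mul1r.
Qed.

Lemma ev_at_dvd c G : ev_at c G = 0 -> principal_ideal ('X%:P - c%:P%:P) G.
Proof.
have := ev_at_mod c G; move: (ev_at c G) => e + e0; rewrite e0 => -[k].
by rewrite map_poly0 subr0 => ->; exists k.
Qed.

Lemma ev_atB c : ev_at c ('X%:P - c%:P%:P) = 0.
Proof. by rewrite /ev_at ev2B ev2Y ev2C subrr. Qed.

(** No factor [Y - c] divides [f]. Over a field where polynomials split, this says that the
    coefficients of [f] in [K[Y]] have no common factor. *)
Definition primitive_coef (f : KXY) := forall c, ev_at c f != 0.

(** Induction on the linear factors of [c]: [Y - z] kills the left side at [Y = z], where [f] does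
    not vanish, so it divides [Q] and can be cancelled. *)
Lemma gauss (f G Q : KXY) (c : {poly K}) :
  primitive_coef f -> c != 0 -> c%:P * G = Q * f -> principal_ideal f G.
Proof.
move=> pf; have [rs ->] := closedK c => c0.
have {c0} a0 : lead_coef c != 0.
  by apply: contraNneq c0 => ->; rewrite scale0r.
set a := lead_coef c in a0 *; elim: rs Q => [|z rs IH] Q.
  rewrite big_nil alg_polyC => e; exists ((a^-1)%:P%:P * Q).
  by rewrite -mulrA -e mulrA -2!polyCM mulVf // mul1r.
rewrite big_cons scalerAr polyCM => e.
have /ev_at_dvd[Q' eQ] : ev_at z Q = 0.
  apply/eqP; have /eqP := congr1 (ev_at z) e; rewrite !rmorphM /=.
  rewrite rmorphB /= ev_atB !mul0r eq_sym mulf_eq0 => /orP[//|].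
  by rewrite (negPf (pf z)).
apply: (IH Q'); apply: (@mulfI _ ('X - z%:P)%:P).
  by rewrite polyC_eq0 polyXsubC_eq0.
by rewrite mulrA e eQ polyCB -mulrA mulrCA.
Qed.

Lemma prime_root (A : comNzRingType) (P : set A) (rho : {rmorphism {poly K} -> A})
  (h : {poly K}) : is_prime P -> h != 0 -> P (rho h) ->
  exists2 c, root h c & P (rho ('X - c%:P)).
Proof.
move=> pP h0; have [rs eh] := closedK h.
rewrite {1}eh -mul_polyC rmorphM /=.
have [_ _ PM] := pP => /PM[|].
  move/(prime_unit pP) => /(_ (rho (lead_coef h)^-1%:P)) [].
  by rewrite -rmorphM -polyCM divff ?lead_coef_eq0 // rmorph1.
rewrite rmorph_prod => /(prime_prod pP)[c rc Pc]; exists c => //.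
by rewrite rootE eh hornerZ horner_prod (big_rem c) //= hornerXsubC subrr mul0r mulr0.
Qed.

End Generator.

Lemma ex_min_size (A : Type) (Q : A -> Prop) (m : A -> nat) :
  (exists a, Q a) -> exists2 a, Q a & forall b, Q b -> (m a <= m b)%N.
Proof.
move=> [a0 Qa0]; have ex : exists n, `[< exists2 a, Q a & m a = n >].
  by exists (m a0); apply/asboolP; exists a0.
case: (ex_minnP ex) => n /asboolP[a Qa <-] mn; exists a => // b Qb.
by apply: mn; apply/asboolP; exists b.
Qed.

Section Generator.
Variable K : fieldType.
Hypothesis closedK : splits K.
Local Notation S0 := (laurent0 K 4).
Variables (p q r s : 'I_4).
Hypothesis pqrs : uniq [:: p; q; r; s].
Local Notation KXY := {poly {poly K}}.
Local Notation chi := (chart_coord K p q r).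
Local Notation em := (chart_emb K p q s).
Local Notation clr := (@clr K 4 _ (cst2 K) chi).
Local Notation pullback := (@pullback K _ (cst2 K) chi).

Variable P : set S0.
Hypothesis curveP : curve_in_E P.

Let pP : is_prime P. Proof. by case: curveP. Qed.
Let idP : is_ideal P. Proof. by case: pP. Qed.
Let LP : @L0 K `<=` P. Proof. by case: curveP. Qed.

Definition trace_ideal : set KXY := em @^-1` P.
Local Notation p0 := trace_ideal.

Let pp0 : is_prime p0. Proof. exact: preimage_prime. Qed.
Let idp0 : is_ideal p0. Proof. by case: pp0. Qed.

Lemma trace_idealP n (g : S0) : bounded_below n g -> P g <-> p0 (clr n g).
Proof. exact: (chart_clear pqrs idP LP). Qed.

Definition ev_pt (e c : K) : {rmorphism KXY -> K} := ev2 (idfun : {rmorphism K -> K}) e c.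

Lemma ev_pt_at e c G : ev_pt e c G = (ev_at c G).[e].
Proof.
have := @ev2_comp K {poly K} K (polyC : {rmorphism K -> {poly K}}) idfun
  (horner_eval e : {rmorphism {poly K} -> K}) 'X c%:P G.
by rewrite /= /horner_eval hornerX hornerC => -> // k; rewrite hornerC.
Qed.

(** Otherwise every element of [S_0] would be, up to a unit, congruent to a constant modulo [P].
    Then [P] would be maximal, against the chain of primes of length 1 above it. *)
Lemma curve_not_point e c : ~ (p0 ('X - e%:P%:P) /\ p0 ('X%:P - c%:P%:P)).
Proof.
move=> [pe pc]; have [_ [[ch [prim strict]] _] _] := curveP.
have [le nle] := strict 0%N isT; have [/= _ P0] := prim 0%N isT.
have [[id1 one1 _] _] := prim 1%N isT.
apply: nle => g g1; have [n bg] := bounded_below_exists g.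
set k := ev_pt e c (clr n g).
have pk : p0 (clr n g - cst2 K k).
  have := @ev2_congr K _ (cst2 K) p0 'X e%:P%:P 'X%:P c%:P%:P (clr n g) idp0 pe pc.
  rewrite ev2_id; congr (p0 (_ - _)).
  by have /= <- := @ev2_comp K K _ (idfun : {rmorphism K -> K}) (cst2 K) (cst2 K) e c (clr n g) (fun=> erefl).
clearbody k; have [k0|k0] := eqVneq k 0.
  by apply: P0; apply/(trace_idealP bg); rewrite -[clr n g]subr0 -[0](rmorph0 (cst2 K)) -k0.
case: one1; have h1 := chart_clear pqrs id1 (fun x h => le _ (P0 _ (LP h))) bg.
have /h1 g1' := g1.
have pk' : P (em (clr n g) - cst K k).
  have emB G : em (G - cst2 K k) = em G - cst K k by rewrite [LHS]ev2B ev2C.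
  by rewrite -emB; exact: pk.
have pk1 : ch 1%N (em (clr n g) - cst K k).
  by apply: le; apply: P0.
have := idealB_mem id1 (idealBC id1 pk1) g1'.
move=> /(idealMl id1 (cst K k^-1)); rewrite -rmorphM mulVf // rmorph1 //.
Qed.

Lemma ev_at_coord c d : c != 0 -> ev_at c (chi d) != 0.
Proof.
move=> c0; move: d; apply: (four_cases pqrs); rewrite /chart_coord /ev_at.
- by rewrite four1 ev2X polyX_eq0.
- by rewrite (four2 pqrs) ev2Y polyC_eq0.
- rewrite (four3 pqrs) ev2N 2!ev2D ev21 ev2X ev2Y oppr_eq0.
  have -> : 1 + 'X + c%:P = 'X + (1 + c)%:P :> {poly K}.
    by rewrite polyCD addrA [1 + 'X]addrC.
  by rewrite -size_poly_gt0 size_XaddC.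
- by rewrite (four4 pqrs) ev21 oner_eq0.
Qed.

Lemma ev_pt_coord e c d : e != 0 -> c != 0 -> 1 + e + c != 0 -> ev_pt e c (chi d) != 0.
Proof.
move=> e0 c0 z0; move: d; apply: (four_cases pqrs); rewrite /chart_coord /ev_pt.
- by rewrite four1 ev2X.
- by rewrite (four2 pqrs) ev2Y.
- by rewrite (four3 pqrs) ev2N 2!ev2D ev21 ev2X ev2Y oppr_eq0.
- by rewrite (four4 pqrs) ev21 oner_eq0.
Qed.

(* Otherwise [P] is contained in the ideals of a line and of a point on it, and
   the dimension is at least 2. *)
Lemma trace_neq0 : exists2 G, p0 G & G != 0.
Proof.
apply: contrapT => no0.
have p00 G : p0 G -> G = 0.
  by move=> pG; apply: contrapT => /eqP G0; apply: no0; exists G.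
(* The line is [Y = 1] and the point on it is [(x, 1)]. It lies in the torus when [x] and the third
   coordinate [-(x + 2)] are non-zero. *)
have [x x0] : exists x, ('X * ('X + 2%:P) : {poly K}).[x] != 0.
  apply: splits_nonroot closedK _; rewrite mulf_neq0 ?polyX_eq0 //.
  by rewrite -size_poly_gt0 size_XaddC.
rewrite hornerM hornerD hornerX hornerC mulf_eq0 negb_or in x0.
have {x0}[x0 x2] := andP x0; have x3 : 1 + x + 1 != 0 by rewrite [1 + x]addrC -addrA.
pose a1 := ring_ker (ev_at (1 : K)); pose a2 := ring_ker (ev_pt x (1 : K)).
have a1P : is_prime a1 by exact: ring_ker_prime.
have a2P : is_prime a2 by exact: ring_ker_prime.
have za1 c : ~ a1 (chi c) by apply/eqP/ev_at_coord/oner_neq0.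
have za2 c : ~ a2 (chi c).
  by move/eqP; apply/negP/ev_pt_coord => //; apply: oner_neq0.
have P1 : is_prime (pullback a1) by exact: pullback_prime.
have P2 : is_prime (pullback a2) by exact: pullback_prime.
have PP1 : P `<=` pullback a1.
  move=> g Pg; have [n bg] := bounded_below_exists g; exists n; split => //.
  by rewrite (p00 _ (proj1 (trace_idealP bg) Pg)); case: a1P => ia1 _ _; apply: ideal0.
have P12 : pullback a1 `<=` pullback a2.
  apply: pullback_sub => G; rewrite /a1 /a2 /ring_ker /preimage /= => e.
  by rewrite ev_pt_at e horner0.
have emin (a : set KXY) G : is_prime a -> a G -> pullback a (em G).
  by case=> ida _ _ aG; apply: (evals_pullback ida (chart_evals pqrs G)).
have [_ [_ nch] _] := curveP; apply: nch; exists (fun i => nth P [:: P; pullback a1; pullback a2] i).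
have emX : a2 ('X - (cst2 K x)) by rewrite /a2 /ring_ker /= /preimage /= /ev_pt ev2B ev2X ev2C subrr.
have emY : a1 ('X%:P - (cst2 K 1)) by rewrite /a1 /ring_ker /= /preimage /= /ev_at ev2B ev2Y ev2C subrr.
split=> [[|[|[|//]]] _ | [|[|//]] _] /=.
- by split.
- by split.
- by split=> // g /PP1 /P12.
- split=> // /(_ _ (emin _ _ a1P emY)) /p00 /eqP.
  by rewrite subr_eq0 /= => /eqP/polyC_inj/eqP; rewrite -subr_eq0 polyXsubC_eq0.
- split=> // /(_ _ (emin _ _ a2P emX)) h.
  have := pullback_evals a1P za1 (chart_evals pqrs ('X - cst2 K x)) h.
  rewrite /a1 /ring_ker /= /preimage /= /ev_at ev2B ev2X ev2C => /eqP.
  by rewrite polyXsubC_eq0.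
Qed.

(* A generator is found as a member of minimal degree in X, and then of minimal
   degree of the leading coefficient; it is primitive, so that pseudo-division
   and Gauss's lemma apply. *)
Lemma trace_principal :
  exists f, [/\ p0 f, f != 0 & forall G, p0 G -> principal_ideal f G].
Proof.
have [_ _ pM] := pp0.
have [f0 [pf0 f00] min0] : exists2 G, p0 G /\ G != 0 &
    forall H, p0 H /\ H != 0 -> (size G <= size H)%N.
  by apply: ex_min_size; have [G pG G0] := trace_neq0; exists G.
have [f [pf [fn0 szf]] minf] : exists2 G, p0 G /\ (G != 0 /\ size G = size f0) &
    forall H, p0 H /\ (H != 0 /\ size H = size f0) ->
      (size (lead_coef G) <= size (lead_coef H))%N.
  by apply: (@ex_min_size _ _ (fun G : KXY => size (lead_coef G))); exists f0.
have {f00} {}min0 H : p0 H -> H != 0 -> (size f <= size H)%N.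
  by move=> pH H0; rewrite szf; apply: min0.
(* If the minimal degree in [X] is 0, the ideal contains some [Y - c]. A member not divisible by it
   would then yield some [X - e] as well, and the curve would be a point. *)
have [/size1_polyC ef|szf2] := leqP (size f) 1.
  set h := f`_0 in ef; have h0 : h != 0 by rewrite -polyC_eq0 -ef.
  have [c rc] := prime_root closedK (rho := polyC) pp0 h0 (eq_ind _ p0 pf _ ef).
  rewrite /= polyCB => pc; exists ('X%:P - c%:P%:P); split=> //.
    by rewrite -polyCB polyC_eq0 polyXsubC_eq0.
  move=> G pG; have [e|nz] := eqVneq (ev_at c G) 0; first exact: ev_at_dvd.
  have pG' : p0 (map_poly polyC (ev_at c G)).
    apply: (idealB_mem idp0 _ pG); apply: (idealBC idp0).
    exact: (principal_ideal_min idp0 pc (ev_at_mod c G)).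
  have [e re] := prime_root closedK (rho := map_poly polyC) pp0 nz pG'.
  by rewrite rmorphB /= map_polyX map_polyC => pe; case: (@curve_not_point e c).
have szm (G : KXY) : p0 G -> G != 0 -> (1 < size G)%N.
  by move=> pG G0; apply: leq_trans szf2 (min0 _ pG G0).
exists f; split=> // G pG.
(* If [f = k (Y - c)], primality leaves two cases: [k] has the same degree in [X] and a leading
   coefficient of smaller degree, or [Y - c] has degree 0 in [X]. Both contradict minimality. *)
have prf : primitive_coef f.
  move=> c; apply/eqP => /ev_at_dvd[k ek].
  have cn0 : 'X - c%:P != 0 by rewrite polyXsubC_eq0.
  rewrite -polyCB in ek.
  have k0 : k != 0 by apply: contraNneq fn0 => k0; rewrite ek k0 mul0r.
  have := pf; rewrite ek => /pM[pk|/szm]; last first.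
    by rewrite polyC_eq0 size_polyC cn0 => /(_ isT).
  have szk : size k = size f0.
    by rewrite -szf ek size_mul ?polyC_eq0 // size_polyC cn0 addn1.
  have := minf k (conj pk (conj k0 szk)); rewrite ek lead_coefM lead_coefC.
  by rewrite size_mul ?lead_coef_eq0 // size_XsubC addn2 ltnn.
(* The remainder of pseudo-division lies in the ideal and has smaller degree in [X], so it is 0;
   [gauss] then removes the power of the leading coefficient. *)
have := Pdiv.WeakIdomain.divp_eq G f; rewrite -mul_polyC.
set a := lead_coef f ^+ _; set Q := divp _ _; set r0 := modp _ _ => e.
have r00 : r0 = 0.
  apply: contrapT => /eqP r0n; have pr : p0 r0.
    have -> : r0 = a%:P * G - Q * f by rewrite e [Q * f + r0]addrC addrK.
    by apply: (idealB idp0); apply: (idealMl idp0).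
  have := min0 _ pr r0n; rewrite leqNgt.
  by rewrite Pdiv.CommonIdomain.ltn_modp fn0.
apply: (gauss closedK prf (c := a) (Q := Q)); last by rewrite e r00 addr0.
by rewrite expf_neq0 // lead_coef_eq0.
Qed.

Lemma chart_coord_nunit c k : c != s -> k * chi c <> 1.
Proof.
have ex0 : c != s -> exists e d, ev_pt e d (chi c) = 0.
  move: c; apply: (four_cases pqrs); rewrite /chart_coord /ev_pt => cs.
  - by exists 0, 0; rewrite four1 ev2X.
  - by exists 0, 0; rewrite (four2 pqrs) ev2Y.
  - by exists (-1), 0; rewrite (four3 pqrs) ev2N 2!ev2D ev21 ev2X ev2Y addr0 subrr oppr0.
  - by rewrite eqxx in cs.
move=> /ex0[e [d ed0]] k1; have := congr1 (ev_pt e d) k1.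
  by rewrite /ev_pt ev2M ev21 [X in _ * X]ed0 mulr0 => /esym/eqP; rewrite oner_eq0.
Qed.

(** The coordinates are units modulo [P], so [f = k chi_c] would put [k] into the ideal generated by
    [f] and make [chi_c] invertible. Because of the last clause, the Newton polygon of [f] touches
    both axes, in every chart. *)
Lemma chart_generator : exists f, [/\ chart_eq p q r s P f, f != 0 &
  forall c k, c != s -> f <> k * chi c].
Proof.
have [f [pf f0 princ]] := trace_principal; have [_ p01 pM] := pp0.
have pchi c : ~ p0 (chi c) by exact: (chart_emb_unit pqrs).
exists f; split=> //.
  split=> // g Pg; have [n bg] := bounded_below_exists g; exists n; split => //.
  by apply: princ; apply/(trace_idealP bg).
move=> c k cs ef; have := pf; rewrite ef => /pM[|/pchi//] /princ[k' ek].
apply: (@chart_coord_nunit c k' cs); apply: (mulIf f0).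
by rewrite mul1r [RHS]ef ek -!mulrA [f * _]mulrC.
Qed.

End Generator.

(** * Multiplicities from initial ideals *)

(* The submodules of [(A/J)_Q] are generated by the powers of the uniformizer
   [x], and [x ^+ n] is the first one to vanish. *)
Section LocLength.
Variables (A : comNzRingType) (J Q : set A) (x : A) (n : nat).
Hypotheses (idJ : is_ideal J) (primeQ : is_prime Q) (JQ : J `<=` Q) (Qx : Q x).
Hypothesis Qgen : forall a, Q a -> exists b, J (a - x * b).
Variable c : A.
Hypotheses (Qc : ~ Q c) (Jcx : J (c * x ^+ n)).
Hypothesis Jxn : forall s m, ~ Q s -> J (s * x ^+ m) -> (n <= m)%N.

Let QM a b : ~ Q a -> ~ Q b -> ~ Q (a * b).
Proof. by case: primeQ => _ _ pM Qa Qb /pM[]. Qed.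

Let idQ : is_ideal Q. Proof. by case: primeQ. Qed.
Let Q1 : ~ Q 1. Proof. by case: primeQ. Qed.

(** Divide by [x] as long as the cofactor stays in [Q]; this is the order of [a] at [Q], truncated
    at [m]. *)
Lemma power_decomp a m : (exists k b, [/\ (k < m)%N, ~ Q b & J (a - x ^+ k * b)]) \/
  (exists b, J (a - x ^+ m * b)).
Proof.
elim: m => [|m [[k [b [km Qb Jb]]]|[b Jb]]].
- by right; exists a; rewrite expr0 mul1r subrr; apply: ideal0.
- by left; exists k, b; rewrite ltnS ltnW.
have [/Qgen[b' Jb']|Qb] := pselect (Q b); last by left; exists m, b.
right; exists b'; have -> : a - x ^+ m.+1 * b' = (a - x ^+ m * b) + x ^+ m * (b - x * b').
  by rewrite exprS; ring.
by apply: (idealD idJ) => //; apply: (idealMl idJ).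
Qed.

Local Notation sub := (loc_submodule J Q).

Lemma sub_power_n N : sub N -> N (x ^+ n, 1).
Proof.
case=> _ eqN N0 _ _; apply: (eqN _ _ N0) => //=; exists c; split=> //=.
rewrite (_ : _ * _ = - (c * x ^+ n)); last by ring.
exact: (idealN idJ).
Qed.

Lemma sub_powerW N m k : sub N -> N (x ^+ m, 1) -> (m <= k)%N -> N (x ^+ k, 1).
Proof.
case=> _ _ _ _ sc Nm /subnK <-; rewrite exprD.
by have := sc (x ^+ (k - m)) 1 _ Q1 Nm; rewrite /= mulr1.
Qed.

Lemma sub_power N a s m b : sub N -> ~ Q s -> ~ Q b -> J (a - x ^+ m * b) ->
  N (a, s) <-> N (x ^+ m, 1).
Proof.
case=> _ eqN _ _ sc Qs Qb Jab; split=> [Na|Nm].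
  apply: (eqN _ _ (sc s b _ Qb Na)) => //=; exists 1; split=> //=.
  rewrite (_ : _ * _ = s * (a - x ^+ m * b)); last by ring.
  exact: (idealMl idJ).
apply: (eqN _ _ (sc b s _ Qs Nm)) => //=; exists 1; split=> //=.
rewrite (_ : _ * _ = - s * (a - x ^+ m * b)); last by ring.
exact: (idealMl idJ).
Qed.

Lemma sub_high N a s b : sub N -> ~ Q s -> J (a - x ^+ n * b) -> N (a, s).
Proof.
move=> sN Qs Jab; have Nn := sub_power_n sN; case: sN => _ eqN _ _ sc.
apply: (eqN _ _ (sc b s _ Qs Nn)) => //=; exists 1; split=> //=.
rewrite (_ : _ * _ = - s * (a - x ^+ n * b)); last by ring.
exact: (idealMl idJ).
Qed.

(** The [i]-th member of a chain contains [x^(n-i)]: a new element in the next member has order less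
    than [n - i], and together with its order power the higher powers follow. The start is [x^n],
    which is zero in the localization. *)
Lemma chain_upper k : has_chain sub k -> (k <= n)%N.
Proof.
move=> [ch [sch strict]].
suff H i : (i <= k)%N -> ch i (x ^+ (n - i), 1) /\ (i <= n)%N by case: (H k).
elim: i => [|i IH] ik; first by split=> //; rewrite subn0; apply: sub_power_n; apply: sch.
have [Ni le_in] := IH (ltnW ik); have [sub_i nsub] := strict i ik.
have [[a s] [Na nNa]] : exists y, ch i.+1 y /\ ~ ch i y.
  by apply: contrapT => h; apply: nsub => y Ny; apply: contrapT => nNy; apply: h; exists y.
have si := sch i (ltnW ik); have si1 := sch i.+1 ik.
have Qs : ~ Q s by case: si1 => /(_ _ Na).
have [[m [b [mn Qb Jab]]]|[b Jab]] := power_decomp a n; last first.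
  by case: nNa; apply: (sub_high si Qs Jab).
have lt_m : (m < n - i)%N.
  rewrite ltnNge; apply/negP => le_m; apply: nNa.
  by apply/(sub_power si Qs Qb Jab); apply: (sub_powerW si Ni le_m).
split; last by rewrite -subn_gt0; apply: leq_ltn_trans lt_m.
apply: (sub_powerW si1 (m := m)); first by apply/(sub_power si1 Qs Qb Jab).
by rewrite subnS -ltnS prednK // (leq_ltn_trans _ lt_m).
Qed.

(** The submodule of the localization generated by [x^m]. *)
Definition power_sub m : set (A * A) :=
  [set y | ~ Q y.2 /\ exists u b, ~ Q u /\ J (u * y.1 - x ^+ m * b)].

Lemma power_sub_submodule m : sub (power_sub m).
Proof.
split=> [y []//|[a s] [a' s'] [/= Qs [u [b [Qu Jub]]]] /= Qs' [v [Qv]] /= Jv||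
  [a s] [a' s'] [/= Qs [u [b [Qu Jub]]]] [/= Qs' [u' [b' [Qu' Jub']]]]|
  e t [a s] Qt [/= Qs [u [b [Qu Jub]]]]].
- split=> //=; exists (v * u * s), (v * s' * b); split; first by do 2 apply: QM => //.
  rewrite (_ : _ - _ = - u * (v * (s' * a - s * a')) + v * s' * (u * a - x ^+ m * b)); last by ring.
  by apply: (idealD idJ); apply: (idealMl idJ).
- split=> //=; exists 1, 0; split=> //; rewrite !mulr0 subrr; exact: ideal0.
- split=> /=; first exact: QM.
  exists (u * u'), (u' * s' * b + u * s * b'); split; first exact: QM.
  rewrite (_ : _ - _ = u' * s' * (u * a - x ^+ m * b) + u * s * (u' * a' - x ^+ m * b')); last by ring.
  by apply: (idealD idJ); apply: (idealMl idJ).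
- split=> /=; first exact: QM.
  exists u, (e * b); split=> //.
  rewrite (_ : _ - _ = e * (u * a - x ^+ m * b)); last by ring.
  exact: (idealMl idJ).
Qed.

Lemma chain_lower : has_chain sub n.
Proof.
exists (fun i => power_sub (n - i)); split=> [i _|i lt_in]; first exact: power_sub_submodule.
have -> : (n - i = (n - i.+1).+1)%N by rewrite subnS prednK // subn_gt0.
set m := (n - i.+1)%N; split=> [[a s] [/= Qs [u [b [Qu Jub]]]]|].
  by split=> //=; exists u, (x * b); split=> //; rewrite mulrA -exprSr.
move=> /(_ (x ^+ m, 1)) []; first by split=> //=; exists 1, 1; split=> //; rewrite mulrC subrr; apply: ideal0.
move=> /= _ [u [b [Qu Jub]]].
(* If [x^m] were in the submodule generated by [x^(m+1)], then [x^m (u - x b)] would be in [J] with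
   cofactor outside [Q], hence [n <= m]; but [m = n - i - 1]. *)
have /Jxn : ~ Q (u - x * b).
  by move=> /(idealD idQ) /(_ (idealMr idQ b Qx)); rewrite subrK.
move=> /(_ m); rewrite (_ : _ * _ = u * x ^+ m - x ^+ m.+1 * b); last by rewrite exprS; ring.
by move=> /(_ Jub); rewrite leqNgt /m ltn_subrL (leq_ltn_trans _ lt_in).
Qed.

Lemma loc_lengthE (R : realType) : loc_length R J Q = (n%:R)%:E.
Proof.
apply/eqP; rewrite eq_le; apply/andP; split.
  apply: ge_ereal_sup => _ [k /chain_upper kn <-].
  by rewrite lee_fin ler_nat.
by apply: ereal_sup_ubound; exists n => //; apply: chain_lower.
Qed.

End LocLength.

Lemma esum_primes (R : realType) (T U : choiceType) (D : set T)
    (rs : seq U) (Qf : U -> T) (F : T -> \bar R) (N : U -> nat) :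
  uniq rs -> D = [set Qf a | a in [set` rs]] -> {in rs &, injective Qf} ->
  (forall a, a \in rs -> F (Qf a) = ((N a)%:R)%:E) ->
  (\esum_(t in D) F t)%E = ((\sum_(a <- rs) N a)%:R)%:E.
Proof.
move=> urs -> inj FN; rewrite esum_image; last first.
  by move=> a b; rewrite !inE; apply: inj.
rewrite esum_fset //; last by move=> a; rewrite inE /= => /FN ->; rewrite lee_fin ler0n.
rewrite -fsbig_seq // big_seq (eq_bigr (fun a => ((N a)%:R)%:E)); last by move=> a /FN.
by rewrite -big_seq sumEFin -natr_sum.
Qed.

(** * Lowest coefficients and initial forms *)

Section LowestCoefficient.
Variable D : idomainType.
Implicit Types (F G : {poly D}) (m : nat) (h : D).

(** The coefficient [h] may be 0: the content is a congruence modulo [X^(m+1)], so that [m] is only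
    a lower bound for the order. *)
Definition lowest_coef G m h := exists H : {poly D}, G = h%:P * 'X^m + H * 'X^(m.+1).

Lemma lowest_coefM F G m n h k : lowest_coef F m h -> lowest_coef G n k -> lowest_coef (F * G) (m + n) (h * k).
Proof.
move=> [H ->] [H' ->]; exists (h%:P * H' + H * k%:P + H * H' * 'X).
by rewrite polyCM !exprS !exprD; ring.
Qed.

Lemma lowest_coef_coef F m h : lowest_coef F m h ->
  F`_m = h /\ forall j, (j < m)%N -> F`_j = 0.
Proof.
move=> [H ->]; split=> [|j jm]; rewrite coefD coefCM coefXn coefMXn ltnS.
  by rewrite eqxx mulr1 leqnn addr0.
by rewrite (ltn_eqF jm) mulr0 ltnW // addr0.
Qed.

Lemma lowest_coef_intro F m : (forall j, (j < m)%N -> F`_j = 0) -> lowest_coef F m F`_m.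
Proof.
move=> F0; exists (drop_poly m.+1 F).
rewrite -{1}(poly_take_drop m.+1 F); congr (_ + _).
apply/polyP => j; rewrite coef_take_poly coefCM coefXn ltnS.
case: ltngtP => [/F0 ->|_|->]; by rewrite ?mulr0 ?mulr1.
Qed.

Lemma lowest_coef_exists F : F != 0 -> exists m h, h != 0 /\ lowest_coef F m h.
Proof.
move=> F0; have ex : exists m, F`_m != 0.
  by exists (size F).-1; rewrite -lead_coefE lead_coef_eq0.
exists (ex_minn ex), F`_(ex_minn ex); case: ex_minnP => m Fm mn; split=> //.
apply: lowest_coef_intro => j jm; apply/eqP; apply: contraTT jm => /mn.
by rewrite -leqNgt.
Qed.

(** Lowest coefficients multiply, so [c] is either 0 or the product of [h] with the lowest
    coefficient of [k]. *)
Lemma lowest_coef_dvd k F m n h c : h != 0 -> lowest_coef F m h -> lowest_coef (k * F) n c ->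
  exists d, c = d * h.
Proof.
move=> h0 lF lkF; have [k0|/lowest_coef_exists[l [k0 [kn0 lk]]]] := eqVneq k 0.
  by exists 0; have [<- _] := lowest_coef_coef lkF; rewrite k0 !mul0r coef0.
have [e lt_e] := lowest_coef_coef (lowest_coefM lk lF); have [<- lt_n] := lowest_coef_coef lkF.
have [nl|ln|->] := ltngtP n (l + m)%N; last by exists k0.
  by exists 0; rewrite lt_e // mul0r.
by move: e; rewrite lt_n // => /eqP; rewrite eq_sym mulf_eq0 (negPf kn0) (negPf h0).
Qed.

End LowestCoefficient.

Section InitialForm.
Variables (K : fieldType) (R : realType) (w : 'rV[R]_4).
Local Notation S := (laurent K 4).
Local Notation S0 := (laurent0 K 4).
Local Notation wt := (expo_weight w).

Lemma expo_weightD u v : wt (u + v) = wt u + wt v.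
Proof.
by rewrite -big_split; apply: eq_bigr => c _; rewrite mxE intrD mulrDr.
Qed.

Lemma expo_weight0 : wt 0 = 0.
Proof. by apply: big1 => c _; rewrite mxE mulr0. Qed.

Lemma expo_weight_quot p s : wt (delta_mx 0 p - delta_mx 0 s) = w 0 p - w 0 s.
Proof.
have wd c : wt (delta_mx 0 c) = w 0 c.
  rewrite /expo_weight (bigD1 c) //= mxE !eqxx mulr1 big1 ?addr0 // => i /negPf ic.
  by rewrite mxE ic andbF mulr0.
have := expo_weightD (delta_mx 0 p - delta_mx 0 s) (delta_mx 0 s).
by rewrite subrK !wd => ->; rewrite addrK.
Qed.

Definition wsupp (Z : set R) (g : S) := forall v, v \in msupp g -> Z (wt v).

Lemma wsuppS (Z Z' : set R) g : Z `<=` Z' -> wsupp Z g -> wsupp Z' g.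
Proof. by move=> ZZ wg v /wg /ZZ. Qed.

Lemma wsupp0 Z : wsupp Z 0. Proof. by move=> v; rewrite msupp0. Qed.

Lemma wsuppU (Z : set R) c v : Z (wt v) -> wsupp Z (<< c *g v >> : S).
Proof. by move=> Zv u /(fsubsetP msuppU_le); rewrite inE => /eqP->. Qed.

Lemma wsuppD Z g h : wsupp Z g -> wsupp Z h -> wsupp Z (g + h).
Proof.
by move=> wg wh v /(fsubsetP (msuppD_le _ _)); rewrite in_fsetU => /orP[/wg|/wh].
Qed.

Lemma wsupp_sum Z (T : eqType) (r : seq T) (F : T -> S) :
  (forall t, t \in r -> wsupp Z (F t)) -> wsupp Z (\sum_(t <- r) F t).
Proof.
by move=> wF; rewrite big_seq; apply: big_ind => //; [exact: wsupp0|exact: wsuppD].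
Qed.

Lemma wsuppM (Z Z' Z'' : set R) g h : (forall x y, Z x -> Z' y -> Z'' (x + y)) ->
  wsupp Z g -> wsupp Z' h -> wsupp Z'' (g * h).
Proof.
move=> ZZ wg wh; rewrite lmulE; apply: wsupp_sum => u ug; apply: wsupp_sum => v vh.
by apply: wsuppU; rewrite expo_weightD; apply: ZZ; [apply: wg|apply: wh].
Qed.

Lemma msupp_neq0 (f : S) : f != 0 -> exists u, u \in msupp f.
Proof.
move=> f0; apply: contrapT => h; case/eqP: f0; apply/malgP => u.
rewrite [RHS]mcoeff_outdom ?msupp0 //; apply: mcoeff_outdom.
by apply/negP => uf; apply: h; exists u.
Qed.

Lemma initial_form_coef (f : S) u : (initial_form w f)@_u =
  if all (fun v => wt u <= wt v) (msupp f) then f@_u else 0.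
Proof.
rewrite /initial_form raddf_sum /=.
have [uf|uf] := boolP (u \in msupp f); last first.
  rewrite (mcoeff_outdom uf) if_same big_seq_cond big1 // => v /andP[vf _].
  by rewrite mcoeffU; case: eqP => // e; rewrite -e vf in uf.
rewrite big_mkcond (big_fsetD1 u) //= big_seq big1 ?addr0; last first.
  move=> v; rewrite in_fsetD1 => /andP[/negPf vu _].
  by case: ifP => // _; rewrite mcoeffU vu.
by case: ifP => // _; rewrite mcoeffUU.
Qed.

Lemma initial_formD (f g : S) m : f != 0 ->
  wsupp [set m] f -> wsupp [set x | m < x] g -> initial_form w (f + g) = f.
Proof.
move=> f0 wf wg; have dis v : v \in msupp f -> g@_v = 0.
  move=> vf; apply: mcoeff_outdom; apply/negP => /wg /=.
  by rewrite (wf _ vf) /= ltxx.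
have [u0 u0f] : exists u, u \in msupp f.
  exact: msupp_neq0.
have u0fg : u0 \in msupp (f + g) by rewrite -mcoeff_neq0 mcoeffD dis // addr0 mcoeff_neq0.
have wfg v : v \in msupp (f + g) -> m <= wt v.
  move=> /(fsubsetP (msuppD_le _ _)); rewrite in_fsetU => /orP[/wf ->//|/wg].
  exact: ltW.
apply/malgP => u; rewrite initial_form_coef mcoeffD.
have [uf|uf] := boolP (u \in msupp f).
  by rewrite dis // addr0 (wf _ uf); case: allP => // h; case: h => v /wfg.
rewrite (mcoeff_outdom uf) add0r; case: allP => // h.
have [ug|ug] := boolP (u \in msupp g); last exact: mcoeff_outdom.
have := h _ u0fg; rewrite (wf _ u0f) => /le_lt_trans - /(_ _ (wg _ ug)).
by rewrite ltxx.
Qed.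

Lemma initial_form_split (f : S) : f != 0 -> exists2 v0, v0 \in msupp f &
  exists g, [/\ f = initial_form w f + g, wsupp [set wt v0] (initial_form w f) &
    wsupp [set x | wt v0 < x] g].
Proof.
move=> f0; have [u0 u0f] : exists u, u \in msupp f.
  exact: msupp_neq0.
pose v0 : msupp f := [arg min_(v < [` u0f]%fset) wt (val v)]%O.
have v0min v : v \in msupp f -> wt (val v0) <= wt v.
  move=> vf; rewrite /v0; case: arg_minP => // x _ /(_ [` vf]%fset isT).
  by [].
exists (val v0); first exact: valP.
exists (f - initial_form w f); rewrite addrC subrK; split=> // v.
  rewrite -mcoeff_neq0 initial_form_coef; case: allP => [h|_]; last by rewrite eqxx.
  rewrite mcoeff_neq0 => vf; apply/eqP; rewrite eq_le v0min // andbT.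
  by apply: h; exact: valP.
rewrite -mcoeff_neq0 mcoeffB initial_form_coef; case: allP => [h|h].
  by rewrite subrr eqxx.
rewrite subr0 mcoeff_neq0 => vf; rewrite /= lt_neqAle v0min // andbT.
by apply: contra_notN h => /eqP <- u /v0min.
Qed.

End InitialForm.

Section UnimodularMonomials.
Variables (A : comNzRingType) (X Xi Y Yi : A) (a b c d : nat).
Hypotheses (XXi : X * Xi = 1) (YYi : Y * Yi = 1) (det1 : (a * d = b * c + 1)%N).

Lemma unimodularX : (X ^+ d * Yi ^+ c) ^+ a * (Y ^+ a * Xi ^+ b) ^+ c = X.
Proof.
rewrite !exprMn -!exprM [(d * a)%N]mulnC det1 [(c * a)%N]mulnC addn1 exprS.
transitivity (X * (X * Xi) ^+ (b * c) * (Y * Yi) ^+ (a * c)); first by rewrite !exprMn; ring.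
by rewrite XXi YYi !expr1n !mulr1.
Qed.

Lemma unimodularY : (X ^+ d * Yi ^+ c) ^+ b * (Y ^+ a * Xi ^+ b) ^+ d = Y.
Proof.
rewrite !exprMn -!exprM det1 [(d * b)%N]mulnC [(c * b)%N]mulnC addn1 exprS.
transitivity (Y * (X * Xi) ^+ (b * d) * (Y * Yi) ^+ (b * c)); first by rewrite !exprMn; ring.
by rewrite XXi YYi !expr1n !mulr1.
Qed.

End UnimodularMonomials.

Lemma evals_neq0 (K : fieldType) (B : idomainType) (iota : {rmorphism K -> B}) z
    (g : laurent0 K 4) (b : B) :
  (forall c, z c != 0) -> evals iota z g b -> b != 0 -> g != 0.
Proof.
move=> z0 [n [bg e]] b0; apply: contraNneq b0 => g0.
move: e; rewrite g0 clr0 => /esym/eqP; rewrite mulf_eq0 expf_eq0.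
by case/orP => // /andP[_ /prodf_eq0[c _]]; rewrite (negPf (z0 c)).
Qed.

(** * Initial ideal of a curve along the weight [a e_p + b e_q] *)

Section Degeneration.
Variables (K : fieldType) (R : realType) (p q r s : 'I_4).
Hypothesis pqrs : uniq [:: p; q; r; s].
Variables (a b c d : nat).
Hypothesis det1 : (a * d = b * c + 1)%N.
Local Notation S0 := (laurent0 K 4).
Local Notation KUT := {poly {poly K}}.

(* The unimodular substitution [X = T^a U^c], [Y = T^b U^d], adapted to the weight
   [a e_p + b e_q]: the outer variable T carries the weight, and the lowest
   T-coefficient of the image of f generates the initial ideal. *)
Definition monX : KUT := 'X^a * 'X%:P ^+ c.
Definition monY : KUT := 'X^b * 'X%:P ^+ d.
(* The T-free part of [1 + X + Y]; note that [a > 0] and, if [b = 0], [d = 1]. *)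
Definition lowZ : {poly K} := 1 + 'X *+ (b == 0%N).
Definition deg_coord : 'I_4 -> KUT := four p q r monX monY (- (1 + monX + monY)).
(** Each coordinate is replaced by its lowest term in [T], which gives the coordinates of the
    initial degeneration of the plane. *)
Definition init_coord : 'I_4 -> KUT := four p q r monX monY (- lowZ%:P).
Definition deg_map : {rmorphism {poly {poly K}} -> KUT} := ev2 (cst2 K) monX monY.
(** The inverse substitution [T = X^d Y^(-c)], [U = Y^a X^(-b)]. By the determinant condition the
    weights of [T] and [U] are 1 and 0. *)
Definition monT : S0 := xquot K p s ^+ d * xquot K s q ^+ c.
Definition monU : S0 := xquot K q s ^+ a * xquot K s p ^+ b.
Definition init_emb : {rmorphism KUT -> S0} := ev2 (cst K) monT monU.
Definition weight : 'rV[R]_4 := \row_j (a%:R *+ (j == p) + b%:R *+ (j == q)).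

Let pq : (p == q) = false.
Proof. by apply/negbTE; move: pqrs; rewrite /= inE negb_or => /andP[/andP[]]. Qed.
Let qp : (q == p) = false. Proof. by rewrite eq_sym. Qed.
Let rpq : (r == p = false) * (r == q = false).
Proof.
move: pqrs; rewrite /= !inE !negb_or => /and4P[/and3P[_ h1 _] /andP[h2 _] _ _].
by split; apply/negbTE; rewrite eq_sym.
Qed.
Let spq : (s == p = false) * (s == q = false).
Proof.
move: pqrs; rewrite /= !inE !negb_or => /and4P[/and3P[_ _ h1] /andP[_ h2] _ _].
by split; apply/negbTE; rewrite eq_sym.
Qed.

Lemma weight_p : weight 0 p = a%:R. Proof. by rewrite mxE eqxx pq addr0. Qed.
Lemma weight_q : weight 0 q = b%:R. Proof. by rewrite mxE eqxx qp add0r. Qed.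
Lemma weight_r : weight 0 r = 0. Proof. by rewrite mxE !rpq addr0. Qed.
Lemma weight_s : weight 0 s = 0. Proof. by rewrite mxE !spq addr0. Qed.

Let a_gt0 : (0 < a)%N.
Proof. by case: (posnP a) det1 => // ->; rewrite mul0n addn1. Qed.
Let ad_b0 : b = 0%N -> a = 1%N /\ d = 1%N.
Proof.
by move=> b0; move: det1; rewrite b0 mul0n => /eqP; rewrite muln_eq1 => /andP[/eqP-> /eqP->].
Qed.

Lemma init_embC k : init_emb (cst2 K k) = cst K k. Proof. exact: ev2C. Qed.
Lemma init_embT : init_emb 'X = monT. Proof. exact: ev2X. Qed.
Lemma init_embU : init_emb 'X%:P = monU. Proof. exact: ev2Y. Qed.
Lemma init_emb_monX : init_emb monX = xquot K p s.
Proof.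
rewrite /monX ev2M 2!ev2Xn init_embT init_embU.
by apply: unimodularX; rewrite ?xqV.
Qed.
Lemma init_emb_monY : init_emb monY = xquot K q s.
Proof.
rewrite /monY ev2M 2!ev2Xn init_embT init_embU.
by apply: unimodularY; rewrite ?xqV.
Qed.

Lemma monT_unit : exists m, monT * m = 1.
Proof.
exists (xquot K s p ^+ d * xquot K q s ^+ c); rewrite mulrACA -!exprMn.
by rewrite !xqV !expr1n mulr1.
Qed.

Lemma monU_unit : exists m, monU * m = 1.
Proof.
exists (xquot K s q ^+ a * xquot K p s ^+ b); rewrite mulrACA -!exprMn.
by rewrite !xqV !expr1n mulr1.
Qed.

Lemma chart_init_emb G : chart_emb K p q s G = init_emb (deg_map G).
Proof.
rewrite /chart_emb -init_emb_monX -init_emb_monY /deg_map.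
by rewrite (ev2_comp _ _ _ init_embC).
Qed.

Lemma lowZ_neq0 : lowZ != 0.
Proof.
have : lowZ.[0] != 0.
  by rewrite /lowZ hornerD hornerMn hornerX hornerC mul0rn addr0 oner_neq0.
by apply: contraNneq => ->; rewrite horner0.
Qed.

Lemma init_coord_neq0 j : init_coord j != 0.
Proof.
have mon0 m n : ('X^m * 'X%:P ^+ n : KUT) != 0.
  by rewrite mulf_neq0 // expf_neq0 ?polyC_eq0 ?polyX_eq0.
move: j; apply: (four_cases pqrs); rewrite /init_coord.
- by rewrite four1; apply: mon0.
- by rewrite (four2 pqrs); apply: mon0.
- by rewrite (four3 pqrs) oppr_eq0 polyC_eq0 lowZ_neq0.
- by rewrite (four4 pqrs) oner_neq0.
Qed.

Lemma init_evals G : evals (cst2 K) init_coord (init_emb G) G.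
Proof.
have z4 : init_coord s = 1 by exact: four4.
have ep := @evals_xq K _ (cst2 K) init_coord p s z4.
have eq := @evals_xq K _ (cst2 K) init_coord q s z4.
rewrite /init_coord four1 -/init_coord in ep.
rewrite /init_coord (four2 pqrs) -/init_coord in eq.
have nz := init_coord_neq0.
have mX0 : monX != 0 by have := nz p; rewrite /init_coord four1.
have mY0 : monY != 0 by have := nz q; rewrite /init_coord (four2 pqrs).
have eT : evals (cst2 K) init_coord monT 'X.
  apply: (evals_div nz (g' := xquot K q s ^+ c) (h := xquot K p s ^+ d) (b' := monY ^+ c)).
  - exact: expf_neq0.
  - by rewrite /monT -mulrA -exprMn xqV expr1n mulr1.
  - rewrite (_ : 'X * _ = monX ^+ d); first exact: evalsX.
    by rewrite /monX /monY !exprMn -!exprM det1 addn1 exprS [(c * d)%N]mulnC mulrA.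
  - exact: evalsX.
have eU : evals (cst2 K) init_coord monU 'X%:P.
  apply: (evals_div nz (g' := xquot K p s ^+ b) (h := xquot K q s ^+ a) (b' := monX ^+ b)).
  - exact: expf_neq0.
  - by rewrite /monU -mulrA -exprMn xqV expr1n mulr1.
  - rewrite (_ : 'X%:P * _ = monY ^+ a); first exact: evalsX.
    rewrite /monX /monY !exprMn -!exprM [(d * a)%N]mulnC det1 addn1 exprS.
    by rewrite mulrCA [(a * b)%N]mulnC [(c * b)%N]mulnC.
  - exact: evalsX.
have := @evals_morph K _ (cst2 K) init_coord _ (cst2 K) init_emb idfun 'X 'X%:P G init_embC (fun=> erefl).
by rewrite init_embT init_embU ev2_id; apply.
Qed.

Local Notation w := weight.
Local Notation hom m g := (wsupp w [set m%R] (@laurent0_val K 4 g)).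

Lemma homM m n (g h : S0) : hom m g -> hom n h -> hom (m + n) (g * h).
Proof. by rewrite laurent0_valM; apply: wsuppM => x y -> ->. Qed.

Lemma hom_cst k : hom 0 (cst K k).
Proof. by apply: wsuppU; rewrite /= expo_weight0. Qed.

Lemma hom1 : hom 0 (1 : S0).
Proof. by have := @hom_cst 1; rewrite rmorph1. Qed.

Lemma homX m n (g : S0) : hom m g -> hom (m *+ n) (g ^+ n).
Proof.
move=> hg; elim: n => [|n IH]; first by rewrite expr0 mulr0n; apply: hom1.
by rewrite exprS mulrS; apply: homM.
Qed.

Lemma hom_xq i j : hom (w 0 i - w 0 j) (xquot K i j).
Proof. by apply: wsuppU; rewrite /= expo_weight_quot. Qed.

Lemma hom_monT : hom 1 monT.
Proof.
have := homM (@homX _ d _ (@hom_xq p s)) (@homX _ c _ (@hom_xq s q)).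
rewrite weight_p weight_s weight_q subr0 sub0r.
by rewrite (_ : _ + _ = 1 :> R) // mulNrn -!mulrnA det1 natrD addrAC subrr add0r.
Qed.

Lemma hom_monU : hom 0 monU.
Proof.
have := homM (@homX _ a _ (@hom_xq q s)) (@homX _ b _ (@hom_xq s p)).
rewrite weight_p weight_s weight_q subr0 sub0r.
by rewrite (_ : _ + _ = 0 :> R) // mulNrn -!mulrnA mulnC subrr.
Qed.

Lemma hom_init_embC (h : {poly K}) : hom 0 (init_emb h%:P).
Proof.
elim/poly_ind: h => [|h k IH]; first by rewrite ev20; apply: wsupp0.
rewrite polyCD polyCM ev2D ev2M init_embU init_embC laurent0_valD.
apply: wsuppD; last exact: hom_cst.
by rewrite -[0]addr0; apply: homM => //; apply: hom_monU.
Qed.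

Lemma init_emb_ge0 G : wsupp w [set x | 0 <= x] (init_emb G).
Proof.
elim/poly_ind: G => [|G h IH]; first by rewrite ev20; apply: wsupp0.
rewrite ev2D ev2M init_embT laurent0_valD; apply: wsuppD.
  rewrite laurent0_valM; apply: wsuppM IH hom_monT => x y /= x0 ->.
  by rewrite addr_ge0 // ler01.
by apply: wsuppS (@hom_init_embC h) => x /= ->.
Qed.

Lemma init_coord_emb_neq0 G : G != 0 -> init_emb G != 0.
Proof. exact: evals_neq0 init_coord_neq0 (init_evals G). Qed.

Section InitialIdeal.
Variables (P : set S0) (f : {poly {poly K}}).
Hypotheses (LP : @L0 K `<=` P) (idP : is_ideal P) (Pf : chart_eq p q r s P f).
Variables (m : nat) (h : {poly K}).
Hypotheses (lowf : lowest_coef (deg_map f) m h) (h0 : h != 0).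
Local Notation J := (initial_ideal w P).

Lemma initial_ideal_ideal : is_ideal J. Proof. exact: ideal_gen_ideal. Qed.

Lemma initial_ideal_mem g : P g -> J (initial_form0 w g).
Proof. by move=> Pg; apply: ideal_gen_sub; exists g. Qed.

(** The equation becomes [T^m h(U)] plus multiples of [T^(m+1)]. Since [U] has weight 0, the first
    term is the initial form, and [T] is a unit. *)
Lemma initial_ideal_low : J (init_emb h%:P).
Proof.
have [H e] := lowf; have [tv tv1] := monT_unit.
have /initial_ideal_mem : P (chart_emb K p q s f) by case: Pf.
have nz : monT ^+ m * init_emb h%:P != 0.
  rewrite -init_embT -ev2Xn -ev2M; apply: init_coord_emb_neq0.
  by rewrite mulf_neq0 ?expf_neq0 ?polyX_eq0 ?polyC_eq0.
have e1 : init_emb (deg_map f) = monT ^+ m * init_emb h%:P + monT ^+ m.+1 * init_emb H.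
  rewrite e ev2D; congr (_ + _).
    by rewrite mulrC ev2M ev2Xn init_embT.
  by rewrite mulrC ev2M ev2Xn init_embT.
have -> : initial_form0 w (chart_emb K p q s f) = monT ^+ m * init_emb h%:P.
  apply: val_inj; rewrite chart_init_emb e1.
  transitivity (initial_form w (laurent0_val (monT ^+ m * init_emb h%:P + monT ^+ m.+1 * init_emb H))) => //.
  rewrite laurent0_valD.
  apply: (@initial_formD _ _ _ _ _ m%:R).
  - by apply: contra_neq nz => v0; apply: val_inj.
  - by rewrite -[_%:R]addr0; apply: homM; [apply: homX; apply: hom_monT|exact: hom_init_embC].
  - rewrite laurent0_valM; have hT := @homX _ m.+1 _ hom_monT.
    apply: wsuppM hT (@init_emb_ge0 H) => x y /= -> y0.
    by rewrite -[ltLHS]addr0 ltr_leD // ltr_nat.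
by apply: (ideal_unit initial_ideal_ideal (b := tv ^+ m)); rewrite -exprMn tv1 expr1n.
Qed.

Let linear_low : S0 := xquot K r s + (1 + xquot K q s *+ (b == 0%N)).

(** Seen by evaluating at the point whose coordinate [x_r] is an indeterminate and whose other
    coordinates are 1. *)
Lemma linear_low_neq0 : linear_low != 0.
Proof.
pose z : 'I_4 -> {poly K} := four p q r 1 1 'X.
have z4 : z s = 1 by exact: four4.
have z0 j : z j != 0.
  move: j; apply: (four_cases pqrs); rewrite /z.
  - by rewrite four1 oner_neq0.
  - by rewrite (four2 pqrs) oner_neq0.
  - by rewrite (four3 pqrs) polyX_eq0.
  - by rewrite (four4 pqrs) oner_neq0.
have eqq : evals polyC z (xquot K q s) 1.
  by have := @evals_xq K _ polyC z q s z4; rewrite {2}/z (four2 pqrs).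
have er : evals polyC z (xquot K r s) 'X.
  by have := @evals_xq K _ polyC z r s z4; rewrite {2}/z (four3 pqrs).
have e : evals polyC z linear_low ('X + (1 + 1 *+ (b == 0%N))).
  apply: evalsD => //; apply: evalsD; first exact: evals1.
  case: (b == 0%N) => //; rewrite !mulr0n -(rmorph0 (cst K)) -(rmorph0 polyC).
  exact: evals_cst.
apply: (evals_neq0 z0 e).
have -> : 'X + (1 + 1 *+ (b == 0%N)) = 'X + (1 + 1 *+ (b == 0%N))%:P :> {poly K}.
  by rewrite polyCD polyCMn.
by rewrite -size_poly_gt0 size_XaddC.
Qed.

Lemma initial_ideal_linear : J linear_low.
Proof.
have /initial_ideal_mem : P (xquot K r s + (1 + xquot K p s + xquot K q s)).
  by apply: LP; apply: L0_linear.
have e : xquot K r s + (1 + xquot K p s + xquot K q s) =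
   linear_low + (xquot K p s + xquot K q s *+ (b != 0%N)).
  rewrite /linear_low; case: (b == 0%N) => /=; rewrite ?mulr1n ?mulr0n ?addr0;
  rewrite -!addrA; congr (_ + _); congr (_ + _); first by rewrite addrC.
congr J; apply: val_inj.
transitivity (initial_form w (laurent0_val (linear_low + (xquot K p s + xquot K q s *+ (b != 0%N))))).
  by rewrite -e.
rewrite laurent0_valD.
have hq : hom b%:R (xquot K q s) by have := @hom_xq q s; rewrite weight_q weight_s subr0.
have hp : hom a%:R (xquot K p s) by have := @hom_xq p s; rewrite weight_p weight_s subr0.
have hr : hom 0 (xquot K r s) by have := @hom_xq r s; rewrite weight_r weight_s subr0.
apply: (@initial_formD _ _ _ _ _ 0).
- by apply: contra_neq linear_low_neq0 => v0; apply: val_inj.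
- rewrite /linear_low !laurent0_valD; apply: wsuppD => //; apply: wsuppD; first exact: hom1.
  have [b0|_] := eqVneq b 0%N; last by rewrite mulr0n; apply: wsupp0.
  by rewrite mulr1n; move: hq; rewrite b0.
- rewrite laurent0_valD; apply: wsuppD.
    by apply: wsuppS hp => x /= ->; rewrite ltr0n.
  have [b0|b0] := eqVneq b 0%N; first by rewrite mulr0n; apply: wsupp0.
  by rewrite mulr1n; apply: wsuppS hq => x /= ->; rewrite ltr0n lt0n.
Qed.

Lemma monU_b0 : b = 0%N -> monU = xquot K q s.
Proof. by move=> b0; rewrite /monU b0 (proj1 (ad_b0 b0)) mulr1. Qed.

Lemma initial_ideal_coord j : J (init_emb (init_coord j) - xquot K j s).
Proof.
have idJ := initial_ideal_ideal; have J0 := ideal0 idJ.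
move: j; apply: (four_cases pqrs); rewrite /init_coord.
- by rewrite four1 init_emb_monX subrr.
- by rewrite (four2 pqrs) init_emb_monY subrr.
- rewrite (four3 pqrs) ev2N -opprD addrC; apply: (idealN idJ).
  rewrite (_ : init_emb _ = 1 + xquot K q s *+ (b == 0%N)); first exact: initial_ideal_linear.
  rewrite /lowZ polyCD ev2D ev21; congr (_ + _).
  have [b0|_] := eqVneq b 0%N; last by rewrite !mulr0n ev20.
  by rewrite !mulr1n init_embU monU_b0.
- by rewrite (four4 pqrs) ev21 xqq subrr.
Qed.

(** The exponent of [T] in the cleared monomial: the weight of [v] shifted by [n (a + b)]. The
    coordinate [x_r] does not enter because it has order 0 in [T]; [rest_expo] is the matching
    exponent of [U]. *)
Definition deg_expo (n : nat) (v : 'rV[int]_4) : nat :=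
  (a * absz (v 0%R p + n%:Z)%R + b * absz (v 0%R q + n%:Z)%R)%N.

Definition rest_expo (n : nat) (v : 'rV[int]_4) : nat :=
  (c * absz (v 0%R p + n%:Z)%R + d * absz (v 0%R q + n%:Z)%R)%N.

Lemma prod_four_mon (n : nat) (v : 'rV[int]_4) (t : KUT) :
  \prod_j four p q r monX monY t j ^+ absz (v 0 j + n%:Z) =
  'X^(deg_expo n v) * (('X^(rest_expo n v))%:P * t ^+ absz (v 0 r + n%:Z)).
Proof.
rewrite (prod_four pqrs) four1 (four2 pqrs) (four3 pqrs) (four4 pqrs) expr1n mulr1.
rewrite mulrA; congr (_ * _); rewrite /monX /monY !exprMn -!exprM /deg_expo /rest_expo.
by rewrite polyC_exp !exprD mulrACA.
Qed.

Lemma deg_coord_congr : principal_ideal 'X (- (1 + monX + monY) - - lowZ%:P).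
Proof.
have idX := principal_ideal_ideal ('X : KUT).
have Xdvd k G : (0 < k)%N -> principal_ideal ('X : KUT) ('X^k * G).
  by move=> k0; exists ('X^(k.-1) * G); rewrite mulrAC -exprSr prednK.
have -> : - (1 + monX + monY) - - lowZ%:P = - (monX + (monY - 'X%:P *+ (b == 0%N))).
  rewrite /lowZ polyCD polyCMn; move: monX monY ('X%:P *+ _) => x y z.
  by rewrite polyC1; ring.
apply: (idealN idX); apply: (idealD idX); first exact: Xdvd.
rewrite /monY; have [b0|b0] := eqVneq b 0%N; last first.
  by rewrite subr0; apply: Xdvd; rewrite lt0n.
by rewrite b0 (proj2 (ad_b0 b0)) mul1r expr1 subrr; apply: (ideal0 idX).
Qed.

Lemma clr_high n k (g : laurent K 4) :
  (forall v, v \in msupp g -> (k <= deg_expo n v)%N) ->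
  principal_ideal 'X^k (@clr K 4 _ (cst2 K) deg_coord n g).
Proof.
move=> gk; have idX := principal_ideal_ideal ('X^k : KUT).
apply: (ideal_sum idX) => v /gk kv; apply: (idealMl idX).
by rewrite prod_four_mon -(subnK kv) exprD mulrAC; eexists.
Qed.

Lemma clr_init n k (g : laurent K 4) :
  (forall v, v \in msupp g -> deg_expo n v = k) ->
  (exists e, @clr K 4 _ (cst2 K) init_coord n g = e%:P * 'X^k) /\
  principal_ideal 'X^(k.+1) (@clr K 4 _ (cst2 K) deg_coord n g - @clr K 4 _ (cst2 K) init_coord n g).
Proof.
move=> gk; split.
  exists (\sum_(v <- msupp g) (g@_v)%:P * ('X^(rest_expo n v) * (- lowZ) ^+ absz (v 0 r + n%:Z))).
  rewrite /clr (raddf_sum polyC) mulr_suml big_seq [RHS]big_seq; apply: eq_bigr => v /gk kv.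
  by rewrite prod_four_mon kv /= 2!polyCM [((- lowZ) ^+ _)%:P]polyC_exp polyCN mulrCA [RHS]mulrC.
have idX := principal_ideal_ideal ('X^(k.+1) : KUT).
rewrite /clr -sumrB; apply: (ideal_sum idX) => v /gk kv.
rewrite -mulrBr; apply: (idealMl idX); rewrite !prod_four_mon kv -mulrBr -mulrBr.
have := idealB_exp (principal_ideal_ideal ('X : KUT)) (absz (v 0 r + n%:Z)) deg_coord_congr.
case=> G ->; exists ('X^(rest_expo n v)%:P * G); rewrite exprS.
by move: ('X^k) ('X^(rest_expo n v)) => x y; ring.
Qed.

Lemma deg_expoE n (g : laurent K 4) v : bounded_below n g -> v \in msupp g ->
  (deg_expo n v)%:R = expo_weight w v + (n * (a + b))%:R.
Proof.
move=> bg vg; have absE j : (absz (v 0 j + n%:Z))%:R = (v 0 j)%:~R + n%:R :> R.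
  by rewrite -[LHS]/((Posz _)%:~R) gez0_abs ?intrD //; exact: bg.
rewrite /deg_expo natrD !natrM !absE /expo_weight (sum_four pqrs).
by rewrite weight_p weight_q weight_r weight_s natrD; ring.
Qed.

Lemma deg_map_coord j : deg_map (chart_coord K p q r j) = deg_coord j.
Proof.
move: j; apply: (four_cases pqrs); rewrite /deg_coord /chart_coord.
- by rewrite 2!four1 ev2X.
- by rewrite 2!(four2 pqrs) ev2Y.
- by rewrite 2!(four3 pqrs) ev2N 2!ev2D ev21 ev2X ev2Y.
- by rewrite 2!(four4 pqrs) ev21.
Qed.

Lemma deg_map_clr n (g : laurent K 4) :
  deg_map (@clr K 4 _ (cst2 K) (chart_coord K p q r) n g) = @clr K 4 _ (cst2 K) deg_coord n g.
Proof.
rewrite (@clr_morph K 4 _ _ (cst2 K) deg_map (chart_coord K p q r) n g).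
apply: (@eq_clr K 4 _ _ (cst2 K)) => [x|j]; first exact: ev2C.
exact: deg_map_coord.
Qed.

(** The converse bound to [initial_ideal_low]. For [g] in [P], the cleared value in the degenerating
    coordinates is a multiple of the image of [f]. Its lowest term in [T] is the value of the
    initial form of [g] in the degenerate coordinates, so [h] divides it by [lowest_coef_dvd]. *)
Lemma initial_ideal_sub : J `<=` pullback (cst2 K) init_coord (principal_ideal h%:P).
Proof.
have idh := principal_ideal_ideal (h%:P : KUT).
apply: ideal_gen_min; first exact: (pullback_ideal _ _ idh).
move=> _ [g Pg <-].
have [g0|g0] := eqVneq (laurent0_val g) 0.
  rewrite (_ : initial_form0 w g = 0); last first.
    by apply: val_inj; rewrite /= g0 /initial_form msupp0 big_seq_fset0.
  by apply: (ideal0 (pullback_ideal _ _ idh)).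
have [v0 v0g [g' [eg ing g'h]]] := initial_form_split w g0.
have [n0 [bn0 [k ek]]] := (proj1 Pf) _ Pg.
have [n1 [bin bg']] := bounded_below2_exists (initial_form w (laurent0_val g)) g'.
pose n := (n1 + n0)%N.
have {}bin := bounded_belowW (leq_addr n0 n1) bin; have {}bg' := bounded_belowW (leq_addr n0 n1) bg'.
have bg : bounded_below n g := bounded_belowW (leq_addl n1 n0) bn0.
have [k' {}ek] : principal_ideal f (@clr K 4 _ (cst2 K) (chart_coord K p q r) n g).
  by apply: (pullbackS (principal_ideal_ideal f) bn0 _ (leq_addl n1 n0)); exists k.
have {}ek : @clr K 4 _ (cst2 K) deg_coord n g = deg_map k' * deg_map f.
  by rewrite -deg_map_clr ek ev2M.
pose M := deg_expo n v0.
have inM v : v \in msupp (initial_form w (laurent0_val g)) -> deg_expo n v = M.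
  move=> vi; apply/eqP; rewrite -(eqr_nat R) (deg_expoE bin vi) (deg_expoE bg v0g).
  by rewrite (ing v vi).
have gM v : v \in msupp g' -> (M.+1 <= deg_expo n v)%N.
  move=> vi; rewrite -(ltr_nat R) (deg_expoE bg' vi) (deg_expoE bg v0g).
  by rewrite ltrD2r; exact: (g'h v vi).
have [[e ee] [G1 eG1]] := clr_init inM; have [G2 eG2] := clr_high gM.
have lowg : lowest_coef (deg_map k' * deg_map f) M e.
  exists (G1 + G2); rewrite -ek eg clrD eG2 mulrDl -eG1 -ee addrA.
  by rewrite [X in _ = X + _]addrC subrK.
have [e' ee'] := lowest_coef_dvd h0 lowf lowg.
by exists n; split=> //; exists (e'%:P * 'X^M); rewrite /= ee ee' polyCM mulrAC.
Qed.

End InitialIdeal.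
End Degeneration.

(** * Minimal primes of the initial ideal and their lengths *)

Section PrimeDecomposition.
Variables (K : fieldType) (p q r s : 'I_4).
Hypothesis closedK : splits K.
Hypothesis pqrs : uniq [:: p; q; r; s].
Variables (a b c d : nat).
Hypothesis det1 : (a * d = b * c + 1)%N.
Local Notation S0 := (laurent0 K 4).
Local Notation KUT := {poly {poly K}}.
Local Notation coord := (init_coord K p q r a b c d).
Local Notation emb := (init_emb K p q s a b c d).
Local Notation clr := (@clr K 4 _ (cst2 K) coord).

(* The roots at which no coordinate of the torus vanishes. *)
Definition good_root (al : K) := (al != 0) && ((b != 0%N) || (al != -1)).

Lemma ev_atC (al : K) (g : {poly K}) : ev_at al g%:P = (g.[al])%:P.
Proof.
rewrite /ev_at ev2P; apply/esym.
by apply: (@ev1_uniq _ _ _ _ (polyC \o horner_eval al)) => [k|] /=; rewrite /horner_eval ?hornerC ?hornerX.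
Qed.

(** The prime of the curve [U = al], with [T] as parameter: a translate of a one-parameter subgroup
    of the torus. *)
Definition root_prime (al : K) : set S0 := pullback (cst2 K) coord (ring_ker (ev_at al)).

Lemma good_coord al j : good_root al -> ~ ring_ker (ev_at al) (coord j).
Proof.
case/andP => al0 alb /eqP; apply/negP; move: j.
have mon m n : ev_at al ('X^m * 'X%:P ^+ n) != 0.
  rewrite /ev_at ev2M ev2Xn ev2X ev2Xn ev2Y.
  by apply: mulf_neq0; apply: expf_neq0; rewrite ?polyX_eq0 ?polyC_eq0.
apply: (four_cases pqrs); rewrite /init_coord.
- by rewrite four1; apply: mon.
- by rewrite (four2 pqrs); apply: mon.
- rewrite (four3 pqrs) (_ : ev_at al _ = - ((lowZ K b).[al])%:P); last first.
    by rewrite -ev_atC; exact: ev2N.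
  rewrite oppr_eq0 polyC_eq0 /lowZ hornerD hornerC hornerMn hornerX.
  case: eqP alb => [_ /=|_ _]; last by rewrite mulr0n addr0 oner_neq0.
  by apply: contraNneq => h; rewrite mulr1n addrC in h; rewrite -addr_eq0 h.
- by rewrite (four4 pqrs) /ev_at ev21 oner_eq0.
Qed.

Lemma root_prime_prime al : good_root al -> is_prime (root_prime al).
Proof.
by move=> gal; apply: pullback_prime => [|j]; [exact: ring_ker_prime|exact: good_coord].
Qed.

Definition uniformizer (al : K) : S0 := emb ('X%:P - al%:P%:P).

Lemma root_primeP al G : good_root al -> root_prime al (emb G) <-> ev_at al G = 0.
Proof.
move=> gal; split=> [|e].
  by apply: (pullback_evals (ring_ker_prime (ev_at al)) (fun j => good_coord gal) (init_evals pqrs det1 G)).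
apply: evals_pullback (init_evals pqrs det1 G) e.
by case: (ring_ker_prime (ev_at al)).
Qed.

Variables (J : set S0) (h : {poly K}).
Hypothesis idJ : is_ideal J.
Hypothesis Jlow : J (emb h%:P).
Hypothesis Jcoord : forall j, J (emb (coord j) - xquot K j s).
Hypothesis Jsub : J `<=` pullback (cst2 K) coord (principal_ideal h%:P).
Hypothesis h0 : h != 0.

Lemma root_prime_sub al : root h al -> J `<=` root_prime al.
Proof.
move=> /rootP hal; apply: (subset_trans Jsub); apply: pullback_sub.
apply: principal_ideal_min; first by case: (ring_ker_prime (ev_at al)).
by rewrite /ring_ker /preimage /= ev_atC hal polyC0.
Qed.

Lemma uniformizer_mem al : good_root al -> root_prime al (uniformizer al).
Proof. by move=> gal; apply/(root_primeP _ gal)/ev_atB. Qed.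

(** The cleared value of [g] is a multiple of [U - al], and modulo [J] it represents [g] times a
    unit. So [U - al] generates the prime modulo [J], as the computation of lengths requires. *)
Lemma root_prime_gen al g : root_prime al g -> exists g', J (g - uniformizer al * g').
Proof.
move=> [n [bg /ev_at_dvd[k ek]]].
have h1 := clear_congr idJ (@init_embC K p q s a b c d) Jcoord bg.
have [t xt] := xprod_unit K n s.
exists (emb k * t); move: h1; rewrite /= ek ev2M => /(idealBC idJ)/(idealMl idJ t).
congr J; rewrite mulrBr mulrA [t * _]mulrC xt mul1r; congr (_ - _).
by rewrite mulrA [RHS]mulrC [t * emb k]mulrC.
Qed.

Lemma init_embB_const (G : KUT) k : emb (G - k%:P%:P) = emb G - cst K k.
Proof. by rewrite [LHS]ev2B ev2C. Qed.

(** As [h(U)] is in [Q], so is some [U - al]. The value [al = 0] is impossible because [U] is a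
    unit; if [b = 0], then [x_r/x_s] is congruent to [-(1 + U)], so [al = -1] would put a unit into
    [Q]. *)
Lemma prime_over_root Q : is_prime Q -> J `<=` Q ->
  exists al, [/\ root h al, good_root al & root_prime al `<=` Q].
Proof.
move=> pQ JQ; have [idQ Q1 _] := pQ.
pose rho : {rmorphism {poly K} -> S0} := emb \o polyC.
have [al hal] := prime_root closedK (rho := rho) pQ h0 (JQ _ Jlow).
rewrite /rho /= polyCB init_embB_const init_embU => Qal.
have gal : good_root al.
  rewrite /good_root; apply/andP; split.
    apply/eqP => al0; move: Qal; rewrite al0 rmorph0 subr0.
    by have [t xt] := monU_unit K p q s a b; apply: prime_unit xt.
  apply/orP; have [b0|] := eqVneq b 0%N; [right|by left].
  apply/eqP => al1; have := JQ _ (Jcoord r); rewrite /init_coord (four3 pqrs).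
  have -> : lowZ K b = 1 + 'X by rewrite /lowZ b0 mulr1n.
  have -> : emb (- (1 + 'X)%:P) = - (1 + monU K p q s a b).
    by rewrite [LHS]ev2N polyCD ev2D ev21 ev2Y.
  move: Qal; rewrite al1 rmorphN1 opprK addrC => Qal /(idealBC idQ).
  rewrite opprK => Qr; have {Qr Qal} := idealB idQ Qr Qal; rewrite addrK.
  by apply: prime_unit (xqV K r s).
exists al; split=> // g /root_prime_gen[g' /JQ Qg].
apply: (idealB_mem idQ Qg); apply: (idealMr idQ).
by rewrite /uniformizer init_embB_const init_embU.
Qed.

Lemma root_prime_inj al be : good_root al -> good_root be ->
  root_prime al `<=` root_prime be -> al = be.
Proof.
move=> gal gbe /(_ _ (uniformizer_mem gal)) /(root_primeP _ gbe).
rewrite /ev_at ev2B ev2Y ev2C -polyCB => /eqP.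
by rewrite polyC_eq0 subr_eq0 => /eqP.
Qed.

Section Roots.
Variable rs : seq K.
Hypothesis hrs : h = lead_coef h *: \prod_(z <- rs) ('X - z%:P).

Lemma root_mem al : root h al = (al \in rs).
Proof. by rewrite hrs rootZ ?lead_coef_eq0 // root_prod_XsubC. Qed.

Lemma minimal_primesE : minimal_primes J =
  [set root_prime al | al in [set` [seq z <- undup rs | good_root z]]].
Proof.
apply/seteqP; split=> [Q [[pQ JQ] minQ]|_ [al /= + <-]].
  have [al [hal gal sQ]] := prime_over_root pQ JQ; exists al.
    by rewrite /= mem_filter gal mem_undup -root_mem.
  by apply: minQ => //; split; [exact: root_prime_prime|exact: root_prime_sub].
rewrite mem_filter mem_undup -root_mem => /andP[gal hal]; split.
  by split; [exact: root_prime_prime|exact: root_prime_sub].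
move=> Q [pQ JQ] QR; have [be [hbe gbe sQ]] := prime_over_root pQ JQ.
have e := root_prime_inj gbe gal (subset_trans sQ QR).
by apply/seteqP; split=> //; rewrite -e.
Qed.

Lemma root_factor al : exists2 h1, ~~ root h1 al & h = ('X - al%:P) ^+ count_mem al rs * h1.
Proof.
exists (lead_coef h *: \prod_(z <- rs | z != al) ('X - z%:P)).
  rewrite rootZ ?lead_coef_eq0 // -big_filter root_prod_XsubC mem_filter.
  by rewrite eqxx.
rewrite {1}hrs -scalerAr; congr (_ *: _); rewrite (bigID (pred1 al)) /=; congr (_ * _).
rewrite -big_filter (eq_big_seq (fun=> 'X - al%:P)); last first.
  by move=> z; rewrite mem_filter => /andP[/eqP->].
by rewrite big_const_seq iter_mulr_1 count_predT size_filter.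
Qed.

Variable R : realType.

(** Write [h = (U - al)^e h1] with [h1(al)] non-zero. Then [h1] kills the [e]-th power of the
    uniformizer. If [g] kills a smaller power, cancelling it in the polynomial ring shows that
    [U - al] divides the value of [g], up to coordinates, which do not vanish at [al]; so [g] is in
    the prime. *)
Lemma loc_length_root al : good_root al -> root h al ->
  loc_length R J (root_prime al) = ((count_mem al rs)%:R)%:E.
Proof.
move=> gal hal; have [h1 h1al eh] := root_factor al.
have pQ := root_prime_prime gal; have [idQ _ _] := pQ.
have Qx := uniformizer_mem gal.
have Qc : ~ root_prime al (emb h1%:P).
  by move=> /(root_primeP _ gal)/eqP; rewrite ev_atC polyC_eq0; exact/negP.
have Jc : J (emb h1%:P * uniformizer al ^+ count_mem al rs).
  move: Jlow; congr J; rewrite [in LHS]eh polyCM polyC_exp polyCB.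
  rewrite /uniformizer; move: ('X%:P - al%:P%:P) => G.
  have -> : emb (G ^+ count_mem al rs * h1%:P) = emb (G ^+ count_mem al rs) * emb h1%:P.
    exact: ev2M.
  have -> : emb (G ^+ count_mem al rs) = emb G ^+ count_mem al rs by exact: ev2Xn.
  exact: mulrC.
apply: (loc_lengthE idJ pQ Qx (@root_prime_gen al) Qc Jc).
move=> g m Qg /Jsub[n1 [bn1 kn1]].
have pa := ring_ker_prime (ev_at al); have [ida _ aM] := pa.
have [n2 [bx ex]] := evalsX m (init_evals pqrs det1 ('X%:P - al%:P%:P)).
have [n3 bg] := bounded_below_exists g.
have bgx : bounded_below (n3 + n2) (laurent0_val (g * uniformizer al ^+ m)).
  by rewrite laurent0_valM; apply: bounded_belowM.
have [k ek] := pullbackS (principal_ideal_ideal _) bn1 kn1 (leq_addr (n3 + n2) n1).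
rewrite leqNgt; apply/negP => mN; apply: Qg.
have asplit : ((\prod_j coord j) ^+ n1 * (clr n3 g * (\prod_j coord j) ^+ n2)) =
    k * h1%:P * ('X%:P - al%:P%:P) ^+ (count_mem al rs - m).
  apply: (@mulIf _ (('X%:P - al%:P%:P) ^+ m)).
    by apply: expf_neq0; rewrite -polyCB polyC_eq0 polyXsubC_eq0.
  rewrite [RHS]/= -[RHS]mulrA -exprD (subnK (ltnW mN)).
  transitivity (k * h%:P); last first.
    by rewrite [in LHS]eh polyCM polyC_exp polyCB [_ ^+ _ * _]mulrC mulrA.
  rewrite -ek clrS // laurent0_valM clrM // ex -!mulrA; congr (_ * _).
exists n3; split=> //.
have : ring_ker (ev_at al) ((\prod_j coord j) ^+ n1 * (clr n3 g * (\prod_j coord j) ^+ n2)).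
  rewrite asplit; apply: (idealMl ida); rewrite -(subnSK mN) exprS.
  by apply: (idealMr ida); exact: ev_atB.
have ncoord m' : ~ ring_ker (ev_at al) ((\prod_j coord j) ^+ m').
  by move=> /(prime_exp pa)/(prime_prod pa)[j _]; exact: good_coord.
by move=> /aM[/ncoord//|/aM[//|/ncoord]].
Qed.

Lemma trop_sum : (\esum_(Q in minimal_primes J) loc_length R J Q)%E =
  ((count good_root rs)%:R)%:E.
Proof.
have ur : uniq [seq z <- undup rs | good_root z] by rewrite filter_uniq ?undup_uniq.
rewrite (esum_primes (N := fun al => count_mem al rs) ur minimal_primesE) //.
- congr (_%:R%:E); rewrite big_filter -sum1_count.
  transitivity (\sum_(z <- undup rs | good_root z) iterop (count_mem z rs) addn 1%N 0%N)%N.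
    by apply: eq_bigr => z _; elim: (count_mem z rs) => // -[//|n] /= <-.
  exact: (big_undup_iterop_count addn).
- move=> al be; rewrite !mem_filter => /andP[gal _] /andP[gbe _] e.
  by apply: (root_prime_inj gal gbe); rewrite e.
- by move=> al; rewrite mem_filter mem_undup -root_mem => /andP[gal hal]; apply: loc_length_root.
Qed.

End Roots.
End PrimeDecomposition.

Section TropicalMultiplicity.
Variables (K : fieldType) (R : realType) (p q r s : 'I_4).
Hypothesis closedK : splits K.
Hypothesis pqrs : uniq [:: p; q; r; s].
Variables (a b c d : nat).
Hypothesis det1 : (a * d = b * c + 1)%N.

Lemma trop_multE (P : set (laurent0 K 4)) f m h rs :
  is_ideal P -> @L0 K `<=` P -> chart_eq p q r s P f ->
  lowest_coef (deg_map K a b c d f) m h -> h != 0 ->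
  h = lead_coef h *: \prod_(z <- rs) ('X - z%:P) ->
  trop_mult P (weight R p q a b) = ((count (good_root b) rs)%:R)%:E.
Proof.
move=> idP LP Pf lowf h0 hrs.
rewrite /trop_mult.
have idJ : is_ideal (initial_ideal (weight R p q a b) P) by exact: ideal_gen_ideal.
apply: (trop_sum closedK pqrs det1 idJ _ _ _ h0 hrs).
- exact: (initial_ideal_low pqrs det1 Pf lowf h0).
- exact: (initial_ideal_coord pqrs det1 LP).
- exact: (initial_ideal_sub pqrs det1 Pf lowf h0).
Qed.

End TropicalMultiplicity.

(** * Newton polygons *)

Section Support.
Variable K : fieldType.
Implicit Types (f : {poly {poly K}}) (i j D : nat).

Definition bounded D f := forall i j, f`_i`_j != 0 -> (i < D)%N /\ (j < D)%N.

Lemma bounded_exists f : exists D, bounded D f.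
Proof.
exists (size f + \max_(i < size f) size (f`_i)%R)%N => i j fij.
have isz : (i < size f)%N.
  by rewrite ltnNge; apply: contra_neqN fij => /(nth_default 0) ->; rewrite coef0.
have jsz : (j < size (f`_i)%R)%N.
  by rewrite ltnNge; apply: contra_neqN fij => /(nth_default 0) ->.
split; first exact: leq_trans isz (leq_addr _ _).
apply: (leq_trans jsz); apply: leq_trans (leq_addl _ _).
exact: (@leq_bigmax _ (fun i : 'I_(size f) => size (f`_i)%R) (Ordinal isz)).
Qed.

Lemma ev2_sum D f (B : comNzRingType) (iota : {rmorphism K -> B}) x y : bounded D f ->
  ev2 iota x y f = \sum_(i < D) \sum_(j < D) iota f`_i`_j * (x ^+ i * y ^+ j).
Proof.
move=> bf; have szf : (size f <= D)%N.
  apply/leq_sizeP => i Di; apply/polyP => j; rewrite coef0; apply/eqP.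
  by apply: contraLR Di => /bf[iD _]; rewrite -ltnNge.
have szi i : (size (f`_i)%R <= D)%N.
  apply/leq_sizeP => j Dj; apply/eqP.
  by apply: contraLR Dj => /bf[_ jD]; rewrite -ltnNge.
rewrite ev2.unlock (ev1_sum _ _ szf); apply: eq_bigr => i _.
rewrite (ev1_sum _ _ (szi i)) mulr_suml; apply: eq_bigr => j _.
by rewrite -mulrA [y ^+ j * _]mulrC.
Qed.
End Support.

Section NewtonFace.
Variables (K : fieldType) (a b c d : nat).
Hypothesis det1 : (a * d = b * c + 1)%N.
Variable f : {poly {poly K}}.
Local Notation F := (deg_map K a b c d f).

Let det_inj i j i' j' : (a * i + b * j = a * i' + b * j')%N ->
  (c * i + d * j = c * i' + d * j')%N -> i = i' /\ j = j'.
Proof. by nia. Qed.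

Lemma deg_map_coefE M e D : bounded D f ->
  F`_M`_e = \sum_(i < D) \sum_(j < D) f`_i`_j *+ ((M == a * i + b * j)%N && (e == c * i + d * j)%N).
Proof.
move=> bf; rewrite /deg_map (ev2_sum _ _ _ bf) !coef_sum; apply: eq_bigr => i _.
rewrite !coef_sum; apply: eq_bigr => j _.
have -> : monX K a c ^+ i * monY K b d ^+ j = ('X^(c * i + d * j))%:P * 'X^(a * i + b * j) :> {poly {poly K}}.
  by rewrite /monX /monY !exprMn -!exprM mulrACA -!exprD -polyC_exp mulrC.
rewrite mulrA -polyCM coefCM coefXn.
have [_|_] := eqVneq M; last by rewrite mulr0 coef0 mulr0n.
rewrite mulr1 coefCM coefXn.
by have [_|_] := eqVneq e; rewrite ?mulr1 ?mulr0.
Qed.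

Lemma deg_map_coef i j : F`_(a * i + b * j)`_(c * i + d * j) = f`_i`_j.
Proof.
have [D0 bf0] := bounded_exists f; pose D := (D0 + (i + j).+1)%N.
have bf : bounded D f by move=> i' j' /bf0 []; rewrite /D; lia.
have iD : (i < D)%N by rewrite /D; lia.
have jD : (j < D)%N by rewrite /D; lia.
rewrite (deg_map_coefE _ _ bf) (bigD1 (Ordinal iD)) //= (bigD1 (Ordinal jD)) //= !eqxx /=.
rewrite mulr1n [X in _ + X + _]big1 ?addr0 => [|j' jj']; last first.
  case: eqP => //= e1; case: eqP => //= e2; case/eqP: jj'; apply: val_inj => /=.
  by have [] := det_inj e1 e2.
rewrite big1 ?addr0 // => i' ii'; apply: big1 => j' _.
case: eqP => //= e1; case: eqP => //= e2; case/eqP: ii'; apply: val_inj => /=.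
by have [] := det_inj e1 e2.
Qed.

Lemma deg_map_coef_neq0 M e : F`_M`_e != 0 -> exists i j,
  [/\ f`_i`_j != 0, M = (a * i + b * j)%N & e = (c * i + d * j)%N].
Proof.
have [D bf] := bounded_exists f; rewrite (deg_map_coefE _ _ bf) => h.
apply: contrapT => no; case/eqP: h; apply: big1 => i _; apply: big1 => j _.
have [e1|] := eqVneq M; have [e2|] := eqVneq e => //=; rewrite ?mulr0n ?andbF //.
by apply/eqP; apply: contrapT => /negP fij; apply: no; exists i, j.
Qed.

(** The lowest coefficient in [T] collects the terms of [f] on the face where [a i + b j] is
    minimal. By unimodularity distinct terms keep distinct exponents [c i + d j], so none cancel. *)
Lemma deg_map_lowc : f != 0 -> exists m h, [/\ h != 0, lowest_coef F m h,
  forall i j, f`_i`_j != 0 -> (m <= a * i + b * j)%N,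
  forall i j, f`_i`_j != 0 -> (a * i + b * j = m)%N -> h`_(c * i + d * j) != 0 &
  forall e, h`_e != 0 -> exists i j,
    [/\ f`_i`_j != 0, m = (a * i + b * j)%N & e = (c * i + d * j)%N]].
Proof.
move=> f0; have F0 : F != 0.
  have li : lead_coef (lead_coef f) != 0 by rewrite !lead_coef_eq0.
  apply: contra_neq li => F0; rewrite !lead_coefE -deg_map_coef F0.
  by rewrite !coef0.
have [m [h [h0 lF]]] := lowest_coef_exists F0; exists m, h; split=> //.
- move=> i j fij; rewrite leqNgt; apply/negP => lt_m.
  have [_ /(_ _ lt_m) e] := lowest_coef_coef lF; move: fij.
  by rewrite -deg_map_coef e coef0 eqxx.
- by move=> i j fij em; have [<- _] := lowest_coef_coef lF; rewrite -em deg_map_coef.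
- by move=> e he; apply: deg_map_coef_neq0; have [-> _] := lowest_coef_coef lF.
Qed.

End NewtonFace.

(** With [e] the multiplicity of the root 0, the number of non-zero roots is the difference between
    the highest and lowest exponents of [h]: the lattice length of a face. *)
Lemma root_span (K : fieldType) (h : {poly K}) rs : h != 0 ->
  h = lead_coef h *: \prod_(z <- rs) ('X - z%:P) ->
  exists e, [/\ h`_e != 0, h`_(e + count (predC1 0%R) rs) != 0 &
    forall e', h`_e' != 0 -> (e <= e' <= e + count (predC1 0%R) rs)%N].
Proof.
move=> h0 hrs; have szrs : size h = (size rs).+1.
  by rewrite hrs size_scale ?lead_coef_eq0 // size_prod_XsubC.
have [h1 h10 eh] := root_factor h0 hrs 0.
rewrite subr0 in eh; set e := count_mem 0 rs in eh; exists e.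
have ecnt : (e + count (predC1 0%R) rs)%N = size rs by rewrite -(count_predC (pred1 0) rs).
rewrite ecnt; split.
- by rewrite eh coefXnM ltnn subnn -horner_coef0.
- by rewrite -[size rs]/(size rs).+1.-1 -szrs -lead_coefE lead_coef_eq0.
- move=> e' he'; apply/andP; split.
    by rewrite leqNgt; apply: contraTN he' => lt; rewrite eh coefXnM lt eqxx.
  rewrite -ltnS -szrs ltnNge; apply: contraTN he' => /(nth_default 0) ->.
  by rewrite eqxx.
Qed.

Lemma sum_between n t1 t2 : (t2 <= t1)%N -> (t1 <= n)%N ->
  (\sum_(q < n) (t2 <= q < t1)%N)%N = (t1 - t2)%N.
Proof.
move=> t21 t1n; transitivity (minn n t1 - minn n t2)%N; last by lia.
elim: n {t1n} => [|n IH]; first by rewrite big_ord0; lia.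
rewrite big_ord_recr /= IH.
by case: (leqP t2 n) => h1; case: (leqP t1 n) => h2 /=; lia.
Qed.

Lemma coprime_ratio a b a' b' : coprime a b -> coprime a' b' ->
  (0 < a)%N -> (0 < a')%N -> (a' * b = a * b')%N -> (a = a' /\ b = b')%N.
Proof.
move=> ab ab' a0 a'0 e; have h1 : (a %| a')%N.
  by rewrite -(Gauss_dvdl _ ab) e dvdn_mulr.
have h2 : (a' %| a)%N by rewrite -(Gauss_dvdl _ ab') -e dvdn_mulr.
have ea : a = a' by apply/eqP; rewrite eqn_dvd h1.
by split=> //; apply/eqP; rewrite -(eqn_pmul2l a'0) e ea.
Qed.

(** A normal with larger ratio [b/a] weighs the height more, so its face lies lower. The first
    coordinates are eliminated between the two minimality inequalities. *)
Lemma edge_order a b a' b' p t p' t' : (a * p + b * t <= a * p' + b * t')%N ->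
  (a' * p' + b' * t' <= a' * p + b' * t)%N -> (a' * b > a * b')%N -> (t <= t')%N.
Proof.
move=> h1 h2 h3; rewrite leqNgt; apply/negP => h4.
have h5 : (a * a' * p' + a * b' * t' <= a * a' * p + a * b' * t)%N by nia.
have h6 : (a * a' * p + a' * b * t <= a * a' * p' + a' * b * t')%N by nia.
have : (a' * b * t + a * b' * t' <= a' * b * t' + a * b' * t)%N by lia.
nia.
Qed.

(** * The left boundary of a Newton polygon, height by height *)

Section Crossing.
Variables (S : nat -> nat -> bool) (D n : nat).
Hypothesis bS : forall i j, S i j -> (i < D)%N /\ (j < D)%N.
Hypotheses (Sn : S 0 n) (minn : forall j, S 0 j -> (n <= j)%N).
(** The sum multiplied by [zj - vj] in the hypothesis, divided by [uj - vj], is twice the abscissa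
    at which the segment [vu] meets the height [q + 1/2]. If replacing [u] by [z] does not move this
    point to the left, then [z] is not to the left of the line through [u] and [v]. *)
Let arith_up (ui uj vi vj zi zj q : nat) : (vj <= q)%N -> (q < uj)%N -> (q < zj)%N ->
  ((ui * (2 * q + 1 - 2 * vj) + vi * (2 * uj - (2 * q + 1))) * (zj - vj) <=
   (zi * (2 * q + 1 - 2 * vj) + vi * (2 * zj - (2 * q + 1))) * (uj - vj))%N ->
  (uj%:Z - vj%:Z) * vi%:Z + (vi%:Z - ui%:Z) * vj%:Z <=
  (uj%:Z - vj%:Z) * zi%:Z + (vi%:Z - ui%:Z) * zj%:Z.
Proof.
move=> h1 h2 h3.
have [x ex] : exists x, q = (vj + x)%N by exists (q - vj)%N; lia.
have [y ey] : exists y, uj = (q + y.+1)%N by exists (uj - q.+1)%N; lia.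
have [t et] : exists t, zj = (q + t.+1)%N by exists (zj - q.+1)%N; lia.
subst uj zj q.
have -> : (2 * (vj + x) + 1 - 2 * vj = 2 * x + 1)%N by lia.
have -> : (2 * (vj + x + y.+1) - (2 * (vj + x) + 1) = 2 * y + 1)%N by lia.
have -> : (2 * (vj + x + t.+1) - (2 * (vj + x) + 1) = 2 * t + 1)%N by lia.
have -> : (vj + x + t.+1 - vj = x + t + 1)%N by lia.
have -> : (vj + x + y.+1 - vj = x + y + 1)%N by lia.
move=> h; have : (ui * (x + t + 1) + vi * (x + y + 1) <= zi * (x + y + 1) + vi * (x + t + 1))%N.
  rewrite -(leq_pmul2l (m := 2 * x + 1)) ?addn1 //; nia.
nia.
Qed.

Let arith_down (ui uj vi vj zi zj q : nat) : (vj <= q)%N -> (q < uj)%N -> (zj <= q)%N ->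
  ((ui * (2 * q + 1 - 2 * vj) + vi * (2 * uj - (2 * q + 1))) * (uj - zj) <=
   (ui * (2 * q + 1 - 2 * zj) + zi * (2 * uj - (2 * q + 1))) * (uj - vj))%N ->
  (uj%:Z - vj%:Z) * vi%:Z + (vi%:Z - ui%:Z) * vj%:Z <=
  (uj%:Z - vj%:Z) * zi%:Z + (vi%:Z - ui%:Z) * zj%:Z.
Proof.
move=> h1 h2 h3.
have [x ex] : exists x, q = (vj + x)%N by exists (q - vj)%N; lia.
have [y ey] : exists y, uj = (q + y.+1)%N by exists (uj - q.+1)%N; lia.
have [t et] : exists t, q = (zj + t)%N by exists (q - zj)%N; lia.
have -> : (2 * q + 1 - 2 * vj = 2 * x + 1)%N by lia.
have -> : (2 * q + 1 - 2 * zj = 2 * t + 1)%N by lia.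
have -> : (2 * uj - (2 * q + 1) = 2 * y + 1)%N by lia.
have -> : (uj - zj = y + t + 1)%N by lia.
have -> : (uj - vj = x + y + 1)%N by lia.
move=> h; have : (vi * (y + t + 1) + ui * (x + y + 1) <= zi * (x + y + 1) + ui * (y + t + 1))%N.
  rewrite -(leq_pmul2l (m := 2 * y + 1)) ?addn1 //; nia.
have -> : vj%:Z = q%:Z - x%:Z by lia.
have -> : zj%:Z = q%:Z - t%:Z by lia.
have -> : uj%:Z = q%:Z + y%:Z + 1 by lia.
nia.
Qed.

(* Among the segments joining a point of S at height at most q to a higher one,
   the one meeting the line of height q + 1/2 furthest to the left is an edge. *)
Lemma crossing q : (q < n)%N -> (exists i j, S i j /\ (j <= q)%N) -> exists a b ui uj vi vj,
  [/\ coprime a b, (0 < a)%N & (0 < b)%N] /\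
  [/\ S ui uj, S vi vj, (vj <= q < uj)%N, (a * ui + b * uj = a * vi + b * vj)%N &
      forall i j, S i j -> (a * vi + b * vj <= a * i + b * j)%N].
Proof.
move=> qn [i0 [j0 [Si0 j0q]]].
have [n0D nD] := bS Sn; have [i0D D0] := bS Si0.
pose T : finType := (('I_D * 'I_D) * ('I_D * 'I_D))%type.
pose Q (x : T) := [&& S x.1.1 x.1.2, S x.2.1 x.2.2 & (x.2.2 <= q < x.1.2)%N].
pose num (x : T) := (x.1.1 * (2 * q + 1 - 2 * x.2.2) + x.2.1 * (2 * x.1.2 - (2 * q + 1)))%N.
pose F (x : T) : rat := (num x)%:R / (x.1.2 - x.2.2)%N%:R.
pose x0 : T := ((Ordinal n0D, Ordinal nD), (Ordinal i0D, Ordinal D0)).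
have Qx0 : Q x0 by rewrite /Q /= Sn Si0 qn j0q.
have leF (x y : T) : Q x -> Q y -> F x <= F y ->
    (num x * (y.1.2 - y.2.2) <= num y * (x.1.2 - x.2.2))%N.
  move=> /and3P[_ _ /andP[x1 x2]] /and3P[_ _ /andP[y1 y2]].
  rewrite /F ler_pdivrMr ?ltr0n ?subn_gt0 ?(leq_ltn_trans x1) //.
  rewrite mulrAC ler_pdivlMr ?ltr0n ?subn_gt0 ?(leq_ltn_trans y1) //.
  by rewrite -!natrM ler_nat.
case: (@Order.TotalTheory.arg_minP _ _ T x0 Q F Qx0) => -[[ui uj] [vi vj]] Qx minx.
have [/= Su Sv /andP[vq qu]] := and3P Qx.
have supp i j : S i j -> (uj%:Z - vj%:Z) * vi%:Z + (vi%:Z - ui%:Z) * vj%:Z <=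
    (uj%:Z - vj%:Z) * i%:Z + (vi%:Z - ui%:Z) * j%:Z.
  move=> Sij; have [iD jD] := bS Sij; have [jq|qj] := leqP j q.
    pose y : T := ((ui, uj), (Ordinal iD, Ordinal jD)).
    have Qy : Q y by rewrite /Q /= Su Sij jq.
    exact: (arith_down vq qu jq (leF _ _ Qx Qy (minx _ Qy))).
  pose y : T := ((Ordinal iD, Ordinal jD), (vi, vj)).
  have Qy : Q y by rewrite /Q /= Sv Sij vq.
  exact: (arith_up vq qu qj (leF _ _ Qx Qy (minx _ Qy))).
move: (ui : nat) (uj : nat) (vi : nat) (vj : nat) Su Sv vq qu supp => {Qx minx} {}ui {}uj {}vi {}vj Su Sv vq qu supp.
(* This makes the second entry of the normal positive. Otherwise [(0, n)], which is not to the left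
   of the line, forces [vi = 0]; but then [vj <= q < n] contradicts the minimality of [n] on the
   axis. *)
have uv : (ui < vi)%N.
  rewrite ltnNge; apply/negP => le.
  have := supp _ _ Sn; have [vi0|vi0] := posnP vi; last by nia.
  by have := minn (eq_ind vi (fun i => S i vj) Sv _ vi0); nia.
pose g := gcdn (uj - vj) (vi - ui).
have g0 : (0 < g)%N by rewrite gcdn_gt0 subn_gt0 (leq_ltn_trans vq qu).
exists ((uj - vj) %/ g)%N, ((vi - ui) %/ g)%N, ui, uj, vi, vj.
have ea : ((uj - vj) %/ g * g = uj - vj)%N by rewrite divnK ?dvdn_gcdl.
have eb : ((vi - ui) %/ g * g = vi - ui)%N by rewrite divnK ?dvdn_gcdr.
have cab : (gcdn ((uj - vj) %/ g) ((vi - ui) %/ g) * g)%N = g by rewrite muln_gcdl ea eb.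
move: ((uj - vj) %/ g)%N ((vi - ui) %/ g)%N ea eb cab => a b ea eb cab.
have a0 : (0 < a)%N by rewrite lt0n; apply/eqP => a00; move: ea; rewrite a00 mul0n; lia.
have b0 : (0 < b)%N by rewrite lt0n; apply/eqP => b00; move: eb; rewrite b00 mul0n; lia.
split; first split=> //.
  by rewrite /coprime -(eqn_pmul2r g0) mul1n cab.
have ea' : uj%:Z - vj%:Z = a%:Z * g%:Z by lia.
have eb' : vi%:Z - ui%:Z = b%:Z * g%:Z by lia.
split=> //; first by rewrite vq qu.
  apply/eqP; rewrite -(eqn_pmul2r g0); apply/eqP; nia.
move=> i j /supp; rewrite ea' eb' => h.
by rewrite -(leq_pmul2r g0); nia.
Qed.

Hypothesis S0 : exists i, S i 0.
Variable N : nat -> nat -> nat.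
Hypothesis face : forall a b, coprime a b -> (0 < a)%N -> (0 < b)%N -> exists m t1 t2,
  [/\ forall i j, S i j -> (m <= a * i + b * j)%N,
      exists2 i, S i t1 & (a * i + b * t1 = m)%N,
      exists2 i, S i t2 & (a * i + b * t2 = m)%N,
      forall i j, S i j -> (a * i + b * j = m)%N -> (t2 <= j <= t1)%N &
      t1 = (t2 + a * N a b)%N].
Variable W : seq (nat * nat).
Hypothesis uW : uniq W.
Hypothesis cW : forall w, w \in W -> [/\ coprime w.1 w.2, (0 < w.1)%N & (0 < w.2)%N].
Hypothesis NW : forall a b, coprime a b -> (0 < a)%N -> (0 < b)%N ->
  N a b != 0%N -> (a, b) \in W.

(** Double counting: the face with normal [w] crosses [w.1 * N w.1 w.2] of the heights [q + 1/2]
    with [q < n], and each such height is crossed by exactly one face, which [crossing] provides. *)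
Lemma newton_height : (\sum_(w <- W) w.1 * N w.1 w.2 = n)%N.
Proof.
have /choice[t tP] : forall w : nat * nat, exists t : nat * nat * nat,
    [/\ coprime w.1 w.2, (0 < w.1)%N & (0 < w.2)%N] ->
  [/\ forall i j, S i j -> (t.1.1 <= w.1 * i + w.2 * j)%N,
      exists2 i, S i t.1.2 & (w.1 * i + w.2 * t.1.2 = t.1.1)%N,
      exists2 i, S i t.2 & (w.1 * i + w.2 * t.2 = t.1.1)%N,
      forall i j, S i j -> (w.1 * i + w.2 * j = t.1.1)%N -> (t.2 <= j <= t.1.2)%N &
      t.1.2 = (t.2 + w.1 * N w.1 w.2)%N].
  move=> w; have [[cw a0 b0]|nw] := pselect [/\ coprime w.1 w.2, (0 < w.1)%N & (0 < w.2)%N].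
    by have [m [t1 [t2 h]]] := face cw a0 b0; exists (m, t1, t2).
  by exists (0, 0, 0)%N.
pose top w := (t w).1.2; pose bot w := (t w).2.
have topn w : w \in W -> (bot w <= top w <= n)%N.
  move=> /cW hw; have [_ a0 b0] := hw; have [mn [i1 Si1 e1] _ _ et] := tP _ hw.
  rewrite /top /bot; apply/andP; split; first by rewrite et leq_addr.
  have h := mn _ _ Sn; rewrite -e1 muln0 add0n in h.
  by rewrite -(leq_pmul2l b0); apply: leq_trans (leq_addl _ _) h.
transitivity (\sum_(w <- W) \sum_(q < n) (bot w <= q < top w)%N)%N.
  rewrite big_seq [RHS]big_seq; apply: eq_bigr => w wW.
  have /andP[h1 h2] := topn _ wW; rewrite sum_between //.
  by have [_ _ _ _] := tP _ (cW wW); rewrite /top /bot => ->; rewrite addKn.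
have [i0 Si0] := S0; rewrite exchange_big /= -[RHS]card_ord -sum1_card; apply: eq_bigr => q _.
have [a [b [ui [uj [vi [vj [[cab a0 b0] [Su Sv /andP[vq qu] euv mn]]]]]]]] :=
  crossing (ltn_ord q) (ex_intro _ i0 (ex_intro _ 0%N (conj Si0 (leq0n q)))).
have hab : [/\ coprime (a, b).1 (a, b).2, (0 < (a, b).1)%N & (0 < (a, b).2)%N] by [].
have [mn' [i1 Si1 e1] [i2 Si2 e2] bt et] := tP _ hab.
have em : (t (a, b)).1.1 = (a * vi + b * vj)%N.
  by apply/eqP; rewrite eqn_leq (mn' _ _ Sv) /= -e1; exact: mn.
have Pab : (bot (a, b) <= q < top (a, b))%N.
  have /andP[h1 h2] := bt _ _ Su (etrans euv (esym em)).
  have /andP[h3 h4] := bt _ _ Sv (esym em).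
  by rewrite /bot /top; lia.
have abW : (a, b) \in W.
  apply: NW => //; apply/eqP => N0; move: Pab; rewrite /bot /top et /= N0; lia.
(* Uniqueness: faces with different normals cover disjoint ranges of heights by [edge_order]. *)
rewrite (eq_big_seq (fun w => (w == (a, b)) : nat)); last first.
  move=> [a' b'] wW /=; have [-> |ne] := eqVneq; first by rewrite Pab.
  have hab' := cW wW; have [/= cab' a'0 b'0] := hab'.
  have [/= mn2 [j1 Sj1 f1] [j2 Sj2 f2] bt2 et2] := tP _ hab'.
  apply/eqP; rewrite eqb0; apply/negP => P'.
  case/negP: ne; have [lt|gt|e] := ltngtP (a' * b) (a * b').
  - have le1 : ((t (a', b')).1.2 <= (t (a, b)).2)%N.
      apply: (@edge_order a' b' a b j1 _ i2 _ _ _ lt); first by rewrite f1; apply: mn2.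
      by rewrite e2; apply: mn'.
    have [/andP[p1 _] /andP[_ p2]] := (Pab, P').
    by have := leq_trans p2 (leq_trans le1 p1); rewrite ltnn.
  - have le1 : ((t (a, b)).1.2 <= (t (a', b')).2)%N.
      apply: (@edge_order a b a' b' i1 _ j2 _ _ _ gt); first by rewrite e1; apply: mn'.
      by rewrite f2; apply: mn2.
    have [/andP[_ p2] /andP[p1 _]] := (Pab, P').
    by have := leq_trans p2 (leq_trans le1 p1); rewrite ltnn.
  - by have [<- <-] := coprime_ratio cab cab' a0 a'0 e; exact: eqxx.
transitivity (count_mem (a, b) W); last by rewrite count_uniq_mem // abW.
by rewrite -sum1_count [RHS]big_mkcond; apply: eq_bigr => w _ /=; case: (_ == _).
Qed.

End Crossing.

(** * Newton polygon and tropical multiplicities of a curve *)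

Section CurveInChart.
Variables (K : fieldType) (R : realType) (p q r s : 'I_4).
Hypothesis closedK : splits K.
Hypothesis pqrs : uniq [:: p; q; r; s].
Variables (P : set (laurent0 K 4)) (f : {poly {poly K}}).
Hypotheses (idP : is_ideal P) (LP : @L0 K `<=` P) (Pf : chart_eq p q r s P f).
Local Notation w := (weight R p q).

Lemma unimodular_exists a b : coprime a b -> (0 < a)%N -> exists c d, (a * d = b * c + 1)%N.
Proof.
move=> cab a0; case: (egcdnP b a0) => km kn e _; exists kn, km.
by rewrite mulnC e (eqP cab) [(b * _)%N]mulnC.
Qed.

(** On the face [a i + b j = m], the exponent [e = c i + d j] of [U] satisfies [a e = j + c m].
    Hence one unit of lattice length raises the height by [a], and [N] non-zero roots account for a
    height of [a N]. *)
Lemma trop_face : f != 0 -> forall a b, coprime a b -> (0 < a)%N -> (0 < b)%N ->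
  exists N, trop_mult P (w a b) = (N%:R)%:E /\ exists m t1 t2,
  [/\ forall i j, f`_i`_j != 0 -> (m <= a * i + b * j)%N,
      exists2 i, f`_i`_t1 != 0 & (a * i + b * t1 = m)%N,
      exists2 i, f`_i`_t2 != 0 & (a * i + b * t2 = m)%N,
      forall i j, f`_i`_j != 0 -> (a * i + b * j = m)%N -> (t2 <= j <= t1)%N &
      t1 = (t2 + a * N)%N].
Proof.
move=> f0 a b cab a0 b0; have [c [d det1]] := unimodular_exists cab a0.
have [m [h [h0 lF mn face1 face2]]] := deg_map_lowc det1 f0.
have [rs hrs] := closedK h; exists (count (predC1 0) rs); split.
  rewrite (trop_multE R closedK pqrs det1 idP LP Pf lF h0 hrs); congr (_%:R%:E).
  by apply: eq_count => z; rewrite /good_root /= -lt0n b0 orTb andbT.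
have [e [he heN span]] := root_span h0 hrs.
have [i2 [j2 [f2 m2 e2]]] := face2 _ he.
have [i1 [j1 [f1 m1 e1]]] := face2 _ heN.
have je i j e' : m = (a * i + b * j)%N -> e' = (c * i + d * j)%N -> (a * e' = j + c * m)%N.
  by move=> -> ->; nia.
exists m, j1, j2; split=> //; [by exists i1|by exists i2| |].
  move=> i j fij em; have := span _ (face1 _ _ fij em).
  have := je _ _ _ (esym em) erefl; have := je _ _ _ m1 e1; have := je _ _ _ m2 e2.
  move: (c * i + d * j)%N (c * m)%N => e' cm E2 E1 E' /andP[l1 l2].
  rewrite -(leq_add2r cm) -E2 -E' leq_mul2l l1 orbT /=.
  by rewrite -(leq_add2r cm) -E' -E1 leq_mul2l l2 orbT.
have := je _ _ _ m1 e1; have := je _ _ _ m2 e2; rewrite mulnDr; lia.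
Qed.

Variable n : nat.
Hypotheses (fn : f`_0`_n != 0) (f_lt_n : forall j, (j < n)%N -> f`_0`_j = 0).

Let f0 : f != 0. Proof. by apply: contraNneq fn => ->; rewrite !coef0. Qed.
Let fmin j : f`_0`_j != 0 -> (n <= j)%N.
Proof. by move=> fj; rewrite leqNgt; apply: contraNN fj => /f_lt_n ->. Qed.

(** The edge crossing the height [n - 1/2] has points at two different heights, so its multiplicity
    is not 0; its upper end, of height at least [n], gives the last inequality. *)
Lemma first_edge i j : f`_i`_j != 0 -> (j < n)%N -> exists a b,
  [/\ coprime a b, (0 < a)%N, (0 < b)%N, trop_mult P (w a b) != 0%E &
   (b * n <= a * i + b * j)%N].
Proof.
move=> fij jn; have [D bf] := bounded_exists f.
have n1 : (n.-1 < n)%N by lia.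
have ex : exists i j, f`_i`_j != 0 /\ (j <= n.-1)%N by exists i, j; split=> //; lia.
have [a [b [ui [uj [vi [vj [[cab a0 b0] [fu fv uv e mn]]]]]]]] :=
  crossing (S := fun i j => f`_i`_j != 0) bf fn fmin n1 ex.
exists a, b; split=> //; last first.
  apply: leq_trans (mn _ _ fij); rewrite -e.
  have uj1 : (n <= uj)%N by lia.
  by apply: leq_trans (leq_addl _ _); rewrite leq_mul2l uj1 orbT.
have [N [-> [m [t1 [t2 [mn2 [i1 fi1 ei1] _ bt et]]]]]] := trop_face f0 cab a0 b0.
apply/eqP => -[] /eqP; rewrite pnatr_eq0 => /eqP N0; rewrite N0 muln0 addn0 in et.
have em : (a * vi + b * vj = m)%N.
  by apply/eqP; rewrite eqn_leq mn2 // andbT -ei1 mn.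
have /andP[_ ut] := bt _ _ fu (etrans e em).
have /andP[tv _] := bt _ _ fv em.
by case/andP: uv => h1 h2; have := leq_trans (leq_trans h2 ut); rewrite et => /(_ _ (leq_trans tv h1)); rewrite ltnn.
Qed.

(* A term on or below the diagonal through (0, n) would force an edge with inner
   normal (a, b), b <= a. *)
Lemma tangency : (forall a b, coprime a b -> (0 < a)%N -> (0 < b)%N -> (b <= a)%N ->
    trop_mult P (w a b) = 0%E) ->
  forall i j, (0 < i)%N -> (i + j <= n)%N -> f`_i`_j = 0.
Proof.
move=> trop0 i j i0 ijn; apply/eqP; apply: contraT => fij.
have [|a [b [cab a0 b0 tn0 le]]] := first_edge fij; first by lia.
case/eqP: tn0; apply: trop0 => //.
have h : (b * i <= b * (n - j))%N by rewrite leq_mul2l; apply/orP; right; lia.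
have h2 : (b * (n - j) <= a * i)%N by rewrite mulnBr leq_subLR addnC.
by rewrite -(leq_pmul2r i0); apply: leq_trans h h2.
Qed.

Lemma no_vanishing : (forall a b, coprime a b -> (0 < a)%N -> (0 < b)%N ->
    trop_mult P (w a b) = 0%E) ->
  (exists i, f`_i`_0 != 0) -> n = 0%N.
Proof.
move=> trop0 [i fi0]; apply/eqP; rewrite -leqn0 leqNgt; apply/negP => n0.
have [a [b [cab a0 b0 /eqP[]]]] := first_edge fi0 n0.
exact: trop0.
Qed.

Lemma trop_height (W : seq (nat * nat)) (N : nat * nat -> nat) : uniq W ->
  (forall x, x \in W -> [/\ coprime x.1 x.2, (0 < x.1)%N & (0 < x.2)%N]) ->
  (forall a b, coprime a b -> (0 < a)%N -> (0 < b)%N -> trop_mult P (w a b) != 0%E -> (a, b) \in W) ->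
  (forall x, x \in W -> trop_mult P (w x.1 x.2) = ((N x)%:R)%:E) ->
  (exists i, f`_i`_0 != 0) -> (\sum_(x <- W) x.1 * N x)%N = n.
Proof.
move=> uW cW tW NW ex0; have [D bf] := bounded_exists f.
have /choice[N' N'P] : forall x : nat * nat, exists N',
    coprime x.1 x.2 -> (0 < x.1)%N -> (0 < x.2)%N -> trop_mult P (w x.1 x.2) = (N'%:R)%:E /\ exists m t1 t2,
  [/\ forall i j, f`_i`_j != 0 -> (m <= x.1 * i + x.2 * j)%N,
      exists2 i, f`_i`_t1 != 0 & (x.1 * i + x.2 * t1 = m)%N,
      exists2 i, f`_i`_t2 != 0 & (x.1 * i + x.2 * t2 = m)%N,
      forall i j, f`_i`_j != 0 -> (x.1 * i + x.2 * j = m)%N -> (t2 <= j <= t1)%N &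
      t1 = (t2 + x.1 * N')%N].
  move=> [a b] /=; have [[c1 c2 c3]|nc] := pselect [/\ coprime a b, (0 < a)%N & (0 < b)%N].
    by have [N' h] := trop_face f0 c1 c2 c3; exists N'.
  by exists 0%N => c1 c2 c3; case: nc.
transitivity (\sum_(x <- W) x.1 * N' (x.1, x.2))%N.
  apply: eq_big_seq => x xW /=; have [c1 c2 c3] := cW _ xW; congr (_ * _)%N.
  have [] := N'P x c1 c2 c3; rewrite NW // => -[] /eqP; rewrite eqr_nat => /eqP -> _.
  by case: (x).
apply: (newton_height (S := fun i j => f`_i`_j != 0) bf fn fmin ex0
  (N := fun a b => N' (a, b)) _ uW cW).
  by move=> a b c1 c2 c3; have [_] := N'P (a, b) c1 c2 c3.
move=> a b c1 c2 c3 N0; apply: tW => //; have [-> _] := N'P (a, b) c1 c2 c3.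
by apply: contraNneq N0 => -[] /eqP; rewrite pnatr_eq0.
Qed.

Lemma deg_map_id : deg_map K 1 0 0 1 f = f.
Proof. by rewrite -[RHS]ev2_id /deg_map /monX /monY !expr1 !expr0 mulr1 mul1r. Qed.

(** For the weight [e_p] the substitution is the identity and the lowest coefficient is [f]
    restricted to [X = 0]. The multiplicity counts its roots other than 0 and -1, so only these two
    remain. *)
Lemma axis_roots : trop_mult P (w 1 0) = 0%E ->
  exists al k, f`_0 = al *: ('X^n * ('X + 1) ^+ k).
Proof.
have lF : lowest_coef (deg_map K 1 0 0 1 f) 0 f`_0.
  by rewrite deg_map_id; apply: lowest_coef_intro.
have h0 : f`_0 != 0 by apply: contraNneq fn => ->; rewrite coef0.
have [rs hrs] := closedK f`_0.
rewrite (trop_multE R closedK pqrs (a := 1) (b := 0) (c := 0) (d := 1) erefl idP LP Pf lF h0 hrs).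
move=> -[] /eqP; rewrite pnatr_eq0 -leqn0 leqNgt -has_count => /hasPn good.
have rs01 z : z \in rs -> z != 0 -> z = -1.
  by move=> /good; rewrite /good_root /= negb_and negbK => /orP[->//|]; rewrite negbK => /eqP.
have e : f`_0 = lead_coef f`_0 *: ('X^(count_mem 0 rs) * ('X + 1) ^+ count (predC1 0) rs).
  rewrite {1}hrs; congr (_ *: _); elim: (rs) rs01 => [|z zs IH] h; first by rewrite big_nil mul1r.
  rewrite big_cons IH; last by move=> x xz; apply: h; rewrite in_cons xz orbT.
  rewrite /=; have [->|z0] := eqVneq z 0; first by rewrite subr0 add0n exprS mulrA.
  by rewrite (h z) ?mem_head // polyCN opprK add0n exprS mulrCA.
have en : count_mem 0 rs = n.
  have c0 : ('X + 1 : {poly K}) ^+ count (predC1 0) rs != 0.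
    by rewrite expf_neq0 // -size_poly_gt0 size_XaddC.
  have c00 : (('X + 1 : {poly K}) ^+ count (predC1 0) rs)`_0 = 1.
    by rewrite -horner_coef0 horner_exp !hornerE expr1n.
  apply/eqP; rewrite eqn_leq; apply/andP; split.
    rewrite leqNgt; apply: contra_neqN fn => lt; rewrite e coefZ coefXnM lt mulr0 //.
  rewrite leqNgt; apply/negP => /f_lt_n; rewrite e coefZ coefXnM ltnn subnn c00 mulr1.
  by move=> /eqP; rewrite lead_coef_eq0 (negPf h0).
by exists (lead_coef f`_0), (count (predC1 0) rs); rewrite -en.
Qed.

End CurveInChart.

(** * Changes of charts *)

Section ChartTransfer.
Variables (K : fieldType) (p q r p' q' r' s : 'I_4).
Hypotheses (pqrs : uniq [:: p; q; r; s]) (pqrs' : uniq [:: p'; q'; r'; s]).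
Local Notation coord := (chart_coord K p q r).
Local Notation coord' := (chart_coord K p' q' r').

Definition change_chart : {rmorphism {poly {poly K}} -> {poly {poly K}}} :=
  ev2 (cst2 K) (coord' p) (coord' q).

Lemma coord_sum : \sum_j coord' j = 0.
Proof.
rewrite (sum_four pqrs') /chart_coord four1 (four2 pqrs') (four3 pqrs') (four4 pqrs').
by move: 'X 'X%:P => x y; ring.
Qed.

Lemma coord'4 : coord' s = 1. Proof. exact: (four4 pqrs'). Qed.

Lemma change_chart_coord j : change_chart (coord j) = coord' j.
Proof.
move: j; apply: (four_cases pqrs); rewrite {1}/chart_coord.
- by rewrite four1 [LHS]ev2X.
- by rewrite (four2 pqrs) [LHS]ev2Y.
- rewrite (four3 pqrs) [LHS]ev2N 2!ev2D ev21 ev2X ev2Y.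
  have := coord_sum; rewrite (sum_four pqrs) coord'4 => e.
  apply/eqP; rewrite eq_sym -subr_eq0 opprK; apply/eqP; rewrite -[RHS]e.
  by move: (coord' p) (coord' q) (coord' r) => x y z; ring.
- by rewrite (four4 pqrs) [LHS]ev21 coord'4.
Qed.

Lemma chart_transfer (P : set (laurent0 K 4)) f : is_ideal P -> @L0 K `<=` P ->
  chart_eq p q r s P f -> chart_eq p' q' r' s P (change_chart f).
Proof.
move=> idP LP [P1 P2]; split.
  move=> g /P1[n [bg [k ek]]]; exists n; split=> //; exists (change_chart k).
  transitivity (change_chart (@clr K 4 _ (cst2 K) coord n g)).
    rewrite (@clr_morph K 4 _ _ (cst2 K) change_chart coord n g).
    apply: (@eq_clr K 4 _ (cst2 K)) => [x|j] /=.
      by apply/esym; exact: ev2C.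
    by apply/esym; exact: change_chart_coord.
  by rewrite ek; exact: ev2M.
have e : chart_emb K p' q' s (change_chart f) =
    ev2 (cst K) (chart_emb K p' q' s (coord' p)) (chart_emb K p' q' s (coord' q)) f.
  by apply: ev2_comp => c; exact: chart_embC.
apply: (idealB_mem idP _ P2); rewrite e.
by apply: (ev2_congr _ _ idP); apply: (chart_emb_coord pqrs' _ idP LP).
Qed.

End ChartTransfer.

Section Reversal.
Variable K : fieldType.
Implicit Types (f : {poly {poly K}}) (D : nat).

Definition tbounded D f := forall i j, f`_i`_j != 0 -> (i + j <= D)%N.

Lemma tbounded_exists f : exists D, tbounded D f.
Proof.
have [D bf] := bounded_exists f; exists (D + D)%N => i j /bf[h1 h2]; lia.
Qed.

(* Passing from [x_p/x_s], [x_q/x_s] to [x_p/x_q], [x_s/x_q] reverses a polynomial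
   of total degree at most [D]. *)
Definition rev_poly2 D f : {poly {poly K}} :=
  \poly_(i < D.+1) \poly_(j < D.+1) if (i + j <= D)%N then f`_i`_(D - i - j) else 0.

Lemma rev_poly2_coef D f i j :
  (rev_poly2 D f)`_i`_j = if (i + j <= D)%N then f`_i`_(D - i - j) else 0.
Proof.
rewrite /rev_poly2 coef_poly; case: ifP => iD; last by rewrite coef0; case: ifP => //; lia.
by rewrite coef_poly; case: ifP => // jD; case: ifP => //; lia.
Qed.

Lemma ev2_rev_poly2 D f (B : comNzRingType) (iota : {rmorphism K -> B}) x y yi :
  tbounded D f -> y * yi = 1 ->
  ev2 iota x y (rev_poly2 D f) = y ^+ D * ev2 iota (x * yi) yi f.
Proof.
move=> bf yyi; have b1 : bounded D.+1 f by move=> i j /bf; lia.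
have b2 : bounded D.+1 (rev_poly2 D f).
  by move=> i j; rewrite rev_poly2_coef; case: ifP => [h _|]; [lia|rewrite eqxx].
rewrite (ev2_sum _ _ _ b1) (ev2_sum _ _ _ b2) mulr_sumr; apply: eq_bigr => i _.
have iD : (i <= D)%N by rewrite -ltnS.
have sub n (F : nat -> B) : (forall j, (j + i > D)%N -> F j = 0) -> n = (D - i).+1 ->
    \sum_(j < D.+1) F j = \sum_(j < n) F j.
  move=> F0 ->; rewrite [RHS](big_ord_widen D.+1); last by lia.
  rewrite [RHS]big_mkcond; apply: eq_bigr => j _; case: ifP => // ji.
  by apply: F0; lia.
rewrite (sub (D - i).+1 (fun j => iota (rev_poly2 D f)`_i`_j * (x ^+ i * y ^+ j))) //; last first.
  by move=> j ji; rewrite rev_poly2_coef; case: ifP => [|_]; [lia|rewrite rmorph0 mul0r].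
rewrite mulr_sumr (sub (D - i).+1 (fun j => y ^+ D * (iota f`_i`_j * ((x * yi) ^+ i * yi ^+ j)))) //; last first.
  move=> j ji; have -> : f`_i`_j = 0 by apply/eqP; apply: contraTT ji => /bf; lia.
  by rewrite rmorph0 mul0r mulr0.
rewrite (reindex_inj rev_ord_inj); apply: eq_bigr => -[j jD] _ /=.
rewrite subSS rev_poly2_coef ifT; last by lia.
have -> : (D - i - (D - i - j) = j)%N by lia.
rewrite [RHS]mulrCA; congr (_ * _); rewrite exprMn -[X in _ = _ * X]mulrA [RHS]mulrCA; congr (_ * _).
have -> : y ^+ D = y ^+ (D - i - j) * (y ^+ i * y ^+ j) by rewrite -!exprD; congr (_ ^+ _); lia.
by rewrite -mulrA mulrACA -!exprMn yyi !expr1n !mulr1.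
Qed.

End Reversal.

(** In degree 0 a common factor of the coordinates cancels, except for what clearing adds: one [u^n]
    for each of the four coordinates. *)
Lemma clr_scale (K : fieldType) (B : comNzRingType) (iota : {rmorphism K -> B}) z u n
    (g : laurent0 K 4) : bounded_below n g ->
  clr iota (fun c => z c * u) n g = u ^+ (4 * n) * clr iota z n g.
Proof.
move=> bg; rewrite /clr mulr_sumr big_seq [RHS]big_seq; apply: eq_bigr => v vg.
rewrite mulrCA; congr (_ * _).
rewrite (eq_bigr (fun c => z c ^+ `|(v 0 c + n%:Z)%R| * u ^+ `|(v 0 c + n%:Z)%R|)); last first.
  by move=> c _; rewrite exprMn.
rewrite big_split /= mulrC; congr (_ * _); rewrite prodrXr; congr (_ ^+ _).
apply/eqP; rewrite -eqz_nat -[X in X == _]natz natr_sum.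
rewrite (eq_bigr (fun c => v 0 c + n%:Z)); last first.
  by move=> c _; rewrite natz gez0_abs //; exact: bg.
rewrite big_split /=; have := elimT (deg0P _) (valP g) v vg; rewrite /expo_deg => ->.
by rewrite sumr_const card_ord add0r -mulr_natr natz mulrC PoszM.
Qed.

Section ReverseChart.
Variables (K : fieldType) (p q r s : 'I_4).
Hypotheses (pqrs : uniq [:: p; q; r; s]) (psrq : uniq [:: p; s; r; q]).
Local Notation coord := (chart_coord K p q r).
Local Notation coord' := (chart_coord K p s r).
Local Notation KXY := {poly {poly K}}.
Local Notation Fr := {fraction KXY}.

Definition frac_cst : {rmorphism K -> Fr} := (@tofrac KXY) \o (cst2 K).
Let tX : Fr := tofrac ('X : KXY).
Let tY : Fr := tofrac ('X%:P : KXY).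
Definition rev_hom : {rmorphism KXY -> Fr} := ev2 frac_cst (tX / tY) (tY^-1).

Let tY0 : tY != 0.
Proof. by rewrite /tY tofrac_eq0 polyC_eq0 polyX_eq0. Qed.

Lemma ev2_frac G : ev2 frac_cst tX tY G = tofrac G.
Proof.
have := @ev2_comp K _ _ (cst2 K) frac_cst (@tofrac KXY : {rmorphism _ -> _}) 'X 'X%:P G (fun=> erefl).
by rewrite ev2_id.
Qed.

Lemma rev_hom_poly D f : tbounded D f -> tofrac (rev_poly2 D f) = tY ^+ D * rev_hom f.
Proof.
by move=> bf; rewrite -ev2_frac (ev2_rev_poly2 (yi := tY^-1) _ _ bf) // divff.
Qed.

Lemma rev_hom_coord j : rev_hom (coord j) = tofrac (coord' j) / tY.
Proof.
move: j; apply: (four_cases pqrs); rewrite {1}/chart_coord.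
- by rewrite four1 [LHS]ev2X /chart_coord four1.
- by rewrite (four2 pqrs) [LHS]ev2Y /chart_coord (four4 psrq) rmorph1 mul1r.
- rewrite (four3 pqrs) [LHS]ev2N 2!ev2D ev21 ev2X ev2Y /chart_coord (four3 psrq).
  rewrite rmorphN 2!rmorphD rmorph1 /= -/tX -/tY mulNr !mulrDl mul1r divff //.
  by congr (- _); rewrite [LHS]addrAC [1 + _]addrC [LHS]addrAC.
- by rewrite (four4 pqrs) [LHS]ev21 /chart_coord (four2 psrq) divff.
Qed.

(** Exchanging the denominators [x_s] and [x_q] divides by [Y]. The divisibility by [f] is therefore
    transported in the fraction field and multiplied back by powers of [Y]. *)
Lemma chart_reverse (P : set (laurent0 K 4)) D f : is_ideal P -> @L0 K `<=` P ->
  tbounded D f -> chart_eq p q r s P f -> chart_eq p s r q P (rev_poly2 D f).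
Proof.
move=> idP LP bf [P1 P2]; split; last first.
  rewrite /chart_emb (ev2_rev_poly2 (yi := xquot K q s) _ _ bf) ?xqV // xqM.
  exact: (idealMl idP).
move=> g /P1[n [bg [k ek]]].
have [Dk bk] := tbounded_exists k.
have e1 : rev_hom (@clr K 4 _ (cst2 K) coord n g) =
    tY^-1 ^+ (4 * n) * tofrac (@clr K 4 _ (cst2 K) coord' n g).
  rewrite (@clr_morph K 4 _ _ (cst2 K) rev_hom coord n g).
  rewrite (@clr_morph K 4 _ _ (cst2 K) (@tofrac KXY : {rmorphism _ -> _}) coord' n g).
  rewrite -clr_scale //; apply: eq_clr => [x|j] /=; first by rewrite [LHS]ev2C.
  exact: rev_hom_coord.
have e2 : @clr K 4 _ (cst2 K) coord' n g * 'X%:P ^+ (Dk + D) =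
   rev_poly2 Dk k * rev_poly2 D f * 'X%:P ^+ (4 * n).
  apply/eqP; rewrite -tofrac_eq; apply/eqP.
  rewrite 3!tofracM 2!tofracXn -/tY.
  rewrite (rev_hom_poly bk) (rev_hom_poly bf).
  have -> : tofrac (@clr K 4 _ (cst2 K) coord' n g) = tY ^+ (4 * n) * (rev_hom k * rev_hom f).
    have <- : rev_hom (@clr K 4 _ (cst2 K) coord n g) = rev_hom k * rev_hom f by rewrite ek; exact: ev2M.
    by rewrite e1 mulrA -exprMn divff // expr1n mul1r.
  rewrite exprD; move: (rev_hom k) (rev_hom f) (tY ^+ Dk) (tY ^+ D) (tY ^+ (4 * n)) => x y z t u.
  by ring.
(* Clearing by [Dk + D] more multiplies by that power of the product of the coordinates, which
   supplies the power of [Y] on the left of [e2]. *)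
exists ((Dk + D) + n)%N; split; first exact: bounded_belowW (leq_addl _ _) bg.
rewrite clrS //.
have -> : \prod_j coord' j = 'X%:P * ('X * - (1 + 'X + 'X%:P)).
  rewrite (prod_four psrq) /chart_coord four1 (four2 psrq) (four3 psrq) (four4 psrq).
  by rewrite mulr1 -mulrA [RHS]mulrCA.
exists (('X * - (1 + 'X + 'X%:P)) ^+ (Dk + D) * (rev_poly2 Dk k * 'X%:P ^+ (4 * n))).
rewrite exprMn [X in X * _]mulrC -mulrA [X in _ * X]mulrC e2 -[RHS]mulrA.
by congr (_ * _); exact: mulrAC.
Qed.

End ReverseChart.

Lemma uniq4_ikjl (T : eqType) (i j k l : T) : uniq [:: i; j; k; l] -> uniq [:: i; k; j; l].
Proof. by rewrite (@perm_uniq _ _ [:: i; k; j; l]) //; apply/permP => x /=; lia. Qed.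

Lemma uniq4_jkil (T : eqType) (i j k l : T) : uniq [:: i; j; k; l] -> uniq [:: j; k; i; l].
Proof. by rewrite (@perm_uniq _ _ [:: j; k; i; l]) //; apply/permP => x /=; lia. Qed.

Lemma uniq4_iljk (T : eqType) (i j k l : T) : uniq [:: i; j; k; l] -> uniq [:: i; l; j; k].
Proof. by rewrite (@perm_uniq _ _ [:: i; l; j; k]) //; apply/permP => x /=; lia. Qed.

(** * The congruence for one curve *)

Section CurveCongruence.
Variables (K : fieldType) (R : realType) (i j k l : 'I_4).
Hypothesis closedK : splits K.
Hypothesis ijkl : uniq [:: i; j; k; l].
Local Notation KXY := {poly {poly K}}.
Local Notation Y := ('X%:P : KXY).
Local Notation Z := (- (1 + 'X + 'X%:P) : KXY).

Lemma ev2_coef0 (y : {poly K}) (G : KXY) : ev2 polyC 0 y G = ev1 polyC y G`_0.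
Proof.
elim/poly_ind: G => [|G q IH]; first by rewrite ev20 coef0 rmorph0.
by rewrite ev2D ev2M ev2X mulr0 add0r ev2P coefD coefMX coefC /= add0r.
Qed.

Lemma coef0_ev2 (x y : KXY) (G : KXY) : (ev2 (cst2 K) x y G)`_0 = ev2 polyC x`_0 y`_0 G.
Proof.
rewrite -!horner_coef0.
have := @ev2_comp K _ _ (cst2 K) polyC (horner_eval 0 : {rmorphism KXY -> {poly K}}) x y G.
by rewrite /= /horner_eval => -> // c; rewrite hornerC.
Qed.

Lemma ev1_comp (y q : {poly K}) : ev1 polyC y q = q \Po y.
Proof.
elim/poly_ind: q => [|q c IH]; first by rewrite rmorph0 comp_poly0.
by rewrite comp_poly_MXaddC -IH rmorphD rmorphM /= ev1X ev1C.
Qed.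

Lemma comp_poly_exp1 (y : {poly K}) n : (('X + 1) ^+ n) \Po y = (y + 1) ^+ n.
Proof. by rewrite rmorphXn rmorphD /= comp_polyX rmorph1. Qed.

Lemma ev_at0_coef (G : KXY) m : (ev_at 0 G)`_m = G`_m`_0.
Proof.
rewrite /ev_at; elim/poly_ind: G m => [|G q IH] m; first by rewrite ev20 !coef0.
rewrite ev2D ev2M ev2X ev2P !coefD !coefMX coefC.
have e : ev1 polyC 0%:P q = (q`_0)%:P.
  by rewrite -horner_coef0; have := ev_atC 0 q; rewrite /ev_at ev2P.
rewrite e coefC; case: m => [|m] /=; first by rewrite !coef0 !add0r.
by rewrite IH !coef0 !addr0.
Qed.

Lemma bottom_row (G : KXY) : (forall m, G <> m * Y) -> exists m, G`_m`_0 != 0.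
Proof.
move=> nd; apply: contrapT => no; have /ev_at_dvd[m em] : ev_at 0 G = 0.
  apply/polyP => m; rewrite ev_at0_coef coef0; apply/eqP.
  by apply: contrapT => /negP h; apply: no; exists m.
by apply: (nd m); rewrite em !polyC0 subr0.
Qed.

Lemma left_column (G : KXY) : (forall m, G <> m * 'X) -> G`_0 != 0.
Proof.
move=> nd; apply/eqP => G0; apply: (nd (drop_poly 1 G)).
rewrite -[LHS](poly_take_drop 1 G) expr1 -[RHS]add0r; congr (_ + _).
by apply/polyP => -[|m]; rewrite coef_take_poly coef0 //.
Qed.

Lemma order_exists (h : {poly K}) : h != 0 ->
  exists n, h`_n != 0 /\ forall m, (m < n)%N -> h`_m = 0.
Proof.
move=> h0; have ex : exists m, h`_m != 0.
  by exists (size h).-1; rewrite -lead_coefE lead_coef_eq0.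
exists (ex_minn ex); case: ex_minnP => m hm mn; split=> // m' lt; apply/eqP.
by apply: contraTT lt => /mn; rewrite -leqNgt.
Qed.

Variable P : set (laurent0 K 4).
Hypothesis curveP : curve_in_E P.
Local Notation w := (weight R).
Hypothesis trop_i : forall q, q != i -> trop_mult P (w i q 1 0) = 0%E.
Hypothesis trop_j : forall q, q != j -> trop_mult P (w j q 1 0) = 0%E.
Hypothesis trop_ij : forall a b, coprime a b -> (0 < a)%N -> (0 < b)%N ->
  trop_mult P (w i j a b) = 0%E.
Hypothesis trop_ik : forall a b, coprime a b -> (0 < a)%N -> (0 < b)%N -> (b <= a)%N ->
  trop_mult P (w i k a b) = 0%E.
Hypothesis trop_il : forall a b, coprime a b -> (0 < a)%N -> (0 < b)%N -> (b <= a)%N ->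
  trop_mult P (w i l a b) = 0%E.

Let idP : is_ideal P. Proof. by case: curveP => -[]. Qed.
Let LP : @L0 K `<=` P. Proof. by case: curveP. Qed.

Let perm1 : uniq [:: i; k; j; l].
Proof. exact: uniq4_ikjl ijkl. Qed.
Let perm2 : uniq [:: j; k; i; l].
Proof. exact: uniq4_jkil ijkl. Qed.
Let perm3 : uniq [:: i; l; j; k].
Proof. exact: uniq4_iljk ijkl. Qed.

Lemma edge_polynomial : exists f, [/\ chart_eq i k j l P f, f != 0 &
  [/\ forall m, f <> m * 'X, forall m, f <> m * Y & forall m, f <> m * Z]].
Proof.
have [f [Pf f0 nd]] := chart_generator closedK perm1 curveP.
exists f; split=> //.
have /andP[nl _] : (l \notin [:: i; k; j]) && uniq [:: i; k; j].
  by rewrite -rcons_uniq.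
have ne c : c \in [:: i; k; j] -> c != l by move=> ci; apply: contraNneq nl => <-.
split=> m e.
- apply: (nd i m); first by rewrite ne ?inE ?eqxx.
  by rewrite /chart_coord four1.
- apply: (nd k m); first by rewrite ne ?inE ?eqxx ?orbT.
  by rewrite /chart_coord (four2 perm1).
- apply: (nd j m); first by rewrite ne ?inE ?eqxx ?orbT.
  by rewrite /chart_coord (four3 perm1).
Qed.

Let ZE (x y : KXY) : ev2 (cst2 K) x y Z = - (1 + x + y).
Proof. by rewrite ev2N 2!ev2D ev21 ev2X ev2Y. Qed.

Let Z_invol : - (1 + 'X + Z) = Y.
Proof. by move: 'X Y => x y; ring. Qed.

Let Z_invol' : - (1 + Z + Y) = 'X :> KXY.
Proof. by move: 'X Y => x y; ring. Qed.

Let Z0 : Z`_0 = - (1 + 'X).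
Proof. by rewrite coefN !coefD coef1 coefX coefC addr0. Qed.

(** After [axis_roots] only a factor [(Y + 1)^ka] is in doubt. On [X = 0] the point [Y = -1] is
    where [x_j] vanishes. In the chart with [x_j/x_l] as second coordinate, [ka] is the order at the
    origin of the axis, and [no_vanishing] makes it 0 as cone([e_i],[e_j]) is avoided. *)
Lemma side_column f n : chart_eq i k j l P f -> f != 0 ->
  (forall m, f <> m * 'X) -> (forall m, f <> m * Z) ->
  f`_0`_n != 0 -> (forall m, (m < n)%N -> f`_0`_m = 0) ->
  exists2 al, al != 0 & f`_0 = al *: 'X^n.
Proof.
move=> Pf f0 ndX ndZ fn flt.
have ik : k != i by move: perm1; rewrite /= inE negb_or eq_sym => /andP[/andP[]].
have [al [ka e0]] := axis_roots closedK perm1 idP LP Pf fn flt (trop_i ik).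
have al0 : al != 0 by apply: contraNneq fn => al0; rewrite e0 al0 scale0r coef0.
pose om : {rmorphism KXY -> KXY} := ev2 (cst2 K) 'X Z.
have omom G : om (om G) = G.
  rewrite /om (ev2_comp (iota' := cst2 K) (rho := om)); last by move=> c; exact: ev2C.
  by rewrite /om ev2X ZE Z_invol ev2_id.
have ijkl' : uniq [:: i; j; k; l] by [].
have := chart_transfer perm1 ijkl' idP LP Pf.
rewrite /change_chart {1}/chart_coord four1 /chart_coord (four3 ijkl') -/om => PC.
pose h : {poly K} := (- (1 + 'X)) ^+ n * al%:P * (-1) ^+ ka.
have eC : (om f)`_0 = h * 'X^ka.
  rewrite coef0_ev2 coefX /= Z0 ev2_coef0 e0 ev1_comp comp_polyZ rmorphM /= comp_Xn_poly comp_poly_exp1.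
  rewrite -mul_polyC /h; have -> : - (1 + 'X) + 1 = -1 * 'X :> {poly K} by move: 'X => x; ring.
  by rewrite [(-1 * 'X) ^+ _]exprMn mulrCA !mulrA.
have eCka : (om f)`_0`_ka = h.[0] by rewrite eC coefMXn ltnn subnn horner_coef0.
have h0 : h.[0] != 0.
  by rewrite !hornerE !mulf_neq0 // expf_neq0 // oppr_eq0 oner_eq0.
have ka0 : ka = 0%N.
  apply: (no_vanishing closedK ijkl' idP LP PC _ _ trop_ij).
  - by rewrite eCka.
  - by move=> m mk; rewrite eC coefMXn mk.
  - apply: bottom_row => m em; apply: (ndZ (om m)).
    by rewrite -(omom f) em /om ev2M ev2Y.
by exists al => //; rewrite e0 ka0 expr0 mulr1.
Qed.

(* The coefficients [f`_1`_q] with [q < n] vanish by [tangency] in this chart, the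
   others by [tangency] in the chart with k and l exchanged. *)
Lemma second_column f n al : chart_eq i k j l P f -> al != 0 -> f`_0 = al *: 'X^n ->
  f`_1 = 0.
Proof.
move=> Pf al0 e0.
have c0 m : f`_0`_m = if m == n then al else 0.
  by rewrite e0 coefZ coefXn; case: ifP => _; rewrite ?mulr1 ?mulr0.
have fn : f`_0`_n != 0 by rewrite c0 eqxx.
have low q : (q < n)%N -> f`_1`_q = 0.
  move=> qn; apply: (tangency closedK perm1 idP LP Pf fn _ trop_ik) => //.
  by move=> m mn; rewrite c0 ltn_eqF.
have [D bf] := tbounded_exists f; have nD : (n <= D)%N := bf _ _ fn.
have Pf' := chart_reverse perm1 perm3 idP LP bf Pf.
have high q : (n <= q)%N -> f`_1`_q = 0.
  move=> nq; case: (leqP (1 + q) D) => qD; last first.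
    by apply/eqP; apply: contraTT qD => /bf; rewrite -leqNgt.
  have <- : (rev_poly2 D f)`_1`_(D - 1 - q) = f`_1`_q.
    by rewrite rev_poly2_coef ifT; [congr (_`__); lia | lia].
  (* Reversal turns the order [n] into [D - n] and the position [q] into [D - 1 - q]; the bound
     [1 + (D - 1 - q) <= D - n] is then [n <= q]. *)
  apply: (tangency closedK perm3 idP LP Pf' (n := D - n) _ _ trop_il) => //; last by lia.
  - by rewrite rev_poly2_coef ifT; [rewrite c0 ifT //; lia | lia].
  - by move=> m mn; rewrite rev_poly2_coef ifT; [rewrite c0 ifF //; lia | lia].
by apply/polyP => q; rewrite coef0; case: (ltnP q n) => [/low|/high].
Qed.

Lemma order_at_tangency (al be : K) n n' ka (G : {poly K}) : al != 0 ->
  al *: 'X^n + G * (1 + 'X) ^+ 2 = be *: ('X^n' * ('X + 1) ^+ ka) -> n%:R = n'%:R :> K.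
Proof.
move=> al0 e.
have s0 m : (-1) ^+ m != 0 :> K by rewrite expf_neq0 // oppr_eq0 oner_eq0.
have e1 : al * (-1) ^+ n = be * ((-1) ^+ n' * 0 ^+ ka).
  have := congr1 (horner^~ (-1)) e; rewrite /= hornerD !hornerZ !hornerM !horner_exp !hornerD hornerX hornerC.
  by rewrite subrr addNr !mulr0 addr0.
(* The left side of [e1] is not 0, so the factor [X + 1] cannot occur. *)
have ka0 : ka = 0%N.
  apply/eqP; apply: contraT => k0; move/eqP: e1.
  by rewrite expr0n (negPf k0) !mulr0 mulf_eq0 (negPf al0) (negPf (s0 n)).
rewrite ka0 !mulr1 in e e1.
(* The operator [X d/dX] multiplies [X^m] by [m], and the term with the factor [(1 + X)^2]
   contributes nothing at -1. *)
have e2 : (al * (-1) ^+ n) * n%:R = (be * (-1) ^+ n') * n'%:R.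
  have X1 m : ('X * ('X^m)^`()).[-1] = (-1) ^+ m * m%:R :> K.
    case: m => [|m]; first by rewrite derivXn mulr0n mulr0 horner0 mulr0.
    by rewrite derivXn mulrnAr -exprS mulr_natr hornerMn horner_exp hornerX.
  have := congr1 (fun h => ('X * h^`()).[-1]) e.
  have u0 : (1 + 'X : {poly K}).[-1] = 0 by rewrite hornerD hornerX hornerC subrr.
  rewrite /= derivD !derivZ expr2 mulrA derivM mulrDr hornerD -scalerAr hornerZ X1.
  rewrite [X in _ + X]hornerM hornerD [(_ * (1 + 'X)).[_]]hornerM u0 mulr0 add0r.
  rewrite [(_ * _^`()).[_]]hornerM hornerM u0 mulr0 mul0r mulr0 addr0.
  by rewrite -scalerAr hornerZ X1 !mulrA.
by move: e2; rewrite -e1; apply: mulfI; rewrite mulf_neq0.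
Qed.

Lemma curve_congruence (W1 W2 : seq (nat * nat)) (N1 N2 : nat * nat -> nat) :
  uniq W1 -> uniq W2 ->
  (forall x, x \in W1 -> [/\ coprime x.1 x.2, (0 < x.1)%N & (0 < x.2)%N]) ->
  (forall x, x \in W2 -> [/\ coprime x.1 x.2, (0 < x.1)%N & (0 < x.2)%N]) ->
  (forall a b, coprime a b -> (0 < a)%N -> (0 < b)%N ->
    trop_mult P (w i k a b) != 0%E -> (a, b) \in W1) ->
  (forall a b, coprime a b -> (0 < a)%N -> (0 < b)%N ->
    trop_mult P (w j k a b) != 0%E -> (a, b) \in W2) ->
  (forall x, x \in W1 -> trop_mult P (w i k x.1 x.2) = ((N1 x)%:R)%:E) ->
  (forall x, x \in W2 -> trop_mult P (w j k x.1 x.2) = ((N2 x)%:R)%:E) ->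
  (\sum_(x <- W1) x.1 * N1 x)%N%:R = (\sum_(x <- W2) x.1 * N2 x)%N%:R :> K.
Proof.
move=> u1 u2 c1 c2 t1 t2 m1 m2.
have [f [Pf f0 [ndX ndY ndZ]]] := edge_polynomial.
have [n [fn flt]] := order_exists (left_column ndX).
have [al al0 e0] := side_column Pf f0 ndX ndZ fn flt.
have e1 := second_column Pf al0 e0.
(* The two charts differ by the involution exchanging [x_i/x_l] and [x_j/x_l], that is, [X] and
   [-(1 + X + Y)]. *)
pose om : {rmorphism KXY -> KXY} := ev2 (cst2 K) Z Y.
have omom G : om (om G) = G.
  rewrite /om (ev2_comp (iota' := cst2 K) (rho := om)); last by move=> c; exact: ev2C.
  have omZ : om Z = 'X by rewrite /om ZE Z_invol'.
  have omY : om Y = Y by rewrite /om ev2Y.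
  by rewrite omZ omY ev2_id.
have := chart_transfer perm1 perm2 idP LP Pf.
rewrite /change_chart /chart_coord (four3 perm2) (four2 perm2) -/om => PB.
have ndX' m : om f <> m * 'X.
  by move=> em; apply: (ndZ (om m)); rewrite -(omom f) em /om ev2M ev2X.
have ndY' m : om f <> m * Y.
  by move=> em; apply: (ndY (om m)); rewrite -(omom f) em /om ev2M ev2Y.
have [n' [fn' flt']] := order_exists (left_column ndX').
have jk : k != j by move: perm2; rewrite /= inE negb_or eq_sym => /andP[/andP[]].
have [be [ka eB]] := axis_roots closedK perm2 idP LP PB fn' flt' (trop_j jk).
have fE : f = (al *: 'X^n)%:P + drop_poly 2 f * 'X^2.
  rewrite -[LHS](poly_take_drop 2 f); congr (_ + _).
  by apply/polyP => -[|[|m]]; rewrite coef_take_poly coefC //= e1.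
(* On the new axis the old [X] becomes [-(1 + Y)], so the multiple of [X^2] in [f] becomes a
   multiple of [(1 + Y)^2]. *)
have eB' : (om f)`_0 = al *: 'X^n + (ev2 polyC Z`_0 'X (drop_poly 2 f)) * (1 + 'X) ^+ 2.
  rewrite coef0_ev2 coefC /= {1}fE ev2D ev2P ev1_comp comp_polyXr; congr (_ + _).
  by rewrite [LHS]ev2M [ev2 _ _ _ 'X^2]ev2Xn ev2X Z0 sqrrN.
rewrite (trop_height closedK perm1 idP LP Pf fn flt u1 c1 t1 m1 (bottom_row ndY)).
rewrite (trop_height closedK perm2 idP LP PB fn' flt' u2 c2 t2 m2 (bottom_row ndY')).
exact: order_at_tangency al0 (etrans (esym eB') eB).
Qed.

End CurveCongruence.

(** * Rays of tropical curves *)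

Section Rays.
Variable R : realType.
Implicit Types (v g h : 'rV[int]_4) (w : 'rV[R]_4) (p q : 'I_4).
Local Notation emb := (map_mx (intr : int -> R)).

Lemma in_cone1 v (t : R) : 0 <= t -> cone [:: v] (t *: emb v).
Proof.
move=> t0; exists (fun=> t), 0; split=> //; rewrite big_seq1.
by apply/rowP => c; rewrite !mxE addr0.
Qed.

Lemma in_cone2 g h (x y : R) : g != h -> 0 <= x -> 0 <= y ->
  cone [:: g; h] (x *: emb g + y *: emb h).
Proof.
move=> gh x0 y0; exists (fun u => if u == g then x else y), 0; split.
  by move=> u; case: ifP.
rewrite big_cons big_seq1 eqxx eq_sym (negPf gh); apply/rowP => c.
by rewrite !mxE addr0.
Qed.

Lemma min0_ge0 v : min0 v -> forall c, 0 <= v 0 c. Proof. by case. Qed.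

Lemma primitive_positive v : min0 v -> primitive_class v -> exists c, 0 < v 0 c.
Proof.
move=> [v0 _] pv; apply: contrapT => no; suff : 0 = 1 :> nat by [].
apply: (pv 0 0); exists 0; apply/rowP => c; rewrite mulr0n !mxE addr0.
apply/eqP; rewrite eq_le v0 andbT leNgt; apply/negP => vc; apply: no.
by exists c.
Qed.

Lemma primitive_multiple v v' (a b : nat) : primitive_class v -> coprime b a -> (0 < b)%N ->
  v' *+ b = v *+ a -> b = 1%N.
Proof.
move=> pv cba b0 e.
have dv c : (b%:Z %| v 0%R c)%Z.
  rewrite -(@Gauss_dvdzr b%:Z a%:Z) //.
  have /rowP/(_ c) := e; rewrite mulmxnE [in RHS]mulmxnE -[LHS]mulr_natl -[RHS]mulr_natl 2!natz => <-.
  by rewrite dvdz_mulr.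
apply: (pv b (\row_c (v 0%R c %/ b%:Z)%Z)); exists 0; apply/rowP => c.
by rewrite [RHS]mxE [const_mx _ _ _]mxE addr0 mulmxnE mxE -mulr_natr natz divzK.
Qed.

(** Both representatives have minimal coordinate 0, which forces [s = 0]. Then [b v' = a v] with
    coprime [a] and [b], so [b] divides [v], [a] divides [v'], and primitivity gives [a = b = 1]. *)
Lemma cone_ray v v' : min0 v -> primitive_class v -> min0 v' -> primitive_class v' ->
  cone [:: v] (emb v') -> v = v'.
Proof.
move=> m0 pv m0' pv' [t [s [t0 e]]]; move: e; rewrite big_seq1.
move: (t v) (t0 v) => {t0}t t0 /rowP e.
have {}e c : (v' 0 c)%:~R = t * (v 0 c)%:~R + s :> R by have := e c; rewrite !mxE.
have v0 c : 0 <= (v 0 c)%:~R :> R by rewrite ler0z min0_ge0.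
have v0' c : 0 <= (v' 0 c)%:~R :> R by rewrite ler0z min0_ge0.
have s0 : s = 0.
  have [_ [c1 z1]] := m0; have [_ [c2 z2]] := m0'.
  apply/eqP; rewrite eq_le; apply/andP; split.
    by have := e c2; rewrite z2 => /eqP; rewrite eq_sym addrC addr_eq0 => /eqP->; rewrite oppr_le0 mulr_ge0.
  by have := v0' c1; rewrite e z1 mulr0 add0r.
have {}e c : (v' 0 c)%:~R = t * (v 0 c)%:~R :> R by rewrite e s0 addr0.
have [c' vc'] := primitive_positive m0' pv'.
have tv : 0 < t * (v 0 c')%:~R by rewrite -e ltr0z.
have vc : 0 < v 0 c' by rewrite lt0r min0_ge0 // andbT; apply: contraTneq tv => ->; rewrite mulr0 ltxx.
have cross c : v' 0 c * v 0 c' = v 0 c * v' 0 c'.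
  by apply/eqP; rewrite -(eqr_int R) !intrM !e; apply/eqP; ring.
pose x := absz (v 0 c'); pose x' := absz (v' 0 c').
have x0 : (0 < x)%N by rewrite /x; lia.
have x0' : (0 < x')%N by rewrite /x'; lia.
have [b [a [gb ga cba]]] : exists b a, [/\ x = b * gcdn x x', x' = a * gcdn x x' & coprime b a]%N.
  exists (x %/ gcdn x x')%N, (x' %/ gcdn x x')%N; split.
  - by rewrite divnK // dvdn_gcdl.
  - by rewrite divnK // dvdn_gcdr.
  - rewrite /coprime -(eqn_pmul2r (m := gcdn x x')) ?gcdn_gt0 ?x0 // mul1n muln_gcdl.
    by rewrite !divnK ?dvdn_gcdl ?dvdn_gcdr.
have g0 : (0 < gcdn x x')%N by rewrite gcdn_gt0 x0.
have eab : v' *+ b = v *+ a.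
  apply/rowP => c; rewrite mulmxnE [RHS]mulmxnE.
  have g0' : (gcdn x x')%:Z != 0 by lia.
  apply: (mulIf g0'); rewrite -[v' _ _ *+ _]mulr_natr -[v _ _ *+ _]mulr_natr 2!natz -!mulrA -!PoszM -gb -ga.
  by rewrite /x /x' !gez0_abs ?min0_ge0 //; exact: cross.
have b1 : b = 1%N by apply: (primitive_multiple pv cba _ eab); move: x0; rewrite gb; case: (b).
have a1 : a = 1%N.
  apply: (primitive_multiple pv' _ _ (esym eab)); first by rewrite coprime_sym.
  by move: x0'; rewrite ga; case: (a).
by move: eab; rewrite a1 b1.
Qed.

End Rays.

Section Fan.
Variables (R : realType) (C : weighted_fan).
Hypothesis hC : tropical_curve R C.
Implicit Types (v : 'rV[int]_4) (p q k : 'I_4).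
Local Notation emb := (map_mx (intr : int -> R)).

Lemma fan_min0 v : v \in finsupp C -> min0 v.
Proof. by case: hC => h _ _ /h[]. Qed.

Lemma fan_primitive v : v \in finsupp C -> primitive_class v.
Proof. by case: hC => h _ _ /h[]. Qed.

Lemma fan_mult_ray v : min0 v -> primitive_class v -> fan_mult C (emb v) = C v.
Proof.
move=> m0 pv; rewrite /fan_mult big_seq_cond.
rewrite (eq_bigl (fun u => (u \in finsupp C) && (u == v))); last first.
  move=> u; case: (boolP (u \in finsupp C)) => //= uC; apply/asboolP/eqP.
    exact: cone_ray (fan_min0 uC) (fan_primitive uC) m0 pv.
  by move=> ->; have := @in_cone1 R v 1 ler01; rewrite scale1r.
rewrite -big_seq_cond; case: (boolP (v \in finsupp C)) => vC.
  rewrite big_mkcond (bigD1_seq v vC (fset_uniq _)) eqxx big1 => [|u /negPf->] //; exact: addn0.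
rewrite big_seq_cond big1; first by rewrite fsfun_dflt.
by move=> u /andP[uC /eqP uv]; move: vC; rewrite -uv uC.
Qed.

Lemma fan_mult_avoid gs (w : 'rV[R]_4) : ~ intersects R C gs -> cone gs w ->
  ~ cone [::] w -> fan_mult C w = 0%N.
Proof.
move=> avoid gw nw; rewrite /fan_mult big_seq_cond big1 // => v /andP[vC /asboolP cv].
by exfalso; apply: avoid; exists w; split=> //; right; exists v.
Qed.

(** [PC C] is a set of vectors; injectivity allows a sum over it to be read as a sum over the
    rays. *)
Lemma PC_inj : {in finsupp C &, injective (fun v => v *+ C v)}.
Proof.
move=> v v' vC vC' e; apply/esym.
apply: (@cone_ray R _ _ (fan_min0 vC') (fan_primitive vC') (fan_min0 vC) (fan_primitive vC)).
have c0 : (C v)%:R != 0 :> R by rewrite pnatr_eq0 -mem_finsupp.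
have := @in_cone1 R v' ((C v)%:R^-1 * (C v')%:R).
rewrite mulr_ge0 ?invr_ge0 ?ler0n // => /(_ isT).
congr (cone _ _); apply/rowP => c; rewrite mxE [emb v' 0 c]mxE [RHS]mxE -mulrA.
apply: (mulfI c0); rewrite mulVKf //.
have /rowP/(_ c) := e; rewrite mulmxnE [in RHS]mulmxnE => /(congr1 (fun x : int => x%:~R : R)).
by rewrite 2!raddfMn /= 2!mulr_natl => ->.
Qed.

Definition edge_vec p k v :=
  [&& v == v 0 p *: evec p + v 0 k *: evec k, 0 < v 0 p & 0 < v 0 k].

Definition edge_sum p k (N : 'rV[int]_4 -> nat) :=
  (\sum_(v <- finsupp C | edge_vec p k v) absz (v 0%R p) * N v)%N.

(** Vectors with [a = 0] contribute nothing, and those with [b = 0] lie on the ray of [e_p], which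
    is excluded. Only rays in the interior of the cone remain. *)
Lemma first_coef_sum_edge p k : p != k ->
  (forall v, v \in finsupp C -> v = v 0 p *: evec p -> v 0 p <= 0) ->
  first_coef_sum C p k = (edge_sum p k C)%:Z.
Proof.
move=> pk avoid; rewrite /first_coef_sum /PC big_mkcond /= big_imfset /=; last exact: PC_inj.
rewrite /edge_sum big_seq [in RHS]big_mkcond -natz natr_sum [RHS]big_seq; apply: eq_bigr => v vC.
have C0 : (0 < C v)%N by rewrite lt0n -mem_finsupp.
have v0 c := min0_ge0 (fan_min0 vC) c.
rewrite !mulmxnE.
have -> : (v *+ C v == v 0 p *+ C v *: evec p + v 0 k *+ C v *: evec k) =
          (v == v 0 p *: evec p + v 0 k *: evec k).
  rewrite -2!scalerMnl -mulrnDl; apply/eqP/eqP => [/rowP h|{1}-> //].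
  apply/rowP => c; have := h c; rewrite mulmxnE [in RHS]mulmxnE; exact: pmulrnI.
rewrite /edge_vec; case: eqP => //= ev.
case: (ltP 0 (v 0 p)) => /= hp; last first.
  by rewrite (_ : v 0 p = 0) ?mul0rn //; apply/eqP; rewrite eq_le hp v0.
case: (ltP 0 (v 0 k)) => /= hk.
  by rewrite natz PoszM gez0_abs // -mulr_natr natz.
have k0 : v 0 k = 0 by apply/eqP; rewrite eq_le hk v0.
have := avoid v vC; rewrite {1}ev k0 scale0r addr0 => /(_ erefl).
by rewrite leNgt hp.
Qed.

Lemma first_coef_sum_le d p k : has_degree C d -> first_coef_sum C p k <= d%:Z.
Proof.
move=> /rowP/(_ p); rewrite summxE [RHS]mxE => <-; rewrite /first_coef_sum.
rewrite [leRHS](bigID (fun v => v == v 0 p *: evec p + v 0 k *: evec k)) /= lerDl.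
rewrite big_seq_cond; apply: sumr_ge0 => v /andP[/imfsetP[u /= uC ->] _].
by rewrite mulmxnE mulrn_wge0 // min0_ge0 //; exact: fan_min0.
Qed.

End Fan.

Section Weights.
Variable R : realType.
Implicit Types p q : 'I_4.
Local Notation emb := (map_mx (intr : int -> R)).

Lemma weight_rays p q a b :
  weight R p q a b = a%:R *: emb (evec p) + b%:R *: emb (evec q).
Proof.
apply/rowP => c; rewrite !mxE eqxx /=.
by case: (c == p); case: (c == q); rewrite /= ?mulr1z ?mulr0z ?mulr1 ?mulr0.
Qed.

Lemma third_index p q : exists2 r : 'I_4, r != p & r != q.
Proof.
have /card_gt0P[r] : (0 < #|[predC pred2 p q]|)%N.
  rewrite lt0n; apply/eqP => e0; have := cardC (pred2 p q).
  by rewrite card2 card_ord e0; case: (_ != _).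
by rewrite !inE negb_or => /andP[]; exists r.
Qed.

Lemma weight_not_origin p q a b : p != q -> (0 < a)%N -> ~ cone [::] (weight R p q a b).
Proof.
move=> pq a0 [t [s [_]]]; rewrite big_nil add0r => /rowP e.
have [r rp rq] := third_index p q.
have := e r; have := e p; rewrite !mxE eqxx (negPf pq) (negPf rp) (negPf rq) => <-.
rewrite !mulr0n mulr1n !addr0 => /eqP; rewrite eq_sym pnatr_eq0 => /eqP z.
by rewrite z in a0.
Qed.

Lemma edge_vec_weight p q v : edge_vec p q v -> 
  weight R p q (absz (v 0 p)) (absz (v 0 q)) = emb v.
Proof.
case/and3P=> /eqP e vp vq; rewrite weight_rays [in RHS]e.
rewrite map_mxD !map_mxZ !natr_absz !gtr0_norm //.
Qed.

End Weights.

Lemma closed_splits (K : closedFieldType) : splits K.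
Proof. by move=> h; have [rs e] := closed_field_poly_normal h; exists rs. Qed.

Lemma loc_length_ge0 (A : comNzRingType) (R : realType) (J Q : set A) :
  is_prime Q -> (0 <= loc_length R J Q)%E.
Proof.
move=> [idQ Q1 Qp]; apply: ereal_sup_ubound; exists 0%N => //.
exists (fun=> [set x | ~ Q x.2]); split=> // _ _; split=> //=.
- by move=> x y Qx Qy; case/Qp.
- by move=> c t x Qt Qx; case/Qp.
Qed.

Lemma trop_mult_ge0 (K : fieldType) (R : realType) (P : set (laurent0 K 4)) (w : 'rV[R]_4) :
  (0 <= trop_mult P w)%E.
Proof. by apply: esum_ge0 => Q [[pQ _] _]; exact: loc_length_ge0. Qed.

Lemma edge_vec_coprime p k v : primitive_class v -> edge_vec p k v ->
  coprime (absz (v 0 p)) (absz (v 0 k)).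
Proof.
move=> pv /and3P[/eqP e _ _]; set g := gcdn (absz (v 0 p)) (absz (v 0 k)).
have gp : (g%:Z %| v 0%R p)%Z by rewrite dvdzE dvdn_gcdl.
have gk : (g%:Z %| v 0%R k)%Z by rewrite dvdzE dvdn_gcdr.
apply/eqP; apply: (pv g (\row_c (v 0%R c %/ g%:Z)%Z)); exists 0; apply/rowP => c.
rewrite [RHS]mxE [const_mx _ _ _]mxE addr0 mulmxnE mxE -mulr_natr natz divzK //.
by rewrite e !mxE rpredD // dvdz_mulr.
Qed.

Lemma edge_vec_intro p k a b : p != k -> coprime a b -> (0 < a)%N -> (0 < b)%N ->
  let v := a%:Z *: evec p + b%:Z *: evec k in
  [/\ min0 v, primitive_class v, edge_vec p k v, v 0 p = a%:Z & v 0 k = b%:Z].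
Proof.
move=> pk cab a0 b0 v.
have vp : v 0 p = a%:Z by rewrite !mxE !eqxx (negPf pk) mulr1 mulr0 addr0.
have vk : v 0 k = b%:Z by rewrite !mxE !eqxx eq_sym (negPf pk) mulr1 mulr0 add0r.
have [r rp rk] := third_index p k.
have vr : v 0 r = 0 by rewrite !mxE (negPf rp) (negPf rk) !andbF !mulr0 addr0.
split=> //.
- split; last by exists r.
  by move=> c; rewrite !mxE addr_ge0 // mulr_ge0.
- move=> n v' [s /rowP e]; apply/eqP; rewrite -dvdn1 -(eqP cab) dvdn_gcd.
  have := e r; rewrite vr [RHS]mxE mulmxnE mxE -mulr_natr natz => er.
  have es : s = - (v' 0 r * n%:Z) by apply/eqP; rewrite -addr_eq0 addrC -er.
  have := e p; rewrite vp [RHS]mxE mulmxnE mxE -mulr_natr natz => ep.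
  have := e k; rewrite vk [RHS]mxE mulmxnE mxE -mulr_natr natz => ek.
  apply/andP; split; rewrite -[X in is_true X]/(n%:Z %| _%:Z)%Z.
    by rewrite ep es -mulrBl dvdz_mull.
  by rewrite ek es -mulrBl dvdz_mull.
- by rewrite /edge_vec vp vk eqxx /=; lia.
Qed.

(** * From curves to cycles *)

Section Realization.
Variables (R : realType) (K : closedFieldType) (C : weighted_fan).
Hypothesis hC : tropical_curve R C.
Variable Y : seq (nat * set (laurent0 K 4)).
Hypothesis curveY : forall y, y \in Y -> curve_in_E y.2.
Hypothesis tropY : forall w : 'rV[R]_4, ~ cone [::] w ->
  cycle_trop_mult Y w = ((fan_mult C w)%:R)%:E.
Local Notation emb := (map_mx (intr : int -> R)).

(** Multiplicities are non-negative, so components of an effective cycle cannot cancel: where [C]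
    vanishes, each component with positive coefficient does. *)
Lemma curve_avoids y (w : 'rV[R]_4) : y \in Y -> (0 < y.1)%N -> ~ cone [::] w -> fan_mult C w = 0%N ->
  trop_mult y.2 w = 0%E.
Proof.
move=> yY y0 nw Cw; have := tropY nw; rewrite Cw => /eqP.
rewrite /cycle_trop_mult seq_psume_eq0; last first.
  by move=> z _; rewrite mule_ge0 // ?lee_fin ?ler0n // trop_mult_ge0.
move=> /allP/(_ y yY) /=; rewrite mule_eq0 => /orP[|/eqP //].
by rewrite eqe pnatr_eq0 => /eqP e; rewrite e in y0.
Qed.

(** Tropical multiplicities are extended reals; [mult_natE] shows that on the interior rays used
    below they are natural numbers, which truncation recovers. *)
Definition mult_nat (P : set (laurent0 K 4)) (w : 'rV[R]_4) := Num.truncn (fine (trop_mult P w)).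

Lemma mult_natE P p k r s a b : curve_in_E P -> uniq [:: p; k; r; s] -> coprime a b ->
  (0 < a)%N -> (0 < b)%N ->
  trop_mult P (weight R p k a b) = ((mult_nat P (weight R p k a b))%:R)%:E.
Proof.
move=> cP pkrs cab a0 b0; have [f [Pf f0 _]] := chart_generator (@closed_splits K) pkrs cP.
have [[idP _ _] _ LP] := cP.
have [N [e _]] := trop_face R (@closed_splits K) pkrs idP LP Pf f0 cab a0 b0.
rewrite /mult_nat e /=; congr ((_%:R)%:E); apply/esym; apply: truncn_def.
by rewrite lexx ltr_nat ltnSn.
Qed.

Lemma fan_coef p k r s v : uniq [:: p; k; r; s] -> v \in finsupp C -> edge_vec p k v ->
  C v = (\sum_(y <- Y) y.1 * mult_nat y.2 (emb v))%N.
Proof.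
move=> pkrs vC ev; have pk : p != k by move: pkrs; rewrite /= inE negb_or => /andP[/andP[]].
have /and3P[_ vp vk] := ev.
have cv := edge_vec_coprime (fan_primitive hC vC) ev.
have v0 : (0 < absz (v 0%R p))%N by rewrite absz_gt0 gt_eqF.
have := tropY (@weight_not_origin R p k _ (absz (v 0 k)) pk v0).
rewrite (edge_vec_weight R ev) (fan_mult_ray hC (fan_min0 hC vC) (fan_primitive hC vC)).
rewrite /cycle_trop_mult big_seq (eq_bigr (fun y => ((y.1 * mult_nat y.2 (emb v))%N%:R)%:E)).
  rewrite -big_seq sumEFin -natr_sum => h; apply/eqP; rewrite -(eqr_nat R).
  by case: h => ->.
move=> y yY; rewrite natrM EFinM -(edge_vec_weight R ev); congr (_ * _)%E.
by apply: (mult_natE (curveY yY) pkrs cv); lia.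
Qed.

Lemma edge_sum_cycle p k r s : uniq [:: p; k; r; s] ->
  edge_sum C p k C = (\sum_(y <- Y) y.1 * edge_sum C p k (fun v => mult_nat y.2 (emb v)))%N.
Proof.
move=> pkrs; rewrite /edge_sum.
under [RHS]eq_bigr do rewrite big_distrr /=.
rewrite exchange_big /= big_seq_cond [RHS]big_seq_cond; apply: eq_bigr => v /andP[vC ev].
rewrite {1}(fan_coef pkrs vC ev) big_distrr /=; apply: eq_bigr => y _.
by rewrite mulnCA.
Qed.

Definition edge_rays p k :=
  [seq (absz (v 0 p), absz (v 0 k)) | v : 'rV[int]_4 <- [seq v <- finsupp C | edge_vec p k v]].

Lemma edge_rays_uniq p k : uniq (edge_rays p k).
Proof.
rewrite map_inj_in_uniq ?filter_uniq ?fset_uniq // => u v.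
rewrite !mem_filter => /andP[/and3P[/eqP eu up uk] _] /andP[/and3P[/eqP ev vp vk] _] [ep ek].
rewrite eu ev; congr (_ *: _ + _ *: _); lia.
Qed.

Lemma edge_rays_coprime p k x : x \in edge_rays p k ->
  [/\ coprime x.1 x.2, (0 < x.1)%N & (0 < x.2)%N].
Proof.
move=> /mapP[v]; rewrite mem_filter => /andP[ev vC] ->.
have /and3P[_ vp vk] := ev; split=> /=; [|lia|lia].
exact: edge_vec_coprime (fan_primitive hC vC) ev.
Qed.

(** A component with positive coefficient has no rays outside [C], so the rays of [C] form a common
    index list for all components. *)
Lemma edge_rays_complete p k y a b : p != k -> y \in Y -> (0 < y.1)%N ->
  coprime a b -> (0 < a)%N -> (0 < b)%N ->
  trop_mult y.2 (weight R p k a b) != 0%E -> (a, b) \in edge_rays p k.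
Proof.
move=> pk yY y0 cab a0 b0 tn0; have [m0 pv ev vp vk] := edge_vec_intro pk cab a0 b0.
set v := _ + _ in m0 pv ev vp vk.
apply/mapP; exists v; last by rewrite vp vk.
rewrite mem_filter ev /= mem_finsupp; apply: contraNneq tn0 => Cv.
apply/eqP; apply: (curve_avoids yY y0); first exact: weight_not_origin.
by have := edge_vec_weight R ev; rewrite vp vk => ->; rewrite fan_mult_ray.
Qed.

Lemma edge_rays_sum p k P : (\sum_(x <- edge_rays p k) x.1 * mult_nat P (weight R p k x.1 x.2))%N =
  edge_sum C p k (fun v => mult_nat P (emb v)).
Proof.
rewrite /edge_rays big_map big_filter; apply: eq_bigr => v ev.
by rewrite edge_vec_weight.
Qed.

Variables (i j k l : 'I_4).
Hypothesis ijkl : uniq [:: i; j; k; l].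
Hypothesis hij : ~ intersects R C [:: evec i; evec j].
Hypothesis hik : ~ intersects R C [:: evec i; evec i + evec k].
Hypothesis hil : ~ intersects R C [:: evec i; evec i + evec l].

Let evec_inj (p q : 'I_4) : p != q -> evec p != evec q.
Proof.
move=> pq; apply/eqP => /rowP/(_ p); rewrite !mxE !eqxx (negPf pq) //.
Qed.

Let cone_ij (a b : nat) : i != j -> cone [:: evec i; evec j] (weight R i j a b).
Proof. by move=> ij; rewrite weight_rays; apply: in_cone2 (evec_inj ij) _ _. Qed.

Let cone_i (q : 'I_4) a h : evec i != h -> cone [:: evec i; h] (weight R i q a 0).
Proof.
move=> ih; rewrite weight_rays scale0r addr0 -[X in cone _ X]addr0 -(scale0r (emb h)).
exact: in_cone2.
Qed.

Let cone_j (q : 'I_4) a : i != j -> cone [:: evec i; evec j] (weight R j q a 0).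
Proof.
move=> ij; rewrite weight_rays scale0r addr0 -[X in cone _ X]add0r -(scale0r (emb (evec i))).
by apply: in_cone2; rewrite ?evec_inj.
Qed.

(** For [b <= a], write [a e_i + b e_q = (a - b) e_i + b (e_i + e_q)]. *)
Let cone_half (q : 'I_4) a b : i != q -> (b <= a)%N ->
  cone [:: evec i; evec i + evec q] (weight R i q a b).
Proof.
move=> iq ba; rewrite weight_rays -{1}(subnK ba) natrD scalerDl -addrA -scalerDr.
rewrite -map_mxD; apply: in_cone2 => //.
apply/eqP => /rowP/(_ q); rewrite !mxE !eqxx (eq_sym q) (negPf iq) //.
Qed.

Let ij : i != j.
Proof. by move: ijkl; rewrite /= !inE !negb_or => /andP[/and3P[]]. Qed.
Let ik : i != k.
Proof. by move: ijkl; rewrite /= !inE !negb_or => /andP[/and3P[]]. Qed.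
Let il : i != l.
Proof. by move: ijkl; rewrite /= !inE !negb_or => /andP[/and3P[]]. Qed.
Let jk : j != k.
Proof. by move: ijkl; rewrite /= !inE !negb_or => /and3P[_ /andP[]]. Qed.
Let ikjl : uniq [:: i; k; j; l].
Proof. exact: uniq4_ikjl ijkl. Qed.
Let jkil : uniq [:: j; k; i; l].
Proof. exact: uniq4_jkil ijkl. Qed.

Let curve_congruence_Y y : y \in Y -> (0 < y.1)%N ->
  (edge_sum C i k (fun v => mult_nat y.2 (emb v)))%:R =
  (edge_sum C j k (fun v => mult_nat y.2 (emb v)))%:R :> K.
Proof.
move=> yY y0; rewrite -2!edge_rays_sum.
have zero gs (w : 'rV[R]_4) : ~ intersects R C gs -> ~ cone [::] w -> cone gs w -> trop_mult y.2 w = 0%E.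
  by move=> av nw cw; apply: (curve_avoids yY y0) => //; exact: fan_mult_avoid av cw nw.
have ti q : q != i -> trop_mult y.2 (weight R i q 1 0) = 0%E.
  move=> qi; apply: (zero _ _ hij); last exact: cone_i (evec_inj ij).
  by apply: weight_not_origin; rewrite // eq_sym.
have tj q : q != j -> trop_mult y.2 (weight R j q 1 0) = 0%E.
  move=> qj; apply: (zero _ _ hij); last exact: cone_j.
  by apply: weight_not_origin; rewrite // eq_sym.
have tij a b : coprime a b -> (0 < a)%N -> (0 < b)%N -> trop_mult y.2 (weight R i j a b) = 0%E.
  by move=> _ a0 _; apply: (zero _ _ hij); [exact: weight_not_origin | exact: cone_ij].
have tik a b : coprime a b -> (0 < a)%N -> (0 < b)%N -> (b <= a)%N ->
    trop_mult y.2 (weight R i k a b) = 0%E.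
  by move=> _ a0 _ ba; apply: (zero _ _ hik); [exact: weight_not_origin | exact: cone_half].
have til a b : coprime a b -> (0 < a)%N -> (0 < b)%N -> (b <= a)%N ->
    trop_mult y.2 (weight R i l a b) = 0%E.
  by move=> _ a0 _ ba; apply: (zero _ _ hil); [exact: weight_not_origin | exact: cone_half].
apply: (curve_congruence (@closed_splits K) ijkl (curveY yY) ti tj tij tik til
  (N1 := fun x => mult_nat y.2 (weight R i k x.1 x.2))
  (N2 := fun x => mult_nat y.2 (weight R j k x.1 x.2))).
- exact: edge_rays_uniq.
- exact: edge_rays_uniq.
- exact: edge_rays_coprime.
- exact: edge_rays_coprime.
- by move=> a b; exact: edge_rays_complete.
- by move=> a b; exact: edge_rays_complete.
- by move=> x /edge_rays_coprime[]; exact: mult_natE (curveY yY) ikjl.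
- by move=> x /edge_rays_coprime[]; exact: mult_natE (curveY yY) jkil.
Qed.

Lemma edge_sum_congruence : (edge_sum C i k C)%:R = (edge_sum C j k C)%:R :> K.
Proof.
rewrite (edge_sum_cycle ikjl) (edge_sum_cycle jkil) !natr_sum big_seq [RHS]big_seq.
(* A curve with coefficient 0 is not constrained by [C], so the congruence may fail for it, but it
   contributes 0 to both sums. *)
apply: eq_bigr => y yY; rewrite !natrM; case: (posnP y.1) => [->|y0]; first by rewrite !mul0r.
by rewrite curve_congruence_Y.
Qed.

Let no_axis p v : p = i \/ p = j -> v \in finsupp C -> v = v 0 p *: evec p -> v 0 p <= 0.
Proof.
move=> pij vC ev; rewrite leNgt; apply/negP => vp; apply: hij.
have e : emb v = weight R p (if p == i then j else i) (absz (v 0 p)) 0.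
  by rewrite weight_rays scale0r addr0 [in LHS]ev map_mxZ natr_absz gtr0_norm.
exists (emb v); split.
- by right; exists v => //; have := @in_cone1 R v 1 ler01; rewrite scale1r.
- by rewrite e; case: pij => ->; [exact: cone_i (evec_inj ij) | exact: cone_j].
- rewrite e; apply: weight_not_origin; last by lia.
  by case: pij => ->; rewrite ?eqxx // [j == i]eq_sym (negPf ij) eq_sym.
Qed.

Lemma first_coef_sums :
  first_coef_sum C i k = (edge_sum C i k C)%:Z /\ first_coef_sum C j k = (edge_sum C j k C)%:Z.
Proof.
split; apply: (first_coef_sum_edge hC) => // v; apply: no_axis; by [left | right].
Qed.

End Realization.

(** The bounds give [|m - n| < d], and a positive integer below [d] is not 0 in [K], since a
    positive characteristic is at least [d]. *)
Lemma natr_eq_small (K : fieldType) (m n d : nat) :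
  [pchar K] =i pred0 \/ (exists2 p, p \in [pchar K] & (d <= p)%N) ->
  (0 < m < d)%N -> (n <= d)%N -> m%:R = n%:R :> K -> m = n.
Proof.
move=> ch md nd e; apply/eqP.
have z a b : (a <= b)%N -> a%:R = b%:R :> K -> (b - a)%:R = 0 :> K.
  by move=> ab ab'; rewrite natrB // ab' subrr.
have small a : (a < d)%N -> a%:R = 0 :> K -> a = 0%N.
  move=> ad a0; case: ch => [/GRing.pcharf0P ch0|[p pK dp]].
    by apply/eqP; rewrite -ch0 a0.
  move/eqP: a0; rewrite -(GRing.dvdn_pcharf pK) => /dvdnP[[|c] ec]; first by rewrite ec.
  by move: ec; rewrite mulSn; lia.
case: (leqP m n) => mn.
  by have := small _ _ (z _ _ mn e); lia.
by have := small _ _ (z _ _ (ltnW mn) (esym e)); lia.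
Qed.

Theorem proposition5p20 (R : realType) (K : closedFieldType)
    (C : weighted_fan) (d : nat) (i j k l : 'I_4)
    (hC : tropical_curve R C)
    (hd : has_degree C d)
    (hchar : [pchar K] =i pred0 \/ exists2 p, p \in [pchar K] & (d <= p)%N)
    (hijkl : uniq [:: i; j; k; l])
    (hij : ~ intersects R C [:: evec i; evec j])
    (hik : ~ intersects R C [:: evec i; evec i + evec k])
    (hil : ~ intersects R C [:: evec i; evec i + evec l])
    (hc12 : first_coef_sum C j k <> first_coef_sum C i k)
    (hc2 : 0 < first_coef_sum C i k < d%:Z) :
  ~ realizable_in_L R K C.
Proof.
move=> [Y [curveY tropY]]; apply: hc12.
have cong := edge_sum_congruence hC curveY tropY hijkl hij hik hil.
have [e1 e2] := first_coef_sums hC hijkl hij.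
have := first_coef_sum_le hC j k hd; rewrite e1 e2 in hc2 *; rewrite lez_nat => le.
congr (_%:Z); apply/esym/(natr_eq_small hchar _ le cong).
by move: hc2; rewrite !ltz_nat.
Qed.
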